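(* For every even integer $n\ge 4$ there exist a point $p\in\mathbb{R}^n$ and a complete, nonflat, smooth Riemannian metric $g$ on $\mathbb{R}^n$ with nonnegative sectional curvature, admitting a minimal positive Green function, such that $g$ is Euclidean in a neighborhood of $p$ and, for the normalized minimal positive Green function $G$ of $(\mathbb{R}^n,g)$ with pole $p$ and $b=G^{1/(2-n)}$, the function $|\nabla b|^2$ admits a smooth extension across $p$.
   Context: $\Delta=\operatorname{div}\nabla$ with respect to $g$, and $r(x)=d(p,x)$. The minimal positive Green function with pole $p$ is normalized by $-\Delta G(p,\cdot)=(n-2)|\mathbb{S}^{n-1}|\,\delta_p$ (distributionally) and $G(p,x)=r(x)^{2-n}(1+o(1))$ as $x\to p$. *)

(* Defs.v *)
From HB Require Import structures.
From mathcomp Require Import all_boot all_order all_algebra.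
From mathcomp Require Import all_classical all_reals all_analysis.

Set Implicit Arguments.
Unset Strict Implicit.
Unset Printing Implicit Defensive.

Import Order.TTheory GRing.Theory Num.Theory.
Import numFieldNormedType.Exports.

Local Open Scope classical_set_scope.
Local Open Scope ring_scope.

(* Lebesgue measure on R^n, as an iterated product measure on n.-tuple R
   (the type on which the library puts the product sigma-algebra). *)
Section lebesgue_tuple.
Context {R : realType}.
Local Notation RT := (measurableTypeR R).

Definition cons_tuple n (x : RT * n.-tuple RT) : n.+1.-tuple RT :=
  [tuple of x.1 :: x.2].

Definition uncons_tuple n (t : n.+1.-tuple RT) : RT * n.-tuple RT :=
  (thead t, [tuple of behead t]).

Lemma cons_tupleK n : cancel (@cons_tuple n) (@uncons_tuple n).
Proof. by case=> x t; congr pair; exact/val_inj. Qed.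

Lemma measurable_cons_tuple n : measurable_fun setT (@cons_tuple n).
Proof. exact: measurable_cons. Qed.

Lemma measurable_uncons_tuple n : measurable_fun setT (@uncons_tuple n).
Proof.
apply/measurable_fun_pairP; split; first exact: measurable_tnth.
exact: measurable_behead.
Qed.

Section step.
Context (n : nat) (mu : {sigma_finite_measure set (n.-tuple RT) -> \bar R}).

Definition lebesgue_cons : set (n.+1.-tuple RT) -> \bar R :=
  pushforward (lebesgue_measure \x mu)%E (@cons_tuple n).

Let lebesgue_cons0 : lebesgue_cons set0 = 0%E.
Proof. by rewrite /lebesgue_cons /pushforward preimage_set0 measure0. Qed.

Let lebesgue_cons_ge0 A : (0 <= lebesgue_cons A)%E.
Proof. exact: (measure_ge0 (lebesgue_measure \x mu)%E). Qed.

Let lebesgue_cons_sigma_additive : semi_sigma_additive lebesgue_cons.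
Proof.
have := @measure_semi_sigma_additive _ _ _
  (pushforward (lebesgue_measure \x mu)%E (@cons_tuple n)).
by apply; exact: measurable_cons_tuple.
Qed.

HB.instance Definition _ := isMeasure.Build _ _ _ lebesgue_cons
  lebesgue_cons0 lebesgue_cons_ge0 lebesgue_cons_sigma_additive.

Let lebesgue_cons_sigma_finite : sigma_finite setT lebesgue_cons.
Proof.
have /sigma_finiteP[F [TF ndF Foo]] := sigma_finiteT (@lebesgue_measure R).
have /sigma_finiteP[G [TG ndG Goo]] := sigma_finiteT mu.
exists (fun k => @uncons_tuple n @^-1` (F k `*` G k)).
  rewrite -preimage_bigcup (_ : \bigcup_k _ = setT) ?preimage_setT//.
  apply/seteqP; split=> // -[x y] _.
  have [i _ Fix] : (\bigcup_k F k) x by rewrite -TF.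
  have [j _ Gjy] : (\bigcup_k G k) y by rewrite -TG.
  exists (maxn i j) => //; split.
  - by move: x Fix; exact/subsetPset/ndF/leq_maxl.
  - by move: y Gjy; exact/subsetPset/ndG/leq_maxr.
move=> k; have [mF Fk] := Foo k; have [mG Gk] := Goo k.
have mFG : measurable (F k `*` G k) by exact: measurableX.
split; first by rewrite -[X in measurable X]setTI; exact: measurable_uncons_tuple.
rewrite /lebesgue_cons /pushforward -comp_preimage.
rewrite (_ : _ \o _ = id) ?preimage_id; last first.
  by apply/funext => x; exact: cons_tupleK.
by rewrite product_measure1E// lte_mul_pinfty// ge0_fin_numE.
Qed.

HB.instance Definition _ := Measure_isSigmaFinite.Build _ _ _ lebesgue_cons
  lebesgue_cons_sigma_finite.

End step.

Fixpoint lebesgue_tuple n : {sigma_finite_measure set (n.-tuple RT) -> \bar R} :=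
  match n with
  | 0 => \d_([tuple] : 0.-tuple RT)
  | n'.+1 => lebesgue_cons (lebesgue_tuple n')
  end.

End lebesgue_tuple.

Section calculus.
Context {R : realType} {n : nat}.
Implicit Types (f : 'rV[R]_n -> R) (U : set 'rV[R]_n).

Definition partial (i : 'I_n) f : 'rV[R]_n -> R :=
  fun x => 'D_(delta_mx 0 i) f x.

Definition iter_partial (s : seq 'I_n) f : 'rV[R]_n -> R := foldr partial f s.

(* C^oo on U, meaningful for open U: all iterated partial derivatives exist
   and are continuous. *)
Definition smooth_on U f := forall (s : seq 'I_n) x, U x ->
  {for x, continuous (iter_partial s f)} /\
  forall i, derivable (iter_partial s f) x (delta_mx 0 i).

Definition test_function f :=
  smooth_on setT f /\ compact (closure [set x | f x != 0]).

(* (n - 1)-dimensional measure of the unit sphere of R^n: the polar-coordinate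
   surface measure sigma(E) = n |{r w : w in E, 0 < r <= 1}| at E = S^(n-1). *)
Definition sphere_area : R :=
  n%:R * fine (lebesgue_tuple n
    [set t : n.-tuple (measurableTypeR R) | \sum_i tnth t i ^+ 2 <= 1]).

Definition row_of_tuple (t : n.-tuple (measurableTypeR R)) : 'rV[R]_n :=
  \row_i tnth t i.

End calculus.

Section riemannian.
Context {R : realType} {n : nat}.
Local Notation pt := 'rV[R]_n.
Implicit Types (g : pt -> 'M[R]_n) (x y p u v w : pt) (f : pt -> R).

(* g x is the matrix of the metric in the standard global chart of R^n *)
Definition riemannian_metric g :=
  [/\ forall i j, smooth_on setT (fun x => g x i j),
      forall x, (g x)^T = g x &
      forall x v, v != 0 -> 0 < (v *m g x *m v^T) 0 0].

Definition euclidean_near g p := \forall x \near p, g x = 1%:M.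

Definition inner g x u v : R := (u *m g x *m v^T) 0 0.

Definition christoffel g x (k i j : 'I_n) : R :=
  2^-1 * \sum_l invmx (g x) k l *
    (partial i (fun y => g y j l) x + partial j (fun y => g y i l) x
     - partial l (fun y => g y i j) x).

(* R(d_i, d_j) d_k = \sum_l riemann_coef g x l i j k d_l, where
   R(X, Y) Z = D_X D_Y Z - D_Y D_X Z - D_[X, Y] Z *)
Definition riemann_coef g x (l i j k : 'I_n) : R :=
  partial i (fun y => christoffel g y l j k) x
  - partial j (fun y => christoffel g y l i k) x
  + \sum_m (christoffel g x l i m * christoffel g x m j k
            - christoffel g x l j m * christoffel g x m i k).

Definition riemann g x u v w : pt :=
  \row_l \sum_i \sum_j \sum_k riemann_coef g x l i j k * u 0 i * v 0 j * w 0 k.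

Definition flat g := forall x u v w, riemann g x u v w = 0.

Definition sectional_curvature g x u v : R :=
  inner g x (riemann g x u v v) u /
  (inner g x u u * inner g x v v - inner g x u v ^+ 2).

Definition nonneg_sectional_curvature g := forall x u v,
  free [:: u; v] -> 0 <= sectional_curvature g x u v.

Definition C1_curve (c : R -> pt) :=
  (forall t, derivable c t 1) /\ continuous (derive1 c).

Definition arc_length g (c : R -> pt) : R :=
  \int[lebesgue_measure]_(t in `[0, 1])
    Num.sqrt (inner g (c t) (derive1 c t) (derive1 c t)).

(* Piecewise C^1 curves are lists of C^1 curves on [0, 1], consecutive ones
   sharing an endpoint; a C^1 curve on [0, 1] always extends to R, so the
   pieces are taken to be C^1 on R. *)
Fixpoint joins x y (s : seq (R -> pt)) : Prop :=
  if s is c :: s' then [/\ C1_curve c, c 0 = x & joins (c 1) y s'] else x = y.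

Definition rdist g x y : R :=
  inf [set \sum_(c <- s) arc_length g c | s in joins x y].

Definition complete_metric g := forall q : nat -> pt,
  (forall e, 0 < e -> exists N, forall i j, (N <= i)%N -> (N <= j)%N ->
     rdist g (q i) (q j) < e) ->
  exists l, rdist g (q i) l @[i --> \oo] --> (0 : R).

Definition grad g f : pt -> pt :=
  fun x => \row_i \sum_j invmx (g x) i j * partial j f x.

Definition grad_norm2 g f : pt -> R :=
  fun x => inner g x (grad g f x) (grad g f x).

Definition vol_density g : pt -> R := fun x => Num.sqrt (\det (g x)).

Definition divergence g (X : pt -> pt) : pt -> R :=
  fun x => (vol_density g x)^-1 *
    \sum_i partial i (fun y => vol_density g y * X y 0 i) x.

Definition laplacian g f : pt -> R := divergence g (grad g f).

(* integration over K against the Riemannian volume sqrt (det g) dx *)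
Definition vol_integrable g (K : set pt) f :=
  (lebesgue_tuple n).-integrable (row_of_tuple @^-1` K)
    (fun t => (f (row_of_tuple t) * vol_density g (row_of_tuple t))%:E).

Definition vol_integral g f : R :=
  \int[lebesgue_tuple n]_t (f (row_of_tuple t) * vol_density g (row_of_tuple t)).

(* - Delta G = (n - 2) |S^(n-1)| delta_p in the sense of distributions *)
Definition green_equation g p G :=
  (forall K, compact K -> vol_integrable g K G) /\
  forall phi, test_function phi ->
    - vol_integral g (fun x => G x * laplacian g phi x) =
    (n%:R - 2) * sphere_area (R := R) (n := n) * phi p.

(* G is a total function, but its value at the pole p plays no role. *)
Definition positive_green g p G :=
  [/\ smooth_on (~` [set p]) G,
      forall x, x != p -> 0 < G x,
      green_equation g p G &
      G x / rdist g p x ^- (n - 2) @[x --> p^'] --> (1 : R)].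

(* The competitors H carry the same normalization at p. *)
Definition minimal_green g p G :=
  positive_green g p G /\
  forall H, positive_green g p H -> forall x, x != p -> G x <= H x.

Definition smooth_extension_across p f :=
  exists2 F : pt -> R, smooth_on setT F & forall x, x != p -> F x = f x.

End riemannian.

(* Main.v *)
Require Import Defs.
From HB Require Import structures.
From mathcomp Require Import all_boot all_order all_algebra.
From mathcomp Require Import all_classical all_reals all_analysis.
From mathcomp Require Import measurable_realfun.
From mathcomp Require Import ring lra zify.

Set Implicit Arguments.
Unset Strict Implicit.
Unset Printing Implicit Defensive.

Import Order.TTheory GRing.Theory Num.Theory.
Import numFieldNormedType.Exports.

Local Open Scope classical_set_scope.
Local Open Scope ring_scope.

(** Let [n = 2 (m + 1)]. The metric is the rotationally symmetric, conformally flat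
    metric [conf(|x|^2) I] on [R^n], with [conf t = exp (- ramp (ln t) / 2)] and
    [ramp s = s exp (-1/s)] for [s > 0], [ramp s = 0] for [s <= 0]. Its factor is
    one for [t <= 1] and lies between [(1 + t)^-1] and one. The curvature is
    nonnegative because [ramp] is convex and nondecreasing, with slope at most one
    ([metric_nonneg]), and not zero because the convexity is strict for [s > 0].
    The metric is complete because the distance to the origin is at least
    [ln (1 + |x|)] ([rdist_ge], [metric_complete]).

    The Laplacian times the volume density is [sum_i d_i (conf^m d_i f)]
    ([laplacian_vol]), so a radial function [g(|x|^2)] is harmonic off the origin
    when [conf^m g' = - m t^-(m+1)]. The solution [g] that tends to zero at infinity
    is [t^-m + c] for [t <= 1], with a constant [c >= 0] ([green_profile_exists]).
    Hence [|x|^(n-2) G = 1 + c |x|^(2m)] near the pole: since [n] is even, this is a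
    polynomial in the coordinates. In [|grad b|^2] the powers of [|x|] cancel and a
    product of real powers of [|x|^(n-2) G] and of the conformal factor is left,
    which is smooth across the pole ([smooth_extension_grad]).

    It remains to see that [G = g(|x|^2)] is the minimal positive Green function.
    For the equation in the sense of distributions ([green_weak]), [G] is replaced
    inside the ball [|x|^2 < a] by a C^2 radial function whose Laplacian is a
    multiple of a tent-shaped function supported in the ball. By the divergence
    theorem all these tents have the same mass, and comparing their primitives with
    the indicator of the unit ball shows that this mass is the volume of the ball
    ([tent_mass]); this is how the area of the sphere appears without polar
    coordinates. The limit [a -> 0] is taken by dominated convergence, and tents of
    dyadic radii also bound the integral of the singularity.

    For minimality, let [H] be a competitor. Its equation, tested on functions
    supported off the pole, shows that it is harmonic there ([weak_harmonic]). By the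
    common normalisation, [G <= (1 + e) H] near the pole, while [G] tends to zero at
    infinity, so the minimum principle on annuli gives [G <= H] ([green_le]). Thus
    [G] is minimal, and every minimal Green function agrees with it off the pole
    ([minimal_green_unique]), which reduces the last assertion to [G]. *)

(** * Derivatives along a direction *)

Section directional.
Context {R : realType} {V : normedModType R}.
Implicit Types (f g : V -> R) (h : R -> R) (x v : V).

Lemma is_derive_lineP f x v (d : R) :
  is_derive x v f d <-> is_derive (0 : R) 1 (fun s : R => f (s *: v + x)) d.
Proof.
have E : 'D_v f x = 'D_1 (fun s : R => f (s *: v + x)) 0.
  rewrite /derive; set g1 := fun s => s^-1 *: _; set g2 := fun s => s^-1 *: _.
  suff -> : g1 = g2 by [].
  by apply/funext => s; rewrite /g1 /g2 /= addr0 scale0r add0r [_%:A]mulr1.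
split=> -[df ed].
- by split; [exact: (derivable1P f x v).1|rewrite -E].
- by split; [exact: (derivable1P f x v).2|rewrite E].
Qed.

Lemma is_derive_subst f x v (a b : R) : is_derive x v f a -> a = b ->
  is_derive x v f b.
Proof. by move=> fa <-. Qed.

Lemma is_deriveDf f g x v (a b : R) : is_derive x v f a -> is_derive x v g b ->
  is_derive x v (fun y => f y + g y) (a + b).
Proof. by move=> fa gb; exact: is_deriveD. Qed.

Lemma is_deriveMf f g x v (a b : R) : is_derive x v f a -> is_derive x v g b ->
  is_derive x v (fun y => f y * g y) (a * g x + f x * b).
Proof.
move=> fa gb; have := is_deriveM fa gb.
by rewrite addrC [X in X + _]mulrC.
Qed.

(** Only the restriction of [f] to a line matters, so the one-dimensional
    chain rule suffices and no total differentiability of [f] is needed. *)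
Lemma is_derive_comp_line f h x v (a b : R) :
  is_derive x v f a -> is_derive (f x) 1 h b ->
  is_derive x v (fun y => h (f y)) (b * a).
Proof.
move=> /is_derive_lineP fa hb; apply/is_derive_lineP.
apply: (@is_derive1_comp R h (fun s : R => f (s *: v + x)) 0 b a) => //.
by rewrite scale0r add0r.
Qed.

Lemma is_derive_sumf (I : Type) (r : seq I) (F : I -> V -> R) x v (d : I -> R) :
  (forall i, is_derive x v (F i) (d i)) ->
  is_derive x v (fun y => \sum_(i <- r) F i y) (\sum_(i <- r) d i).
Proof.
move=> Fd; elim: r => [|i r IH].
  rewrite big_nil (_ : (fun _ => _) = cst 0); first exact: is_derive_cst.
  by apply/funext => y; rewrite big_nil.
rewrite big_cons (_ : (fun _ => _) =
  fun y => F i y + \sum_(j <- r) F j y); first exact: is_deriveDf.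
by apply/funext => y; rewrite big_cons.
Qed.

End directional.

(** * Smooth functions on R^n *)

Section smoothness.
Context {R : realType} {n : nat}.
Local Notation pt := 'rV[R]_n.
Implicit Types (f g : pt -> R) (h : R -> R) (U : set pt).

Lemma is_derive_partial f (x : pt) i : derivable f x (delta_mx 0 i) ->
  is_derive x (delta_mx 0 i) f (partial i f x).
Proof. by move=> df; exact: DeriveDef. Qed.

Lemma partialE f (x : pt) i (d : R) : is_derive x (delta_mx 0 i) f d ->
  partial i f x = d.
Proof. by case. Qed.

(** Smoothness is defined by iterating partial derivatives from the outside;
    this finite-order version peels them off from the inside, which is what
    an induction on the order needs. *)
Fixpoint Ck (k : nat) U f : Prop :=
  if k is k'.+1 then
    (forall x, U x -> {for x, continuous f} /\
      forall i, derivable f x (delta_mx 0 i)) /\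
    forall i, Ck k' U (partial i f)
  else forall x, U x -> {for x, continuous f}.

Lemma smoothP U f : smooth_on U f <-> forall k, Ck k U f.
Proof.
split=> [sf k|Cf s].
  have : forall s x, U x -> {for x, continuous (iter_partial s f)} /\
      forall i, derivable (iter_partial s f) x (delta_mx 0 i) by [].
  elim: k f {sf} => [|k IH] f sf /=; first by move=> x Ux; have [] := sf [::] x Ux.
  split=> [x Ux|i]; first exact: (sf [::] x Ux).
  apply: IH => s x Ux; have := sf (rcons s i) x Ux.
  by rewrite /iter_partial foldr_rcons.
elim/last_ind: s f Cf => [|s i IH] f Cf x Ux; first by have [/(_ x Ux)] := Cf 1%N.
rewrite /iter_partial foldr_rcons; apply: IH => // k.
by have [_ /(_ i)] := Cf k.+1.
Qed.

Lemma Ck_cont k U f x : Ck k U f -> U x -> {for x, continuous f}.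
Proof. by case: k => [|k] => [Cf|[Cf _]] Ux; [exact: Cf|case: (Cf x Ux)]. Qed.

Lemma CkS k U f : Ck k.+1 U f -> Ck k U f.
Proof.
elim: k f => [|k IH] f [Cf Df]; first by move=> x Ux; case: (Cf x Ux).
by split; [exact: Cf|move=> i; exact: IH (Df i)].
Qed.

Lemma near_eq_cont f g (x : pt) : (\forall y \near x, f y = g y) ->
  {for x, continuous f} -> {for x, continuous g}.
Proof.
move=> fg cf; rewrite /prop_for /continuous_at -(nbhs_singleton fg).
exact: cvg_trans (near_eq_cvg fg) cf.
Qed.

Lemma near_eq_partial f g (x : pt) i : (\forall y \near x, f y = g y) ->
  partial i f x = partial i g x.
Proof. exact: near_eq_derive. Qed.

Lemma open_near U (P : pt -> Prop) x : open U -> U x ->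
  (forall y, U y -> P y) -> \forall y \near x, P y.
Proof. by move=> oU Ux UP; move: (open_nbhs_nbhs (conj oU Ux)); exact: filterS. Qed.

Lemma Ck_eq k U f g : open U -> (forall x, U x -> f x = g x) ->
  Ck k U f -> Ck k U g.
Proof.
move=> oU; elim: k f g => [|k IH] f g fg.
  move=> Cf x Ux; apply: near_eq_cont (Cf x Ux).
  exact: open_near oU Ux fg.
move=> [Cf Df]; split=> [x Ux|i]; last first.
  apply: IH (Df i) => x Ux; apply: near_eq_partial; exact: open_near oU Ux fg.
have fgx := open_near oU Ux fg; have [cf df] := Cf x Ux.
split; first exact: near_eq_cont cf.
by move=> i; exact: near_eq_derivable (df i).
Qed.

Lemma CkS_intro k U f (df : 'I_n -> pt -> R) : open U ->
  (forall x, U x -> {for x, continuous f}) ->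
  (forall i x, U x -> is_derive x (delta_mx 0 i) f (df i x)) ->
  (forall i, Ck k U (df i)) -> Ck k.+1 U f.
Proof.
move=> oU cf fd Cd; split=> [x Ux|i].
  by split; [exact: cf|move=> i; case: (fd i x Ux)].
by apply: Ck_eq (Cd i) => // x Ux; apply/esym/partialE/fd.
Qed.

Lemma Ck_derive k U f i x : Ck k.+1 U f -> U x ->
  is_derive x (delta_mx 0 i) f (partial i f x).
Proof. by case=> Cf _ Ux; case: (Cf x Ux) => _ df; exact: is_derive_partial. Qed.

Lemma Ck_cst k U (c : R) : open U -> Ck k U (fun=> c).
Proof.
move=> oU; elim: k c => [|k IH] c; first by move=> x _; exact: cst_continuous.
apply: (CkS_intro (df := fun _ _ => 0)) => //.
by move=> x _; exact: cst_continuous.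
Qed.

Lemma Ck_add k U f g : open U -> Ck k U f -> Ck k U g ->
  Ck k U (fun x => f x + g x).
Proof.
move=> oU; elim: k f g => [|k IH] f g Cf Cg.
  by move=> x Ux; exact: cvgD (Cf x Ux) (Cg x Ux).
apply: (CkS_intro (df := fun i x => partial i f x + partial i g x)) => //.
- by move=> x Ux; exact: cvgD (Ck_cont Cf Ux) (Ck_cont Cg Ux).
- by move=> i x Ux; exact: is_deriveDf (Ck_derive i Cf Ux) (Ck_derive i Cg Ux).
- by move=> i; apply: IH; [exact: (proj2 Cf i)|exact: (proj2 Cg i)].
Qed.

Lemma Ck_mul k U f g : open U -> Ck k U f -> Ck k U g ->
  Ck k U (fun x => f x * g x).
Proof.
move=> oU; elim: k f g => [|k IH] f g Cf Cg.
  by move=> x Ux; exact: cvgM (Cf x Ux) (Cg x Ux).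
apply: (CkS_intro (df := fun i x => partial i f x * g x + f x * partial i g x)) => //.
- by move=> x Ux; exact: cvgM (Ck_cont Cf Ux) (Ck_cont Cg Ux).
- by move=> i x Ux; exact: is_deriveMf (Ck_derive i Cf Ux) (Ck_derive i Cg Ux).
- move=> i; apply: Ck_add => //; apply: IH; (try exact: CkS).
  + exact: (proj2 Cf i).
  + exact: (proj2 Cg i).
Qed.

Lemma Ck_compS k U f h (h' : R -> R) : open U -> Ck k.+1 U f ->
  (forall x, U x -> is_derive (f x) 1 h (h' (f x))) ->
  Ck k U (fun x => h' (f x)) -> Ck k.+1 U (fun x => h (f x)).
Proof.
move=> oU Cf hd Ch'.
apply: (CkS_intro (df := fun i x => h' (f x) * partial i f x)) => //.
- move=> x Ux; apply: continuous_comp; first exact: (Ck_cont Cf).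
  have [dh _] := hd x Ux.
  by apply: differentiable_continuous; apply/derivable1_diffP.
- move=> i x Ux; exact: is_derive_comp_line (Ck_derive i Cf Ux) (hd x Ux).
- by move=> i; apply: Ck_mul => //; exact: (proj2 Cf i).
Qed.

Lemma smooth_eq U f g : open U -> (forall x, U x -> f x = g x) ->
  smooth_on U f -> smooth_on U g.
Proof. by move=> oU fg /smoothP Cf; apply/smoothP => k; exact: Ck_eq (Cf k). Qed.

Lemma smooth_cont U f x : smooth_on U f -> U x -> {for x, continuous f}.
Proof. by move=> sf Ux; case: (sf [::] x Ux). Qed.

Lemma smooth_derive U f x i : smooth_on U f -> U x ->
  is_derive x (delta_mx 0 i) f (partial i f x).
Proof. by move=> sf Ux; apply: is_derive_partial; case: (sf [::] x Ux). Qed.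

Lemma smooth_partial U f i : smooth_on U f -> smooth_on U (partial i f).
Proof. by move=> /smoothP Cf; apply/smoothP => k; exact: (proj2 (Cf k.+1) i). Qed.

Lemma smooth_sub U U' f : U `<=` U' -> smooth_on U' f -> smooth_on U f.
Proof. by move=> UU' sf s x /UU'; exact: sf. Qed.

Lemma smooth_setU U U' f : smooth_on U f -> smooth_on U' f ->
  smooth_on (U `|` U') f.
Proof. by move=> sf sf' s x [|]; [exact: sf|exact: sf']. Qed.

Lemma smooth_cst U (c : R) : open U -> smooth_on U (fun=> c).
Proof. by move=> oU; apply/smoothP => k; exact: Ck_cst. Qed.

Lemma smooth_add U f g : open U -> smooth_on U f -> smooth_on U g ->
  smooth_on U (fun x => f x + g x).
Proof. by move=> oU /smoothP Cf /smoothP Cg; apply/smoothP => k; exact: Ck_add. Qed.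

Lemma smooth_mul U f g : open U -> smooth_on U f -> smooth_on U g ->
  smooth_on U (fun x => f x * g x).
Proof. by move=> oU /smoothP Cf /smoothP Cg; apply/smoothP => k; exact: Ck_mul. Qed.

Lemma smooth_opp U f : open U -> smooth_on U f -> smooth_on U (fun x => - f x).
Proof.
move=> oU sf; apply: (smooth_eq oU _ (smooth_mul oU (smooth_cst (-1) oU) sf)).
by move=> x _; rewrite mulN1r.
Qed.

Lemma smooth_exp U f k : open U -> smooth_on U f -> smooth_on U (fun x => f x ^+ k).
Proof.
move=> oU sf; elim: k => [|k IH].
  by apply: (smooth_eq oU _ (smooth_cst 1 oU)) => x _; rewrite expr0.
by apply: (smooth_eq oU _ (smooth_mul oU sf IH)) => x _; rewrite exprS.
Qed.

Lemma smooth_sum U (I : Type) (r : seq I) (F : I -> pt -> R) : open U ->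
  (forall i, smooth_on U (F i)) -> smooth_on U (fun x => \sum_(i <- r) F i x).
Proof.
move=> oU sF; elim: r => [|i r IH].
  by apply: (smooth_eq oU _ (smooth_cst 0 oU)) => x _; rewrite big_nil.
by apply: (smooth_eq oU _ (smooth_add oU (sF i) IH)) => x _; rewrite big_cons.
Qed.

Lemma coord_cont (j : 'I_n) : continuous (fun x : pt => x 0 j).
Proof. by move=> x; apply: differentiable_continuous; exact: differentiable_coord. Qed.

Lemma is_derive_coord (x : pt) (i j : 'I_n) :
  is_derive x (delta_mx 0 i) (fun y : pt => y 0 j) (j == i)%:R.
Proof.
apply/is_derive_lineP.
have -> : (fun s : R => (s *: delta_mx 0 i + x) 0 j) =
    (fun s : R => s * (j == i)%:R + x 0 j).
  by apply/funext => s; rewrite !mxE eqxx.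
have d1 : is_derive (0 : R) 1 (fun s : R => s) 1 by exact: is_derive_id.
have d2 c : is_derive (0 : R) 1 (fun s : R => c) (0 : R) by exact: is_derive_cst.
have := is_deriveDf (is_deriveMf d1 (d2 (j == i)%:R)) (d2 (x 0 j)).
by rewrite mul1r mulr0 !addr0.
Qed.

Lemma smooth_coord U j : open U -> smooth_on U (fun x : pt => x 0 j).
Proof.
move=> oU; apply/smoothP => -[|k]; first by move=> x _; exact: coord_cont.
apply: (CkS_intro (df := fun i _ => (j == i)%:R)) => //.
- by move=> x _; exact: coord_cont.
- by move=> i x _; exact: is_derive_coord.
- by move=> i; exact: Ck_cst.
Qed.

(** One step of the induction on the order is enough, because the other factor of
    the chain rule is already smooth: only [h' \o f] has to be studied. *)
Lemma smooth_comp U f h (h' : R -> R) : open U -> smooth_on U f ->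
  (forall x, U x -> is_derive (f x) 1 h (h' (f x))) ->
  smooth_on U (fun x => h' (f x)) -> smooth_on U (fun x => h (f x)).
Proof.
move=> oU /smoothP Cf hd /smoothP Ch'; apply/smoothP => k.
exact: (CkS (Ck_compS oU (Cf k.+1) hd (Ch' k))).
Qed.

Lemma smooth_expR U f : open U -> smooth_on U f -> smooth_on U (fun x => expR (f x)).
Proof.
move=> oU /smoothP Cf; apply/smoothP; elim=> [|k IH].
  move=> x Ux; apply: continuous_comp; last exact: continuous_expR.
  exact: (Ck_cont (Cf 0%N)).
exact: (Ck_compS oU (Cf k.+1) (fun x _ => is_derive_expR _) IH).
Qed.

Lemma is_derive_inv (t : R) : t != 0 -> is_derive t 1 (fun s => s^-1) (- t^-1 ^+ 2).
Proof.
move=> t0; have dt : derivable (id : R -> R) t 1 by exact: derivable_id.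
apply: DeriveDef; first exact: derivableV.
by rewrite (deriveV t0 dt) derive_id [_ *: _]mulr1 -exprVn.
Qed.

Lemma smooth_inv U f : open U -> (forall x, U x -> f x != 0) ->
  smooth_on U f -> smooth_on U (fun x => (f x)^-1).
Proof.
move=> oU f0 /smoothP Cf; apply/smoothP; elim=> [|k IH].
  move=> x Ux; apply: continuousV; first exact: f0.
  exact: (Ck_cont (Cf 0%N)).
apply: (Ck_compS (h := fun s => s^-1) (h' := fun s => - s^-1 ^+ 2) oU (Cf k.+1)
  (fun x Ux => is_derive_inv (f0 x Ux))).
apply: (@Ck_eq _ _ (fun x => -1 * ((f x)^-1 * (f x)^-1))) => //.
  by move=> x _; rewrite mulN1r expr2.
by do 2?[apply: Ck_mul => //]; exact: Ck_cst.
Qed.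

Lemma smooth_ln U f : open U -> (forall x, U x -> 0 < f x) ->
  smooth_on U f -> smooth_on U (fun x => ln (f x)).
Proof.
move=> oU f0 sf; apply: (smooth_comp (h' := fun s => s^-1) oU sf).
  by move=> x Ux; exact/is_derive1_ln/f0.
by apply: (smooth_inv oU _ sf) => x Ux; rewrite gt_eqF// f0.
Qed.

End smoothness.

(** * Lebesgue measure on n-tuples *)

Section lebesgue_tuple_facts.
Context {R : realType}.
Local Notation RT := (measurableTypeR R).
Local Notation lebn := (@lebesgue_tuple R).
Local Notation consT x t := (@Defs.cons_tuple R _ (x, t)).

Lemma tnth_cons0 n (x : RT) (t : n.-tuple RT) : tnth (consT x t) ord0 = x.
Proof. by rewrite (tnth_nth 0). Qed.

Lemma tnth_consS n (x : RT) (t : n.-tuple RT) j :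
  tnth (consT x t) (lift ord0 j) = tnth t j.
Proof. by rewrite !(tnth_nth 0). Qed.

Lemma measurable_tnthR n (i : 'I_n) :
  measurable_fun [set: n.-tuple RT] (fun t => (tnth t i : R)).
Proof. exact: measurable_tnth. Qed.

Definition box n (a : n.-tuple RT) (r : R) : set (n.-tuple RT) :=
  [set t | forall i, `|tnth t i - tnth a i| <= r].

Lemma measurable_box n (a : n.-tuple RT) (r : R) : measurable (box a r).
Proof.
rewrite (_ : box a r = \bigcap_(i in [set: 'I_n])
    ((fun t => tnth t i : R) @^-1` `[(tnth a i : R) - r, (tnth a i : R) + r])).
  apply: fin_bigcap_measurable => // i _.
  rewrite -[X in measurable X]setTI; exact: measurable_tnthR.
apply/seteqP; split=> t /= bt i; first by move=> _ /=; rewrite in_itv/= -ler_distl.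
by move: (bt i I); rewrite /= in_itv/= -ler_distl.
Qed.

Lemma cons_box n (x0 : RT) (a : n.-tuple RT) (r : R) :
  @Defs.cons_tuple R n @^-1` box (consT x0 a) r =
  `[(x0 : R) - r, (x0 : R) + r]%classic `*` box a r.
Proof.
apply/seteqP; split=> -[x t] /=.
  move=> bt; split; last by move=> i; have := bt (lift ord0 i); rewrite !tnth_consS.
  by have := bt ord0; rewrite !tnth_cons0 in_itv/= -ler_distl.
rewrite in_itv/= -ler_distl => -[xr bt] i.
by case: (unliftP ord0 i) => [j|] ->; rewrite ?tnth_consS ?tnth_cons0//; exact: bt.
Qed.

Lemma cons_surj n (t : n.+1.-tuple RT) : exists x a, t = consT x a.
Proof.
exists (thead t), [tuple of behead t]; rewrite [LHS]tuple_eta.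
by apply/val_inj.
Qed.

Lemma lebesgue_itv_center (c r : R) : 0 <= r ->
  lebesgue_measure `[c - r, c + r]%classic = (2 * r)%:E.
Proof.
move=> r0; rewrite lebesgue_measure_itv /= lte_fin.
have [->|rn0] := eqVneq r 0; first by rewrite subr0 addr0 ltxx mulr0.
have rgt : 0 < r by rewrite lt_neqAle eq_sym rn0.
rewrite ifT; last by rewrite ltrD2l gt0_cp.
by rewrite -EFinB; congr (_%:E); ring.
Qed.

Lemma lebesgue_box n (a : n.-tuple RT) (r : R) : 0 <= r ->
  lebn n (box a r) = ((2 * r) ^+ n)%:E.
Proof.
move=> r0; elim: n a => [|n IH] a.
  rewrite expr0 /= diracE mem_set//= => -[]//.
have [x0 [b ->]] := cons_surj a.
rewrite [LHS]/= /lebesgue_cons /pushforward cons_box product_measure1E//; last exact: measurable_box.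
rewrite IH exprS EFinM; congr (_ * _)%E; exact: lebesgue_itv_center.
Qed.

Lemma integrable_box n (a : n.-tuple RT) (r : R) (f : n.-tuple RT -> R) (C : R) :
  measurable_fun setT f -> (forall t, `|f t| <= C) ->
  (forall t, ~ box a r t -> f t = 0) ->
  (lebn n).-integrable setT (EFin \o f).
Proof.
move=> mf fC f0.
have mB := measurable_box a r.
rewrite (_ : EFin \o f = (EFin \o f) \_ (box a r)).
  apply: (integrable_mkcond _ mB).1.
  apply: measurable_bounded_integrable => //.
  - have [r0|r0] := leP 0 r; first by rewrite [ltLHS](lebesgue_box a r0) ltry.
    apply: le_lt_trans (_ : lebn n (box a 0) < +oo)%E.
      apply: le_measure; rewrite ?inE//; first exact: measurable_box.
      by move=> t bt i; rewrite (le_trans (bt i))// ltW.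
    by rewrite lebesgue_box// ltry.
  - exact: measurable_funS mf.
  - exists C; split; first exact: num_real.
    by move=> M CM t _; apply: le_trans (fC t) _; exact: ltW.
apply/funext => t; rewrite patchE; case: ifPn => // /negP tB.
by rewrite /= f0// => bt; apply: tB; rewrite inE.
Qed.

Lemma Fubini_cons n (f : n.+1.-tuple RT -> R) :
  (lebn n.+1).-integrable setT (EFin \o f) ->
  (\int[lebn n.+1]_t (f t)%:E =
   \int[lebesgue_measure]_x \int[lebn n]_t (f (consT x t))%:E)%E /\
  (\int[lebn n.+1]_t (f t)%:E =
   \int[lebn n]_t \int[lebesgue_measure]_x (f (consT x t))%:E)%E.
Proof.
move=> fi.
have mc : measurable_fun setT (@Defs.cons_tuple R n) by exact: measurable_cons_tuple.
have /integrableP[mf fi1] := fi.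
pose g := (EFin \o f) \o @Defs.cons_tuple R n.
have mg : measurable_fun setT g by exact: measurableT_comp.
have gi : (lebesgue_measure \x lebn n)%E.-integrable setT g.
  apply/integrableP; split=> //; apply: le_lt_trans fi1.
  rewrite [leRHS](@ge0_integral_pushforward _ _ _ _ _ _ mc) //.
  exact: measurableT_comp.
have E : (\int[lebn n.+1]_t (f t)%:E = \int[lebesgue_measure \x lebn n]_z g z)%E.
  by rewrite [LHS](@integral_pushforward _ _ _ _ _ _ mc).
by split; rewrite E; [rewrite -integral12_prod_meas1|rewrite -integral21_prod_meas1].
Qed.

Lemma measurable_consr n (f : n.+1.-tuple RT -> R) (x : RT) :
  measurable_fun setT f -> measurable_fun setT (fun t => f (consT x t)).
Proof.
move=> mf; apply: (measurableT_comp mf).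
by apply: (@measurable_cons _ _ _ _ (cst x) _ id); [exact: measurable_cst|exact: measurable_id].
Qed.

Definition upd n (t : n.-tuple RT) (i : 'I_n) (s : R) : n.-tuple RT :=
  [tuple if j == i then (s : RT) else tnth t j | j < n].

Lemma upd_cons0 n (x : RT) (t : n.-tuple RT) s : upd (consT x t) ord0 s = consT s t.
Proof.
apply: eq_from_tnth => j; rewrite tnth_mktuple.
case: (unliftP ord0 j) => [k|] ->; last by rewrite eqxx tnth_cons0.
by rewrite [_ == _]eq_sym (negPf (neq_lift _ _)) !tnth_consS.
Qed.

Lemma upd_consS n (x : RT) (t : n.-tuple RT) j s :
  upd (consT x t) (lift ord0 j) s = consT x (upd t j s).
Proof.
apply: eq_from_tnth => k; rewrite tnth_mktuple.
case: (unliftP ord0 k) => [l|] ->; last by rewrite (negPf (neq_lift _ _)) !tnth_cons0.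
by rewrite (inj_eq lift_inj) !tnth_consS tnth_mktuple.
Qed.

(** The derivative of a compactly supported function of one variable has zero
    integral; integrating over the other variables first or last reduces the
    multidimensional statement to that one. *)
Lemma integral_derive_tuple n (i : 'I_n) (f f' : n.-tuple RT -> R) (M C : R) :
  measurable_fun setT f' -> (forall t, `|f' t| <= C) -> 0 <= M ->
  (forall (t : n.-tuple RT) j, M < `|tnth t j| -> f t = 0 /\ f' t = 0) ->
  (forall t : n.-tuple RT, is_derive (tnth t i : R) 1 (fun s : R => f (upd t i s)) (f' t)) ->
  (forall t, continuous (fun s : R => f' (upd t i s))) ->
  (\int[lebn n]_t (f' t)%:E = 0)%E.
Proof.
move=> + + M0.
elim: n i f f' => [[] //|n IH] i f f' mf' f'C f0 fd cf'.
have fi : (lebn n.+1).-integrable setT (EFin \o f').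
  apply: (@integrable_box _ [tuple of nseq n.+1 (0 : R)] M _ C) => // t tB.
  have [j] : exists j, M < `|tnth t j|.
    apply: contrapT => tM; apply: tB => j; rewrite tnth_nseq subr0 leNgt.
    by apply/negP => ?; apply: tM; exists j.
  by case/f0.
have [E1 E2] := Fubini_cons fi.
case: (unliftP ord0 i) => [j|] ij; rewrite {}ij in fd cf'.
- rewrite {}E1; have Z x : (\int[lebn n]_t (f' (consT x t))%:E = 0)%E.
    apply: (IH j (fun t => f (consT x t)) (fun t => f' (consT x t))).
    + exact: measurable_consr.
    + by [].
    + by move=> t k; rewrite -(tnth_consS x) => /f0.
    + move=> t; have := fd (consT x t); rewrite tnth_consS.
      by under eq_fun do rewrite upd_consS.
    + move=> t; have := cf' (consT x t).
      by under eq_fun do rewrite upd_consS.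
  by under eq_integral do rewrite Z; rewrite integral0.
- rewrite {}E2.
  suff Z t : (\int[lebesgue_measure]_x (f' (consT x t))%:E = 0)%E.
    by under eq_integral do rewrite Z; rewrite integral0.
  set h := fun x : R => f (consT x t); set h' := fun x : R => f' (consT x t).
  have hd (x : R) : is_derive x 1 h (h' x).
    have := fd (consT x t); rewrite tnth_cons0.
    by under eq_fun do rewrite upd_cons0.
  have ch' : continuous h'.
    have := cf' (consT 0 t); by under eq_fun do rewrite upd_cons0.
  have ch : continuous h.
    move=> x; apply: differentiable_continuous; apply/derivable1_diffP.
    by case: (hd x).
  have h0 (x : R) : M < `|x| -> h x = 0.
    by move=> xM; case: (f0 (consT x t) ord0); rewrite ?tnth_cons0.
  rewrite (_ : (fun x : RT => (f' (consT x t))%:E) =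
     (fun x => (h' x)%:E) \_ `[- (M + 1), M + 1]); last first.
    apply/funext => x; rewrite patchE; case: ifPn => // /negP xM.
    congr EFin; have [] := f0 (consT x t) ord0; last by [].
    rewrite tnth_cons0 ltNge; apply/negP => xM'; apply: xM.
    by rewrite inE/= in_itv/= -ler_norml (le_trans xM')// lerDl.
  rewrite -integral_mkcond (@continuous_FTC2 _ _ h).
  + by rewrite !h0 ?subee// ?normrN ger0_norm ?ltrDl// addr_ge0.
  + by rewrite gtrN// ltr_wpDl.
  + exact: continuous_subspaceT.
  + split; first by move=> x _; case: (hd x).
    * exact: cvg_at_right_filter (ch _).
    * exact: cvg_at_left_filter (ch _).
  + by move=> x _; rewrite derive1E; case: (hd x).
Qed.

End lebesgue_tuple_facts.

(** * Lebesgue measure and continuous functions of row vectors *)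

Section row_vectors.
Context {R : realType} {n : nat}.
Local Notation RT := (measurableTypeR R).
Local Notation lebn := (@lebesgue_tuple R).
Local Notation pt := 'rV[R]_n.
Local Notation row := (@row_of_tuple R n).

Lemma row_coord (t : n.-tuple RT) i : row t 0 i = tnth t i.
Proof. by rewrite mxE. Qed.

Lemma row_upd (t : n.-tuple RT) i (s : R) :
  row (upd t i s) = (s - tnth t i) *: delta_mx 0 i + row t.
Proof.
apply/rowP => j; rewrite !mxE tnth_mktuple eqxx /=.
case: eqVneq => [->|_]; first by rewrite mulr1 subrK.
by rewrite mulr0 add0r.
Qed.

Lemma rV_ballP (x y : pt) (e : R) : 0 < e ->
  (forall j, `|x 0 j - y 0 j| < e) -> ball x e y.
Proof. by move=> e0 xy; split=> // i j; rewrite (ord1 i); exact: xy. Qed.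

Lemma open_measurable_row (U : set pt) : open U -> measurable (row @^-1` U).
Proof.
move=> oU.
pose B (q : 'rV[rat]_n * nat) : set (n.-tuple RT) :=
  box [tuple (ratr (q.1 0 i) : RT) | i < n] q.2.+1%:R^-1.
have Bq q (t : n.-tuple RT) :
    B q t <-> forall i, `|tnth t i - ratr (q.1 0 i)| <= q.2.+1%:R^-1.
  by split=> tq i; have := tq i; rewrite tnth_mktuple.
pose F q := if `[< B q `<=` row @^-1` U >] then B q else set0.
have -> : row @^-1` U = \bigcup_q F q.
  apply/seteqP; split=> [t Ut|t [q _]]; last first.
    by rewrite /F; case: asboolP => // BU /BU.
  have /nbhs_ballP[e /= e0 eU] := open_nbhs_nbhs (conj oU Ut).
  have [k ke] : exists k : nat, k.+1%:R^-1 < e / 2.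
    exists (Num.bound (e / 2)^-1); rewrite invf_plt ?posrE ?divr_gt0//.
    rewrite (lt_le_trans (archi_boundP _)) ?invr_ge0 ?divr_ge0 ?ltW//.
    by rewrite ltr_nat.
  have k0 : (0 : R) < k.+1%:R^-1 by rewrite invr_gt0.
  have /choice[q qt] : forall i, exists q : rat,
      `|(tnth t i : R) - ratr q| < k.+1%:R^-1.
    move=> i; have /rat_in_itvoo[q] : (tnth t i : R) < (tnth t i : R) + k.+1%:R^-1.
      by rewrite ltrDl.
    rewrite in_itv/= => /andP[q1 q2]; exists q.
    by rewrite ltr_distlC q2 andbT (lt_trans _ q1)// gtrBl.
  exists (\row_i q i, k) => //; rewrite /F asboolT; last first.
    move=> u /Bq uq; apply: eU; apply: rV_ballP => // j.
    rewrite !row_coord; have := uq j; have := qt j; rewrite /= mxE => h1 h2.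
    rewrite -(subrK (ratr (q j)) (tnth t j : R)) -addrA.
    rewrite (le_lt_trans (ler_normD _ _))// (splitr e) ltrD//; first exact: lt_trans ke.
    by rewrite distrC (le_lt_trans h2).
  by apply/Bq => j; rewrite /= mxE ltW.
apply: countable_bigcupT_measurable => //.
by move=> q; rewrite /F; case: ifP => // _; exact: measurable_box.
Qed.

Lemma measurable_row_on (U : set pt) (f : pt -> R) : open U ->
  (forall x, U x -> {for x, continuous f}) ->
  measurable_fun (row @^-1` U) (fun t => f (row t)).
Proof.
move=> oU cf; apply: (measurability _ (RGenOpens.measurableE R)).
move=> _ [_ [a [b ->] <-]].
suff : open (U `&` f @^-1` `]a, b[) by move/open_measurable_row.
rewrite openE => x [Ux fx].
apply: filterI; first exact: open_nbhs_nbhs.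
by apply: (cf x Ux); apply: open_nbhs_nbhs; split => //; exact: interval_open.
Qed.

Lemma measurable_row (f : pt -> R) : continuous f ->
  measurable_fun setT (fun t : n.-tuple RT => f (row t)).
Proof. by move=> cf; have := @measurable_row_on setT f openT (fun x _ => cf x). Qed.

Lemma compact_cube (M : R) : compact [set x : pt | forall i, `|x 0 i| <= M].
Proof.
rewrite (_ : mkset _ = [set x : pt | forall i, `[- M, M]%classic (x ord0 i)]).
  by apply: (@rV_compact _ _ (fun=> `[- M, M]%classic)) => i; exact: segment_compact.
by apply/seteqP; split=> x /= xM i; have := xM i; rewrite in_itv/= ler_norml.
Qed.

Lemma compact_coord_bounded (K : set pt) : compact K ->
  exists M : R, 0 <= M /\ forall x j, K x -> `|x 0 j| <= M.
Proof.
move=> /compact_bounded [M [_ HM]]; exists (Num.max 0 (M + 1)); split.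
  by rewrite le_max lexx.
move=> x j Kx; rewrite le_max; apply/orP; right.
have MM : M < M + 1 by rewrite ltrDl.
apply: le_trans (HM _ MM x Kx); rewrite /Num.norm /= mx_normrE.
exact: (le_bigmax _ (fun ij : 'I_1 * 'I_n => `|x ij.1 ij.2|) (0, j)).
Qed.

Lemma bounded_on_cube (f : pt -> R) (M : R) : 0 <= M -> continuous f ->
  exists C : R, forall x : pt, (forall i, `|x 0 i| <= M) -> `|f x| <= C.
Proof.
move=> M0 cf.
have [||c _ fc] := @EVT_max_rV R n (fun x => `|f x|) _ _ (@compact_cube M).
- by exists 0 => i /=; rewrite mxE normr0.
- apply: continuous_subspaceT => x; apply: continuous_comp; first exact: cf.
  exact: norm_continuous.
by exists `|f c| => x xM; apply: fc; rewrite inE.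
Qed.

Lemma derive_outside_cube (i : 'I_n) (f : pt -> R) (M d : R) (x : pt) j :
  (forall (y : pt) k, M < `|y 0 k| -> f y = 0) -> M < `|x 0 j| ->
  is_derive x (delta_mx 0 i) f d -> d = 0.
Proof.
move=> f0 xM [_ <-]; have fx : \forall y \near x, f y = (fun=> 0) y.
  have : \forall y \near x, M < `|(y : pt) 0 j|.
    apply: (@cvgr_gt _ _ (nbhs x) _ (fun y : pt => `|y 0 j|) `|x 0 j|) => //.
    by apply: cvg_norm; exact: coord_cont.
  by apply: filterS => y; exact: f0.
by rewrite (near_eq_derive _ fx); exact: derive_cst.
Qed.

(** The one-component form of the divergence theorem for compactly supported
    fields. *)
Lemma integral_partial0 (i : 'I_n) (f df : pt -> R) (M : R) : 0 <= M ->
  (forall (x : pt) j, M < `|x 0 j| -> f x = 0) ->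
  (forall x : pt, is_derive x (delta_mx 0 i) f (df x)) -> continuous df ->
  (\int[lebn n]_t (df (row t))%:E = 0)%E.
Proof.
move=> M0 f0 fd cdf.
have df0 (x : pt) j : M < `|x 0 j| -> df x = 0.
  by move=> xM; exact: derive_outside_cube f0 xM (fd x).
have [C fC] := bounded_on_cube M0 cdf.
apply: (@integral_derive_tuple R n i (f \o row) (df \o row) M (Num.max C 0)) => //.
- exact: measurable_row.
- move=> t; rewrite le_max /=.
  have [tM|] := pselect (forall i, `|(row t) 0 i| <= M); first by rewrite fC.
  move=> /existsNP[j /negP]; rewrite -ltNge => /df0 ->.
  by rewrite normr0 lexx orbT.
- by move=> t j tM; split => /=; [apply: (f0 _ j)|apply: (df0 _ j)]; rewrite row_coord.
- move=> t; have /is_derive_lineP := fd (row t).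
  have ds : is_derive (tnth t i : R) 1 (fun s : R => s - tnth t i) 1.
    have h1 : is_derive (tnth t i : R) 1 (fun s : R => s) 1 by exact: is_derive_id.
    have h2 : is_derive (tnth t i : R) 1 (fun s : R => - (tnth t i : R)) 0.
      exact: is_derive_cst.
    by have := is_deriveDf h1 h2; rewrite addr0.
  rewrite -(subrr (tnth t i : R)) => h.
  have := is_derive_comp_line ds h; rewrite mulr1.
  by under eq_fun do rewrite -row_upd.
- move=> t s; have -> : (fun s : R => (df \o row) (upd t i s)) =
      df \o (fun s : R => (s - tnth t i) *: delta_mx 0 i + row t).
    by apply/funext => u; rewrite /= row_upd.
  apply: continuous_comp; last exact: cdf.
  apply: cvgD; last exact: cvg_cst.
  apply: cvgZr_tmp.
  by apply: cvgB; [exact: cvg_id|exact: cvg_cst].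
Qed.

End row_vectors.

(** * The profile functions *)

Section profile.
Context {R : realType}.
Implicit Types (s t : R) (k m : nat).

(** The functions [s^-k exp(-1/s)], extended by zero: a family closed under
    differentiation up to linear combinations, hence made of smooth functions. *)
Definition expinv k s : R := if 0 < s then s^-1 ^+ k * expR (- s^-1) else 0.

Lemma expinv_le0 k s : s <= 0 -> expinv k s = 0.
Proof. by rewrite /expinv ltNge => ->. Qed.

Lemma expinv_ge0 k s : 0 <= expinv k s.
Proof.
rewrite /expinv; case: ifP => // s0.
by rewrite mulr_ge0 ?expR_ge0// exprn_ge0// invr_ge0 ltW.
Qed.

Lemma expinv_gt0 k s : 0 < s -> 0 < expinv k s.
Proof. by move=> s0; rewrite /expinv s0 mulr_gt0 ?expR_gt0// exprn_gt0// invr_gt0. Qed.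

Lemma expinvS k s : s * expinv k.+1 s = expinv k s.
Proof.
rewrite /expinv; case: ifP => s0; last by rewrite mulr0.
by rewrite exprS !mulrA mulfV ?mul1r// gt_eqF.
Qed.

Lemma expinv_le_sqr k s : `|expinv k s| <= k.+2`!%:R * s ^+ 2.
Proof.
rewrite ger0_norm ?expinv_ge0// /expinv; case: ifPn => [s0|_]; last first.
  by rewrite mulr_ge0// sqr_ge0.
have y0 : 0 <= s^-1 by rewrite invr_ge0 ltW.
have := expR_ge1Dxn k.+1 y0; set y := s^-1 => ey.
have yk : y ^+ k.+2 <= k.+2`!%:R * expR y.
  rewrite -ler_pdivrMl ?ltr0n ?fact_gt0// mulrC; apply: le_trans ey; lra.
have -> : s ^+ 2 = y ^- 2 by rewrite /y exprVn invrK.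
rewrite expRN ler_pdivrMr ?expR_gt0// mulrAC ler_pdivlMr ?exprn_gt0 ?invr_gt0//.
by rewrite -exprD addn2.
Qed.

Lemma is_derive_quadratic (f : R -> R) (C : R) : (forall s, `|f s| <= C * s ^+ 2) ->
  is_derive (0 : R) 1 f 0.
Proof.
move=> fC; have f0 : f 0 = 0.
  by apply/eqP; rewrite -normr_le0; have := fC 0; rewrite expr0n mulr0.
have C0 : 0 <= C by have := le_trans (normr_ge0 _) (fC 1); rewrite expr1n mulr1.
have C1 : 0 < C + 1 by rewrite ltr_wpDl.
have H : (fun s => s^-1 *: ((f \o shift 0) (s *: (1 : R)) - f 0)) @ 0^' --> (0 : R).
  apply/cvgrPdist_le => e e0; near=> s.
  have s0 : s != 0 by near: s; exact: nbhs_dnbhs_neq.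
  rewrite /= f0 sub0r normrN subr0 addr0 normrM normfV ler_pdivrMl ?normr_gt0//.
  rewrite [_%:A]mulr1; apply: le_trans (fC s) _.
  rewrite -real_normK ?num_real// expr2 mulrA mulrC ler_wpM2l//.
  apply: (@le_trans _ _ ((C + 1) * `|s|)); first by apply: ler_wpM2r => //; rewrite lerDl ler01.
  rewrite -ler_pdivlMl//; near: s; apply: dnbhs0_le.
  by rewrite mulr_gt0 ?invr_gt0.
split; first by apply/cvg_ex; exists 0.
exact: cvg_lim H.
Unshelve. all: by end_near. Qed.

Lemma near_ltR s c : s < c -> \forall r \near s, r < c.
Proof. by move=> sc; apply: (@cvgr_lt _ _ (nbhs s) _ id s) => //; exact: cvg_id. Qed.

Lemma near_gtR s c : c < s -> \forall r \near s, c < r.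
Proof. by move=> sc; apply: (@cvgr_gt _ _ (nbhs s) _ id s) => //; exact: cvg_id. Qed.

Lemma near_eq_contR (f g : R -> R) s : (\forall r \near s, f r = g r) ->
  {for s, continuous f} -> {for s, continuous g}.
Proof.
move=> fg cf; rewrite /prop_for /continuous_at -(nbhs_singleton fg).
exact: cvg_trans (near_eq_cvg fg) cf.
Qed.

Lemma is_derive_idR s : is_derive s 1 (fun r : R => r) 1.
Proof. exact: is_derive_id. Qed.

Lemma is_derive_cstR s (c : R) : is_derive s 1 (fun r : R => c) 0.
Proof. exact: is_derive_cst. Qed.

Lemma is_derive_zmul (f : R -> R) s (c d : R) :
  is_derive s 1 f d -> is_derive s 1 (fun r => c * f r) (c * d).
Proof.
move=> fd; have := is_deriveMf (is_derive_cstR s c) fd.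
by rewrite mul0r add0r.
Qed.

Lemma is_derive_expf (f : R -> R) s (d : R) k :
  is_derive s 1 f d -> is_derive s 1 (fun r => f r ^+ k) (k%:R * f s ^+ k.-1 * d).
Proof.
move=> fd; elim: k => [|k IH].
  by rewrite mul0r mul0r; exact: is_derive_cstR.
have := is_deriveMf fd IH; under eq_fun do rewrite -exprS.
move/is_derive_subst; apply; case: k {IH} => [|k]; rewrite /= ?exprS ?mulrS; ring.
Qed.

Lemma is_derive_expinv k s :
  is_derive s 1 (expinv k) (expinv k.+2 s - k%:R * expinv k.+1 s).
Proof.
have [s0|s0|->] := ltgtP s 0.
- rewrite !expinv_le0 ?ltW// mulr0 subr0.
  apply: near_eq_is_derive (is_derive_cstR s 0).
  by apply: filterS (near_ltR s0) => r r0; rewrite expinv_le0// ltW.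
- have sn0 : s != 0 by rewrite gt_eqF.
  apply: (@near_eq_is_derive _ _ _ (fun r : R => r^-1 ^+ k * expR (- r^-1))).
    by apply: filterS (near_gtR s0) => r r0; rewrite /expinv r0.
  have di := is_derive_inv sn0.
  have dN : is_derive s 1 (fun r : R => - r^-1) (s^-1 ^+ 2).
    by have := is_derive_zmul (-1) di; rewrite mulN1r opprK; under eq_fun do rewrite mulN1r.
  have dE := is_derive_comp_line dN (is_derive_expR (- s^-1)).
  have := is_deriveMf (is_derive_expf k di) dE.
  rewrite /expinv s0; move/is_derive_subst; apply; case: k => [|k]; rewrite /= ?exprS; ring.
- rewrite !expinv_le0// mulr0 subr0.
  exact: is_derive_quadratic (expinv_le_sqr k).
Qed.

(** [s exp(-1/s)] is convex, vanishes for [s <= 0] and has slope at most one: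
    these three features make the metric below nonnegatively curved, Euclidean
    on a ball and complete. *)
Definition ramp s : R := s * expinv 0 s.
Definition ramp1 s : R := expinv 0 s + expinv 1 s.

Lemma ramp_le0 s : s <= 0 -> ramp s = 0.
Proof. by move=> s0; rewrite /ramp expinv_le0// mulr0. Qed.

Lemma ramp1_le0 s : s <= 0 -> ramp1 s = 0.
Proof. by move=> s0; rewrite /ramp1 !expinv_le0// addr0. Qed.

Lemma is_derive_ramp s : is_derive s 1 ramp (ramp1 s).
Proof.
have := is_deriveMf (is_derive_idR s) (is_derive_expinv 0 s).
rewrite mul0r subr0 mul1r expinvS; exact.
Qed.

Lemma is_derive_ramp1 s : is_derive s 1 ramp1 (expinv 3 s).
Proof.
have := is_deriveDf (is_derive_expinv 0 s) (is_derive_expinv 1 s).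
by move/is_derive_subst; apply; ring.
Qed.

Lemma ramp1_ge0 s : 0 <= ramp1 s.
Proof. by rewrite addr_ge0 ?expinv_ge0. Qed.

Lemma ramp1_le1 s : ramp1 s <= 1.
Proof.
rewrite /ramp1 /expinv; case: ifPn => [s0|_]; last by rewrite addr0.
rewrite expr0 expr1 -mulrDl expRN ler_pdivrMr ?expR_gt0// mul1r.
exact: expR_ge1Dx.
Qed.

Lemma ramp_ge0 s : 0 <= ramp s.
Proof.
have [s0|s0] := leP s 0; first by rewrite ramp_le0.
by rewrite mulr_ge0 ?expinv_ge0// ltW.
Qed.

Lemma ramp_le s : 0 <= s -> ramp s <= s.
Proof.
move=> s0; rewrite /ramp ler_piMr// /expinv; case: ifPn => // s1.
by rewrite expr0 mul1r -expR0 ler_expR oppr_le0 invr_ge0.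
Qed.

(** Half the logarithm of the conformal factor, as a function of [|x|^2]. With
    the constant [4^-1] the factor decays like [|x|^-1], which is slow enough
    for completeness. *)
Definition lconf t : R := - 4^-1 * ramp (ln t).
Definition lconf1 t : R := - 4^-1 * (ramp1 (ln t) * t^-1).
Definition lconf2 t : R := - 4^-1 * ((expinv 3 (ln t) - ramp1 (ln t)) * t^-1 ^+ 2).

Lemma lconf_le1 t : t <= 1 -> lconf t = 0.
Proof. by move=> t1; rewrite /lconf ramp_le0 ?mulr0// ln_le0. Qed.

Lemma lconf1_le1 t : t <= 1 -> lconf1 t = 0.
Proof. by move=> t1; rewrite /lconf1 ramp1_le0 ?mul0r ?mulr0// ln_le0. Qed.

Lemma lconf2_le1 t : t <= 1 -> lconf2 t = 0.
Proof.
by move=> t1; rewrite /lconf2 ramp1_le0 ?expinv_le0 ?subr0 ?mul0r ?mulr0// ln_le0.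
Qed.

Lemma is_derive_lconf t : is_derive t 1 lconf (lconf1 t).
Proof.
have [t1|t1] := ltP t 1.
  rewrite (lconf1_le1 (ltW t1)); apply: (near_eq_is_derive _ (is_derive_cstR t 0)).
  by apply: filterS (near_ltR t1) => r r1; rewrite lconf_le1// ltW.
have t0 : 0 < t by rewrite (lt_le_trans _ t1).
exact: is_derive_zmul (is_derive_comp_line (is_derive1_ln t0) (is_derive_ramp _)).
Qed.

Lemma is_derive_lconf1 t : is_derive t 1 lconf1 (lconf2 t).
Proof.
have [t1|t1] := ltP t 1.
  rewrite (lconf2_le1 (ltW t1)); apply: (near_eq_is_derive _ (is_derive_cstR t 0)).
  by apply: filterS (near_ltR t1) => r r1; rewrite lconf1_le1// ltW.
have t0 : 0 < t by rewrite (lt_le_trans _ t1).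
have tn0 : t != 0 by rewrite gt_eqF.
have d1 := is_derive_comp_line (is_derive1_ln t0) (is_derive_ramp1 _).
have := is_derive_zmul (- 4^-1) (is_deriveMf d1 (is_derive_inv tn0)).
by move/is_derive_subst; apply; rewrite /lconf2; ring.
Qed.

Lemma mul_lconf1 t : 0 < t -> t * lconf1 t = - 4^-1 * ramp1 (ln t).
Proof. by move=> t0; rewrite /lconf1; field; rewrite gt_eqF. Qed.

Lemma lconf1_npos t : 0 <= t -> lconf1 t <= 0.
Proof.
by move=> t0; rewrite /lconf1 mulNr oppr_le0 !mulr_ge0 ?ramp1_ge0 ?invr_ge0.
Qed.

Lemma mul_lconf1_ge t : 0 <= t -> - 4^-1 <= t * lconf1 t.
Proof.
rewrite le_eqVlt => /predU1P[<-|t0]; first by rewrite mul0r oppr_le0.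
by rewrite mul_lconf1//; have := ramp1_le1 (ln t); lra.
Qed.

Lemma lconf_slope t : 0 < t -> lconf1 t + t * lconf2 t = - 4^-1 * (expinv 3 (ln t) / t).
Proof. by move=> t0; rewrite /lconf1 /lconf2; field; rewrite gt_eqF. Qed.

Lemma lconf_slope_le0 t : 0 <= t -> lconf1 t + t * lconf2 t <= 0.
Proof.
rewrite le_eqVlt => /predU1P[<-|t0]; first by rewrite mul0r addr0 lconf1_npos.
by rewrite lconf_slope// mulNr oppr_le0 mulr_ge0// mulr_ge0 ?expinv_ge0 ?invr_ge0 ?ltW.
Qed.

Lemma lconf_slope_lt0 t : 1 < t -> lconf1 t + t * lconf2 t < 0.
Proof.
move=> t1; have t0 : 0 < t by rewrite (lt_trans _ t1).
by rewrite lconf_slope// mulNr oppr_lt0 mulr_gt0// mulr_gt0 ?invr_gt0// expinv_gt0// ln_gt0.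
Qed.

Definition conf t : R := expR (2 * lconf t).

Lemma conf_gt0 t : 0 < conf t. Proof. exact: expR_gt0. Qed.

Lemma conf_neq0 t : conf t != 0. Proof. by rewrite gt_eqF ?conf_gt0. Qed.

Lemma confE t : conf t = expR (- 2^-1 * ramp (ln t)).
Proof. by congr expR; rewrite /lconf; field. Qed.

Lemma conf_le1 t : t <= 1 -> conf t = 1.
Proof. by move=> t1; rewrite /conf lconf_le1// mulr0 expR0. Qed.

Lemma conf_ub t : conf t <= 1.
Proof. by rewrite confE expR_le1 mulNr oppr_le0 mulr_ge0 ?ramp_ge0. Qed.

Lemma conf_lb t : 0 <= t -> (1 + t)^-1 <= conf t.
Proof.
move=> t0; have t1 : 0 < 1 + t by rewrite ltr_pwDl.
have L0 : 0 <= ln (1 + t) by rewrite ln_ge0// lerDl.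
have -> : (1 + t)^-1 = expR (- ln (1 + t)) by rewrite expRN lnK.
rewrite confE ler_expR mulNr lerN2.
have EL : ramp (ln t) <= ln (1 + t).
  have [t1'|t1'] := leP t 1; first by rewrite ramp_le0// ln_le0.
  apply: le_trans (ramp_le _) _; first by rewrite ln_ge0 ?ltW.
  by rewrite ler_ln ?posrE ?(lt_trans _ t1')// lerDr.
by have := ramp_ge0 (ln t); lra.
Qed.

Lemma is_derive_conf t : is_derive t 1 conf (2 * lconf1 t * conf t).
Proof.
have := is_derive_comp_line (is_derive_zmul 2 (is_derive_lconf t)) (is_derive_expR _).
by move/is_derive_subst; apply; rewrite mulrC.
Qed.

End profile.

Section green_profile.
Context {R : realType}.
Variable m : nat.
Hypothesis m_gt0 : (0 < m)%N.
Implicit Types (s t : R) (k : nat).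

(** The derivative of the difference between the Euclidean profile [t^-m] and
    the profile of the Green function; it vanishes for [t <= 1], where the
    metric is Euclidean, so that its primitive is regular at zero. *)
Definition corr t : R := m%:R * t^-1 ^+ m.+1 * ((conf t)^-1 ^+ m - 1).

Lemma corr_le1 t : t <= 1 -> corr t = 0.
Proof. by move=> t1; rewrite /corr conf_le1// invr1 expr1n subrr mulr0. Qed.

Lemma conf_inv_ge1 t : 1 <= (conf t)^-1 ^+ m.
Proof.
by apply: exprn_ege1; rewrite invf_ge1 ?conf_gt0// conf_ub.
Qed.

Lemma corr_ge0 t : 0 <= corr t.
Proof.
have [t1|t1] := leP t 1; first by rewrite corr_le1.
rewrite /corr; apply: mulr_ge0; last by rewrite subr_ge0 conf_inv_ge1.
by rewrite mulr_ge0// exprn_ge0// invr_ge0 ltW// (lt_trans _ t1).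
Qed.

Lemma derive_cont (f : R -> R) t (d : R) : is_derive t 1 f d -> {for t, continuous f}.
Proof.
by case=> df _; apply: differentiable_continuous; apply/derivable1_diffP.
Qed.

Lemma corr_cont : continuous corr.
Proof.
move=> t; have [t1|t1] := ltP t 1.
  apply: (@near_eq_contR _ (fun=> 0)); last exact: cst_continuous.
  by apply: filterS (near_ltR t1) => r r1; rewrite corr_le1// ltW.
have t0 : 0 < t by rewrite (lt_le_trans _ t1).
have tn0 : t != 0 by rewrite gt_eqF.
have d1 := is_derive_expf m.+1 (is_derive_inv tn0).
have d2 := is_derive_expf m (is_derive_comp_line (is_derive_conf t)
   (is_derive_inv (conf_neq0 t))).
have d3 := is_deriveDf d2 (is_derive_cstR t (-1)).
exact: (derive_cont (is_deriveMf (is_derive_zmul m%:R d1) d3)).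
Qed.

(* The primitive of [corr] converges at infinity by comparison with that of
   [t^(-3/2)]; this is [t^(-1/2)]. *)
Let rsq t : R := expR (- 2^-1 * ln t).

Let is_derive_rsq t : 0 < t -> is_derive t 1 rsq (- 2^-1 * (rsq t / t)).
Proof.
move=> t0; have := is_derive_comp_line (is_derive_zmul (- 2^-1) (is_derive1_ln t0))
  (is_derive_expR _).
by move/is_derive_subst; apply; rewrite /rsq; ring.
Qed.

Let corr_le t : 1 <= t -> corr t <= m%:R * (rsq t / t).
Proof.
move=> t1; have t0 : 0 < t by rewrite (lt_le_trans _ t1).
have L0 := ln_ge0 t1.
suff H : t^-1 ^+ m * ((conf t)^-1 ^+ m - 1) <= rsq t.
  have -> : corr t = (m%:R * t^-1) * (t^-1 ^+ m * ((conf t)^-1 ^+ m - 1)).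
    by rewrite /corr exprS; ring.
  have -> : m%:R * (rsq t / t) = (m%:R * t^-1) * rsq t by ring.
  apply: ler_wpM2l => //.
  by rewrite mulr_ge0// invr_ge0 ltW.
apply: (@le_trans _ _ (t^-1 ^+ m * (conf t)^-1 ^+ m)).
  by apply: ler_wpM2l; [rewrite exprn_ge0// invr_ge0 ltW|rewrite gerBl].
rewrite -exprMn confE -expRN -[t in t^-1]lnK ?posrE// -expRN -expRD -expRM_natl.
rewrite ler_expR; have := ramp_le L0; have m1 : (1 : R) <= m%:R by rewrite ler1n.
nra.
Qed.

Lemma antiderivative (f : R -> R) (f0 : forall t, t <= 1 -> f t = 0) :
  continuous f -> exists F : R -> R, (forall t, is_derive t 1 F (f t)) /\
    forall t, t <= 1 -> F t = 0.
Proof.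
move=> cf; pose F t := \int[lebesgue_measure]_(x in `[0, t]) f x.
have F0 t : t <= 1 -> F t = 0.
  move=> t1; rewrite /F (@eq_Rintegral _ _ _ _ _ (fun=> 0)); last first.
    by move=> x; rewrite inE/= in_itv/= => /andP[_ xt]; rewrite f0// (le_trans xt).
  by rewrite Rintegral_cst// mul0r.
exists F; split => // t; have [t1|t1] := ltP t 1.
  rewrite f0 ?ltW//; apply: near_eq_is_derive (is_derive_cstR t 0).
  by apply: filterS (near_ltR t1) => r r1; rewrite F0// ltW.
have fi : lebesgue_measure.-integrable `[0, t + 1] (EFin \o f).
  apply: continuous_compact_integrable; first exact: segment_compact.
  exact: continuous_subspaceT.
have tt : t < t + 1 by rewrite ltrDl.
have [dF eF] := continuous_FTC1_closed tt fi (lt_le_trans ltr01 t1) (cf t).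
by split; [exact: dF|rewrite -derive1E; exact: eF].
Qed.

Lemma delta_exists : exists (D : R -> R) (c0 : R),
  [/\ forall t, is_derive t 1 D (corr t), forall t, t <= 1 -> D t = 0,
      forall t, 0 <= D t <= c0 &
      forall e, 0 < e -> exists T, forall t, T <= t -> c0 - e < D t].
Proof.
have [D [dD D0]] := antiderivative corr_le1 corr_cont.
have Dc t : {for t, continuous D} by exact: derive_cont (dD t).
have Dmono : {homo D : s t / s <= t}.
  move=> s t; rewrite le_eqVlt => /predU1P[->//|st].
  have [|c _ Dst] := MVT st (fun x _ => dD x).
    by apply: continuous_subspaceT => x; exact: Dc.
  by rewrite -subr_ge0 Dst mulr_ge0 ?corr_ge0// subr_ge0 ltW.
have Dub t : D t <= 2 * m%:R.
  have [t1|t1] := leP t 1; first by rewrite D0// mulr_ge0.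
  pose H r := D r + 2 * m%:R * rsq r.
  have dH (r : R) : 0 < r -> is_derive r 1 H (corr r - m%:R * (rsq r / r)).
    move=> r0; have := is_deriveDf (dD r) (is_derive_zmul (2 * m%:R) (is_derive_rsq r0)).
    by move/is_derive_subst; apply; field; rewrite gt_eqF.
  have [||c] := @MVT R H (fun r => corr r - m%:R * (rsq r / r)) 1 t t1.
  - by move=> r; rewrite in_itv/= => /andP[r1 _]; apply: dH; rewrite (lt_trans _ r1).
  - apply: derivable_within_continuous => r; rewrite in_itv/= => /andP[r1 _].
    by have [] := dH r (lt_le_trans ltr01 r1).
  rewrite in_itv/= => /andP[c1 _] e.
  have : H t - H 1 <= 0.
    rewrite e; apply: mulr_le0_ge0; last by rewrite subr_ge0 ltW.
    by rewrite subr_le0; exact: corr_le (ltW c1).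
  rewrite /H (D0 1)// /rsq ln1 mulr0 expR0.
  have : 0 <= 2 * m%:R * expR (- 2^-1 * ln t) by rewrite mulr_ge0 ?expR_ge0// mulr_ge0.
  lra.
have hs : has_sup (range D).
  by split; [exists (D 0); exists 0|exists (2 * m%:R) => _ [t _ <-]].
exists D, (sup (range D)); split => //.
- move=> t; apply/andP; split.
    have [t1|t1] := leP t 1; first by rewrite D0.
    by rewrite -(D0 1)// Dmono// ltW.
  by apply: sup_ubound; [case: hs|exists t].
- move=> e e0; have [_ [T _ <-] DT] := sup_adherent e0 hs.
  by exists T => t Tt; rewrite (lt_le_trans DT)// Dmono.
Qed.

End green_profile.

Section green_profile_exists.
Context {R : realType}.

(** The Green function is [g(|x|^2)]: the equation for [g] says that the flux
    of its gradient through spheres is constant, [c] is the constant by which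
    it differs from the Euclidean Green function on the flat ball, and the decay
    at infinity is what makes it minimal. *)
Definition green_profile (m : nat) (g : R -> R) (c : R) : Prop :=
  [/\ 0 <= c, forall t, t <= 1 -> g t = t^-1 ^+ m + c,
      forall t : R, 0 < t ->
        is_derive t 1 g (- (m%:R * t^-1 ^+ m.+1 * (conf t)^-1 ^+ m)),
      forall t, 0 <= t -> t^-1 ^+ m <= g t <= t^-1 ^+ m + c &
      forall e : R, 0 < e -> exists T, forall t, T <= t -> g t < e].

Lemma green_profile_exists (m : nat) : (0 < m)%N -> exists g c, green_profile m g c.
Proof.
move=> m0; have [D [c [dD D0 Dc Dlim]]] := @delta_exists R m m0.
exists (fun t => t^-1 ^+ m + (c - D t)), c; split.
- by have /andP[D0' Dc'] := Dc 0; exact: le_trans Dc'.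
- by move=> t t1; rewrite D0// subr0.
- move=> t t0; have tn0 : t != 0 by rewrite gt_eqF.
  have d1 := is_derive_expf m (is_derive_inv tn0).
  have d2 := is_deriveDf (is_derive_cstR t c) (is_derive_zmul (-1) (dD t)).
  have := is_deriveDf d1 d2; under eq_fun do rewrite mulN1r.
  move/is_derive_subst; apply; rewrite /corr.
  by case: m m0 {D dD D0 Dc Dlim d1 d2} => // k _; rewrite [k.+1.-1]/= !exprS; ring.
- by move=> t t0; have /andP[Dt0 Dtc] := Dc t; apply/andP; split; lra.
- move=> e e0; have e20 : 0 < e / 2 by rewrite divr_gt0.
  have [T DT] := Dlim _ e20.
  exists (Num.max T (Num.max 1 (2 / e + 1))) => t.
  rewrite !ge_max => /andP[Tt /andP[t1 et]]; have Dt := DT t Tt.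
  have t0 : 0 < t by rewrite (lt_le_trans _ t1).
  have : t^-1 ^+ m <= t^-1.
    rewrite -[leRHS]expr1; apply: ler_wiXn2l => //; first by rewrite invr_ge0 ltW.
    by rewrite invf_le1.
  have : t^-1 < e / 2.
    rewrite -[e / 2]invrK ltf_pV2 ?posrE ?invr_gt0// invf_div.
    by rewrite (lt_le_trans _ et)// ltrDl.
  lra.
Qed.

End green_profile_exists.

(** * Radial functions on R^n *)

Section radial.
Context {R : realType} {n : nat}.
Local Notation pt := 'rV[R]_n.
Implicit Types (x : pt) (f : pt -> R).

Definition sqn x : R := \sum_i x 0 i ^+ 2.

Lemma sqn_ge0 x : 0 <= sqn x.
Proof. by apply: sumr_ge0 => i _; exact: sqr_ge0. Qed.

Lemma coord_sqn x i : x 0 i ^+ 2 <= sqn x.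
Proof. by rewrite /sqn (bigD1 i)//= lerDl sumr_ge0// => j _; exact: sqr_ge0. Qed.

Lemma sqn0 : sqn (0 : pt) = 0.
Proof. by rewrite /sqn big1// => i _; rewrite mxE expr0n. Qed.

Lemma sqn_eq0 x : (sqn x == 0) = (x == 0).
Proof.
apply/eqP/eqP => [x0|->]; last exact: sqn0.
apply/rowP => i; rewrite mxE; apply/eqP; rewrite -sqrf_eq0 eq_le sqr_ge0 andbT.
by rewrite -x0 coord_sqn.
Qed.

Lemma sqn_gt0 x : (0 < sqn x) = (x != 0).
Proof. by rewrite lt_neqAle sqn_ge0 andbT eq_sym sqn_eq0. Qed.

Lemma sqn_le_cube x (M : R) : (forall i, `|x 0 i| <= M) -> sqn x <= n%:R * M ^+ 2.
Proof.
move=> xM; have -> : n%:R * M ^+ 2 = \sum_(i < n) M ^+ 2.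
  by rewrite sumr_const card_ord mulr_natl.
apply: ler_sum => i _; rewrite -real_normK ?num_real//.
by apply: lerXn2r; rewrite ?nnegrE// (le_trans _ (xM i)).
Qed.

Lemma cube_sqn x (M : R) i : 0 <= M -> sqn x <= M ^+ 2 -> `|x 0 i| <= M.
Proof.
move=> M0 xM; rewrite -(@ler_pXn2r _ 2) ?nnegrE// real_normK ?num_real//.
exact: le_trans (coord_sqn x i) xM.
Qed.

Lemma is_derive_sqn x i : is_derive x (delta_mx 0 i) sqn (2 * x 0 i).
Proof.
have d j : is_derive x (delta_mx 0 i) (fun y : pt => y 0 j ^+ 2)
    ((j == i)%:R * x 0 j + x 0 j * (j == i)%:R).
  have := is_deriveMf (is_derive_coord x i j) (is_derive_coord x i j).
  by under eq_fun do rewrite -expr2.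
have := is_derive_sumf (index_enum 'I_n) d.
move/is_derive_subst; apply; rewrite (bigD1 i)//= eqxx big1 ?addr0.
  by rewrite mul1r mulr1 mulr2n mulrDl mul1r.
by move=> j ji; rewrite (negPf ji) mul0r mulr0 addr0.
Qed.

Lemma smooth_sqn (U : set pt) : open U -> smooth_on U sqn.
Proof.
move=> oU; apply: smooth_sum => // i; apply: smooth_exp => //.
exact: smooth_coord.
Qed.

Lemma sqn_cont : continuous sqn.
Proof. by move=> x; apply: (@smooth_cont R n setT); [exact/smooth_sqn/openT|]. Qed.

Lemma is_derive_radial (h : R -> R) x i (d : R) : is_derive (sqn x) 1 h d ->
  is_derive x (delta_mx 0 i) (fun y => h (sqn y)) (d * (2 * x 0 i)).
Proof. by move=> hd; exact: is_derive_comp_line (is_derive_sqn x i) hd. Qed.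

Lemma radial_cont (h : R -> R) x : {for sqn x, continuous h} ->
  {for x, continuous (fun y => h (sqn y))}.
Proof. by move=> ch; apply: continuous_comp ch; exact: sqn_cont. Qed.

Lemma open_sqn_lt (a : R) : open [set x | sqn x < a].
Proof.
apply: (@open_comp _ _ sqn [set t | t < a]); last exact: open_lt.
by move=> x _; exact: sqn_cont.
Qed.

Lemma open_sqn_gt (a : R) : open [set x | a < sqn x].
Proof.
apply: (@open_comp _ _ sqn [set t | a < t]); last exact: open_gt.
by move=> x _; exact: sqn_cont.
Qed.

Lemma nonzero_sqn : ~` [set (0 : pt)] = [set x | 0 < sqn x].
Proof.
apply/seteqP; split=> x /=; first by rewrite sqn_gt0 => /eqP.
by rewrite sqn_gt0 => /eqP.
Qed.

Lemma open_nonzero : open (~` [set (0 : pt)]).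
Proof. by rewrite nonzero_sqn; exact: open_sqn_gt. Qed.

(** Off the origin, functions of [|x|^2] are smooth by composition even when the
    profile involves [ln] or negative powers; at the origin they are smooth
    because of their explicit form on the unit ball. *)
Lemma smooth_cover f : smooth_on [set x | sqn x < 1] f ->
  smooth_on (~` [set 0]) f -> smooth_on setT f.
Proof.
move=> f1 f2; apply: smooth_sub (smooth_setU f1 f2) => x _.
have [->|x0] := eqVneq x 0; first by left; rewrite /= sqn0.
by right; exact/eqP.
Qed.

Lemma smooth_expinv k (U : set pt) f : open U -> smooth_on U f ->
  smooth_on U (fun x => expinv k (f x)).
Proof.
move=> oU sf; apply/smoothP => N; elim: N k => [|N IH] k.
  move=> x Ux; apply: continuous_comp; first exact: smooth_cont sf Ux.
  exact: derive_cont (is_derive_expinv k _).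
move/smoothP: sf => sf.
apply: (Ck_compS (h' := fun s => expinv k.+2 s - k%:R * expinv k.+1 s)) => //.
  by move=> x _; exact: is_derive_expinv.
apply: (@Ck_eq _ _ _ _ (fun x => expinv k.+2 (f x) + - k%:R * expinv k.+1 (f x))) => //.
  by move=> x _; rewrite mulNr.
by apply: Ck_add => //; apply: Ck_mul => //; exact: Ck_cst.
Qed.

Lemma smooth_lconf : smooth_on setT (fun x => lconf (sqn x)).
Proof.
apply: smooth_cover.
  apply: (@smooth_eq _ _ _ (fun=> 0)); [exact: open_sqn_lt| |exact/smooth_cst/open_sqn_lt].
  by move=> x /= x1; rewrite lconf_le1// ltW.
have oU := open_nonzero; have sln : smooth_on (~` [set 0]) (fun x => ln (sqn x)).
  apply: smooth_ln => //; last exact: smooth_sqn.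
  by move=> x; rewrite nonzero_sqn.
have s0 := smooth_expinv 0 oU sln.
exact: smooth_mul oU (smooth_cst _ oU) (smooth_mul oU sln s0).
Qed.

Lemma smooth_conf : smooth_on setT (fun x => conf (sqn x)).
Proof.
apply: smooth_expR; first exact: openT.
by apply: smooth_mul; [exact: openT|exact/smooth_cst/openT|exact: smooth_lconf].
Qed.

Lemma smooth_green m (g : R -> R) c : green_profile m g c ->
  smooth_on (~` [set 0]) (fun x => g (sqn x)).
Proof.
case=> _ _ dg _ _; have oU := open_nonzero.
have sqU x : (~` [set (0 : pt)]) x -> 0 < sqn x by rewrite nonzero_sqn.
apply: (smooth_comp (h' := fun t => - (m%:R * t^-1 ^+ m.+1 * (conf t)^-1 ^+ m))) => //.
- exact: smooth_sqn.
- by move=> x /sqU; exact: dg.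
apply: smooth_opp => //; apply: smooth_mul => //; last first.
  apply: smooth_exp => //; apply: smooth_inv => //.
    by move=> x _; rewrite conf_neq0.
  by apply: smooth_sub smooth_conf.
apply: smooth_mul => //; first exact: smooth_cst.
apply: smooth_exp => //; apply: smooth_inv => //; last exact: smooth_sqn.
by move=> x /sqU x0; rewrite gt_eqF.
Qed.

End radial.

(** * Regularised Green function *)

Section splice.
Context {R : realType}.
Implicit Types (f g : R -> R) (a t : R).

Definition splice a f g t : R := if t < a then f t else g t.

Lemma splice_lt a f g t : t < a -> splice a f g t = f t.
Proof. by rewrite /splice => ->. Qed.

Lemma splice_ge a f g t : a <= t -> splice a f g t = g t.
Proof. by rewrite /splice leNgt => /negbTE ->. Qed.

Lemma is_derive_quotient f t (d : R) : is_derive t 1 f d <->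
  forall e, 0 < e -> \forall h \near (0 : R)^', `|d - h^-1 * (f (h + t) - f t)| <= e.
Proof.
split=> [[fd <-] e e0|fd].
  have H : (fun h => h^-1 *: ((f \o shift t) (h *: (1 : R)) - f t)) @ 0^' --> 'D_1 f t by [].
  move/cvgrPdist_le : H => /(_ e e0); apply: filterS => h.
  by rewrite /= [_%:A]mulr1.
have H : (fun h => h^-1 *: ((f \o shift t) (h *: (1 : R)) - f t)) @ 0^' --> d.
  apply/cvgrPdist_le => e e0; apply: filterS (fd e e0) => h.
  by rewrite /= [_%:A]mulr1.
split; first by apply/cvg_ex; exists d.
exact: cvg_lim H.
Qed.

Lemma is_derive_splice_at a f g (d : R) : f a = g a ->
  is_derive a 1 f d -> is_derive a 1 g d -> is_derive a 1 (splice a f g) d.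
Proof.
move=> fg /is_derive_quotient fd /is_derive_quotient gd.
apply/is_derive_quotient => e e0; near=> h.
rewrite [splice a f g a]splice_ge//; have [ha|ha] := ltP (h + a) a.
  by rewrite splice_lt// -fg; near: h; exact: fd.
by rewrite splice_ge//; near: h; exact: gd.
Unshelve. all: by end_near. Qed.

Lemma is_derive_splice a f g f' g' t : f a = g a -> f' a = g' a ->
  (forall s, s <= a -> is_derive s 1 f (f' s)) ->
  (forall s, a <= s -> is_derive s 1 g (g' s)) ->
  is_derive t 1 (splice a f g) (splice a f' g' t).
Proof.
move=> fg fg' fd gd; have [ta|ta|->] := ltgtP t a.
- rewrite splice_lt//; apply: near_eq_is_derive (fd t (ltW ta)).
  by apply: filterS (near_ltR ta) => s sa; rewrite splice_lt.
- rewrite splice_ge ?ltW//; apply: near_eq_is_derive (gd t (ltW ta)).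
  by apply: filterS (near_gtR ta) => s sa; rewrite splice_ge// ltW.
- rewrite splice_ge//; apply: is_derive_splice_at => //; last exact: gd.
  by rewrite -fg'; exact: fd.
Qed.

Lemma splice_cont a f g : f a = g a ->
  (forall s, s <= a -> {for s, continuous f}) ->
  (forall s, a <= s -> {for s, continuous g}) -> continuous (splice a f g).
Proof.
move=> fg cf cg t; have [ta|ta|->] := ltgtP t a.
- apply: near_eq_contR (cf t (ltW ta)).
  by apply: filterS (near_ltR ta) => s sa; rewrite splice_lt.
- apply: near_eq_contR (cg t (ltW ta)).
  by apply: filterS (near_gtR ta) => s sa; rewrite splice_ge// ltW.
- apply/cvgrPdist_le => e e0; near=> s.
  rewrite [splice a f g a]splice_ge//; have [sa|sa] := ltP s a.
    rewrite splice_lt// -fg; near: s.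
    by move/cvgrPdist_le: (cf a (lexx a)); apply.
  rewrite splice_ge//; near: s.
  by move/cvgrPdist_le: (cg a (lexx a)); apply.
Unshelve. all: by end_near. Qed.

End splice.

Section regularised.
Context {R : realType}.
Variables (m : nat) (g : R -> R) (c : R).
Hypothesis gP : green_profile m g c.
Implicit Types (a t : R).

(** [t^-(m+1)] continued below [a] by its tangent line at [a]: the radial field
    [x theta(|x|^2)] is then C^1, and its divergence is a multiple of the
    [tent a] by [theta_tent]. *)
Definition theta a : R -> R :=
  splice a (fun t => a^-1 ^+ m.+1 * (m.+2%:R - m.+1%:R * a^-1 * t)) (fun t => t^-1 ^+ m.+1).
Definition theta1 a : R -> R :=
  splice a (fun=> - m.+1%:R * a^-1 ^+ m.+2) (fun t => - m.+1%:R * t^-1 ^+ m.+2).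
Definition tent a : R -> R :=
  splice a (fun t => m.+2%:R * a^-1 ^+ m.+2 * (a - t)) (fun=> 0).

Lemma is_derive_theta a t : 0 < a -> is_derive t 1 (theta a) (theta1 a t).
Proof.
move=> a0; have an0 : a != 0 by rewrite gt_eqF.
apply: is_derive_splice => //.
- rewrite -[RHS]mulr1; congr (_ * _); rewrite mulfVK//.
  by rewrite -[m.+2]addn1 natrD addrAC subrr add0r.
- move=> s _; have d1 := is_derive_zmul (- (m.+1%:R * a^-1)) (is_derive_idR s).
  have := is_derive_zmul (a^-1 ^+ m.+1) (is_deriveDf (is_derive_cstR s m.+2%:R) d1).
  under eq_fun do rewrite mulNr.
  by move/is_derive_subst; apply; rewrite [in RHS]exprS; ring.
- move=> s sa; have s0 : s != 0 by rewrite gt_eqF// (lt_le_trans a0).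
  have := is_derive_expf m.+1 (is_derive_inv s0).
  by move/is_derive_subst; apply; rewrite /= !exprS; ring.
Qed.

Lemma theta_cont a : 0 < a -> continuous (theta a).
Proof. by move=> a0 t; exact: derive_cont (is_derive_theta t a0). Qed.

Lemma theta1_cont a : 0 < a -> continuous (theta1 a).
Proof.
move=> a0; apply: splice_cont => // s sa; first exact: cst_continuous.
have s0 : s != 0 by rewrite gt_eqF// (lt_le_trans a0).
exact: (derive_cont (is_derive_zmul (- m.+1%:R) (is_derive_expf m.+2 (is_derive_inv s0)))).
Qed.

Lemma tent_cont a : continuous (tent a).
Proof.
apply: splice_cont => [|s _|s _]; last exact: cst_continuous.
  by rewrite subrr mulr0.
exact: (derive_cont (d := m.+2%:R * a^-1 ^+ m.+2 * (0 + -1 * 1))).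
Qed.

Lemma tent_ge0 a t : 0 < a -> 0 <= tent a t.
Proof.
move=> a0; rewrite /tent /splice; case: ifP => // ta.
by rewrite mulr_ge0 ?subr_ge0 ?ltW// mulr_gt0// exprn_gt0// invr_gt0.
Qed.

Lemma tent_ge a t : a <= t -> tent a t = 0.
Proof. by move=> ta; rewrite /tent splice_ge. Qed.

Lemma theta_tent a t : 0 < a ->
  m.+1.*2%:R * theta a t + 2 * t * theta1 a t = m.+1.*2%:R * tent a t.
Proof.
move=> a0; have an0 : a != 0 by rewrite gt_eqF.
rewrite -muln2 natrM /theta /theta1 /tent /splice; case: ltP => ta.
  rewrite -[m.+2]addn1 !natrD !addn1 !exprS; field.
  by rewrite an0.
have t0 : t != 0 by rewrite gt_eqF// (lt_le_trans a0).
by rewrite !exprS; field.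
Qed.

(** The C^2 radial profile whose gradient, weighted by [conf^m], is the field
    [- 2 m x theta a]; it agrees with the Green function outside the ball of
    radius [a^(1/2)]. *)
Definition green_reg a : R -> R :=
  splice a (fun t => g a + m%:R * a^-1 ^+ m.+1 * (m.+2%:R * (a - t) -
     2^-1 * m.+1%:R * a^-1 * (a ^+ 2 - t ^+ 2))) g.

Lemma is_derive_green_reg a t : 0 < a <= 1 ->
  is_derive t 1 (green_reg a) (- (m%:R * theta a t * (conf t)^-1 ^+ m)).
Proof.
move=> /andP[a0 a1]; have an0 : a != 0 by rewrite gt_eqF.
have [_ _ dg _ _] := gP.
have -> : - (m%:R * theta a t * (conf t)^-1 ^+ m) =
  splice a (fun t => - (m%:R * (a^-1 ^+ m.+1 * (m.+2%:R - m.+1%:R * a^-1 * t))))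
    (fun t => - (m%:R * t^-1 ^+ m.+1 * (conf t)^-1 ^+ m)) t.
  rewrite /theta /splice; case: ifP => // ta.
  by rewrite conf_le1 ?invr1 ?expr1n ?mulr1// (le_trans (ltW ta)).
apply: is_derive_splice.
- by rewrite !subrr !mulr0 subrr mulr0 addr0.
- rewrite conf_le1// invr1 expr1n mulr1 mulfVK//; congr (- (_ * _)).
  by rewrite -[m.+2]addn1 natrD addrAC subrr add0r mulr1.
- move=> s _; have d2 := is_derive_expf 2 (is_derive_idR s).
  have d1 := is_deriveDf (is_derive_cstR s a) (is_derive_zmul (-1) (is_derive_idR s)).
  have d3 := is_deriveDf (is_derive_cstR s (a ^+ 2)) (is_derive_zmul (-1) d2).
  have d4 := is_deriveDf (is_derive_zmul m.+2%:R d1)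
    (is_derive_zmul (- (2^-1 * m.+1%:R * a^-1)) d3).
  have := is_deriveDf (is_derive_cstR s (g a))
    (is_derive_zmul (m%:R * a^-1 ^+ m.+1) d4).
  under eq_fun do rewrite !mulN1r mulNr.
  by move/is_derive_subst; apply; rewrite /=; field.
- by move=> s sa; apply: dg; rewrite (lt_le_trans a0).
Qed.

Lemma green_reg_ge a t : a <= t -> green_reg a t = g t.
Proof. exact: splice_ge. Qed.

Lemma green_reg_bound a t : 0 < a <= 1 -> 0 < t ->
  `|green_reg a t| <= (1 + m%:R * m.+2%:R) * t^-1 ^+ m + c.
Proof.
move=> /andP[a0 a1] t0; have [c0 _ _ gb _] := gP.
have t0' := ltW t0; have a0' := ltW a0.
have tm : 0 <= t^-1 ^+ m by rewrite exprn_ge0// invr_ge0.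
have mm : 0 <= m%:R * m.+2%:R :> R by rewrite mulr_ge0.
rewrite /green_reg /splice; case: ltP => ta; last first.
  have /andP[g1 g2] := gb t t0'; rewrite ger0_norm; first nra.
  exact: le_trans g1.
have /andP[g1 g2] := gb a a0'.
have am : a^-1 ^+ m <= t^-1 ^+ m.
  apply: lerXn2r; rewrite ?nnegrE ?invr_ge0//.
  by rewrite lef_pV2 ?posrE// ltW.
have am0 : 0 <= a^-1 ^+ m by rewrite exprn_ge0// invr_ge0.
set P := _ - _ * (_ ^+ 2 - _).
have aP : a^-1 ^+ m.+1 * P = a^-1 ^+ m * (P / a) by rewrite exprS; ring.
have P0 : 0 <= P / a <= m.+2%:R.
  have ra : 0 <= t / a <= 1.
    by rewrite divr_ge0// ler_pdivrMr// mul1r ltW.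
  have -> : P / a = m.+2%:R * (1 - t / a) - 2^-1 * m.+1%:R * (1 - (t / a) ^+ 2).
    by rewrite /P; field; rewrite gt_eqF.
  move: (t / a) ra => r /andP[r0 r1].
  have -> : m.+2%:R = m.+1%:R + 1 :> R by rewrite -[m.+2]addn1 natrD.
  have k0 : 0 <= m.+1%:R :> R by [].
  move: (m.+1%:R : R) k0 => k k0.
  have h1 : 0 <= k * (1 - r) * (1 - r) by rewrite !mulr_ge0 ?subr_ge0.
  have h2 : 0 <= k * (1 - r) by rewrite mulr_ge0 ?subr_ge0.
  have h3 : 0 <= k * r by rewrite mulr_ge0.
  have h4 : 0 <= k * (1 - r) * r by rewrite !mulr_ge0 ?subr_ge0.
  apply/andP; split; nra.
rewrite -mulrA aP; move/andP: P0 => [P0 P1].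
have Q0 : 0 <= m%:R * (a^-1 ^+ m * (P / a)).
  by apply: mulr_ge0 => //; exact: mulr_ge0.
have Q1 : m%:R * (a^-1 ^+ m * (P / a)) <= m%:R * m.+2%:R * a^-1 ^+ m.
  by rewrite -mulrA; apply: ler_wpM2l => //; rewrite mulrC; apply: ler_wpM2r.
rewrite ger0_norm; last by rewrite addr_ge0// (le_trans am0 g1).
have : m%:R * m.+2%:R * a^-1 ^+ m <= m%:R * m.+2%:R * t^-1 ^+ m.
  by apply: ler_wpM2l.
lra.
Qed.

End regularised.

(** * Integrals of compactly supported functions *)

Section compact_support.
Context {R : realType} {n : nat}.
Local Notation RT := (measurableTypeR R).
Local Notation lebn := (@lebesgue_tuple R n).
Local Notation pt := 'rV[R]_n.
Local Notation row := (@row_of_tuple R n).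
Implicit Types (f h : pt -> R).

Definition Cc f := continuous f /\
  exists M : R, 0 <= M /\ forall (x : pt) j, M < `|x 0 j| -> f x = 0.

Definition intRn f : R := \int[lebn]_t f (row t).
Definition intableRn f := lebn.-integrable setT (EFin \o (f \o row)).

Lemma integrable_supported f (M C : R) :
  measurable_fun setT (f \o row) -> (forall x, `|f x| <= C) ->
  (forall (x : pt) j, M < `|x 0 j| -> f x = 0) -> intableRn f.
Proof.
move=> mf fC f0; apply: (@integrable_box _ _ [tuple of nseq n (0 : RT)] M _ C) => //.
  by move=> t; exact: fC.
move=> t tB; have [j] : exists j, M < `|row t 0 j|.
  apply: contrapT => tM; apply: tB => j; rewrite tnth_nseq subr0 leNgt.
  by apply/negP => ?; apply: tM; exists j; rewrite row_coord.
exact: f0.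
Qed.

Lemma Cc_bounded f : Cc f -> exists C, forall x, `|f x| <= C.
Proof.
case=> cf [M [M0 f0]]; have [C fC] := bounded_on_cube M0 cf.
exists (Num.max C 0) => x; rewrite le_max.
have [xM|] := pselect (forall i, `|x 0 i| <= M); first by rewrite fC.
by move=> /existsNP[j /negP]; rewrite -ltNge => /f0 ->; rewrite normr0 lexx orbT.
Qed.

Lemma Cc_integrable f : Cc f -> intableRn f.
Proof.
move=> csf; have [C fC] := Cc_bounded csf; case: csf => cf [M [M0 f0]].
by apply: (integrable_supported (measurable_row cf) fC f0).
Qed.

Lemma Cc_mul f h : continuous h -> Cc f -> Cc (fun x => h x * f x).
Proof.
move=> ch [cf [M [M0 f0]]]; split.
  by move=> x; exact: cvgM (ch x) (cf x).
by exists M; split=> // x j xM; rewrite (f0 x j)// mulr0.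
Qed.

Lemma Cc_add f h : Cc f -> Cc h -> Cc (fun x => f x + h x).
Proof.
move=> [cf [M [M0 f0]]] [ch [N [N0 h0]]]; split.
  by move=> x; exact: cvgD (cf x) (ch x).
exists (Num.max M N); split=> [|x j]; first by rewrite le_max M0.
by rewrite gt_max => /andP[xM xN]; rewrite (f0 x j)// (h0 x j)// addr0.
Qed.

Lemma Cc_sum (I : Type) (r : seq I) (F : I -> pt -> R) :
  (forall i, Cc (F i)) -> Cc (fun x => \sum_(i <- r) F i x).
Proof.
move=> cF; elim: r => [|i r IH].
  under eq_fun do rewrite big_nil.
  split; first exact: cst_continuous.
  by exists 0.
under eq_fun do rewrite big_cons; exact: Cc_add.
Qed.

Lemma intableRn_add f h : intableRn f -> intableRn h -> intableRn (fun x => f x + h x).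
Proof. by move=> fi hi; exact: (integrableD measurableT fi hi). Qed.

Lemma intableRn_sub f h : intableRn f -> intableRn h -> intableRn (fun x => f x - h x).
Proof. by move=> fi hi; exact: (integrableB measurableT fi hi). Qed.

Lemma intableRn_scale f (k : R) : intableRn f -> intableRn (fun x => k * f x).
Proof. by move=> fi; exact: (integrableZl measurableT k fi). Qed.

Lemma intRn_add f h : intableRn f -> intableRn h -> intRn (fun x => f x + h x) = intRn f + intRn h.
Proof. by move=> fi hi; rewrite /intRn RintegralD. Qed.

Lemma intRn_sub f h : intableRn f -> intableRn h -> intRn (fun x => f x - h x) = intRn f - intRn h.
Proof. by move=> fi hi; rewrite /intRn RintegralB. Qed.

Lemma intRn_scale f (k : R) : intableRn f -> intRn (fun x => k * f x) = k * intRn f.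
Proof. by move=> fi; rewrite /intRn RintegralZl. Qed.

Lemma intRn_sum (I : Type) (r : seq I) (F : I -> pt -> R) : (forall i, Cc (F i)) ->
  intRn (fun x => \sum_(i <- r) F i x) = \sum_(i <- r) intRn (F i).
Proof.
move=> cF; elim: r => [|i r IH].
  rewrite big_nil /intRn; under eq_Rintegral do rewrite big_nil.
  by rewrite Rintegral_cst// mul0r.
rewrite big_cons -IH -intRn_add; last 2 first.
- exact: Cc_integrable.
- by apply: Cc_integrable; exact: Cc_sum.
by congr intRn; apply/funext => x; rewrite big_cons.
Qed.

Lemma intRn_le f h : intableRn f -> intableRn h -> (forall x, f x <= h x) -> intRn f <= intRn h.
Proof. by move=> fi hi fh; apply: le_Rintegral => // t _; exact: fh. Qed.

Lemma Cc_partial i f df (M : R) : 0 <= M ->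
  (forall (x : pt) j, M < `|x 0 j| -> f x = 0) ->
  (forall x : pt, is_derive x (delta_mx 0 i) f (df x)) -> continuous df -> Cc df.
Proof.
move=> M0 f0 fd cdf; split=> //; exists M; split=> // x j xM.
exact: derive_outside_cube f0 xM (fd x).
Qed.

Lemma divergence_theorem (F dF : 'I_n -> pt -> R) (M : R) : 0 <= M ->
  (forall i (x : pt) j, M < `|x 0 j| -> F i x = 0) ->
  (forall i (x : pt), is_derive x (delta_mx 0 i) (F i) (dF i x)) ->
  (forall i, continuous (dF i)) -> intRn (fun x => \sum_i dF i x) = 0.
Proof.
move=> M0 F0 Fd cdF; rewrite intRn_sum.
  rewrite big1// => i _; rewrite /intRn /Rintegral.
  by rewrite (integral_partial0 M0 (F0 i) (Fd i) (cdF i)).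
by move=> i; exact: Cc_partial M0 (F0 i) (Fd i) (cdF i).
Qed.

End compact_support.

(** * The mass of the tents *)

Section tent_mass.
Context {R : realType}.
Variables (n m : nat).
Hypothesis hn : n = m.+1.*2.
Local Notation RT := (measurableTypeR R).
Local Notation lebn := (@lebesgue_tuple R n).
Local Notation pt := 'rV[R]_n.
Local Notation row := (@row_of_tuple R n).
Implicit Types a b : R.

Definition ball_volume : R :=
  fine (lebn [set t : n.-tuple RT | \sum_i tnth t i ^+ 2 <= 1]).

Lemma far_sqn (x : pt) (M : R) j : 1 <= M -> M < `|x 0 j| -> M < sqn x.
Proof.
move=> M1 xM; have M0 : 0 <= M by rewrite (le_trans ler01).
apply: lt_le_trans (coord_sqn x j); rewrite -real_normK ?num_real//.
by rewrite expr2; nra.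
Qed.

Lemma Cc_tent a : Cc (fun x : pt => tent m a (sqn x)).
Proof.
split; first by move=> x; apply: radial_cont; exact: tent_cont.
exists (1 + `|a|); split=> [|x j xM]; first exact: addr_ge0.
rewrite tent_ge//; apply: ltW; apply: le_lt_trans (ler_norm a) _.
apply: le_lt_trans (far_sqn _ xM); first by rewrite lerDr.
by rewrite lerDl.
Qed.

(** The difference of two tents is the divergence of a radial field that vanishes
    outside a ball. *)
Lemma tent_mass_const a b : 0 < a -> 0 < b ->
  intRn (fun x : pt => tent m a (sqn x)) = intRn (fun x : pt => tent m b (sqn x)).
Proof.
move=> a0 b0; apply/eqP; rewrite -subr_eq0 -intRn_sub; last 2 first.
- exact/Cc_integrable/Cc_tent.
- exact/Cc_integrable/Cc_tent.
have n0 : n%:R != 0 :> R by rewrite pnatr_eq0 hn.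
rewrite -(mulrI_eq0 _ (mulfI n0)) -intRn_scale; last first.
  apply: (Cc_integrable (f := fun x : pt => tent m a (sqn x) - tent m b (sqn x))).
  apply: Cc_add (Cc_tent a) _.
  under eq_fun do rewrite -mulN1r; apply: Cc_mul (Cc_tent b).
  exact: cst_continuous.
pose dth t := theta m a t - theta m b t; pose dth1 t := theta1 m a t - theta1 m b t.
have dthd (t : R) : is_derive t 1 dth (dth1 t).
  have := is_deriveDf (is_derive_theta m t a0) (is_derive_zmul (-1) (is_derive_theta m t b0)).
  by rewrite mulN1r; under eq_fun do rewrite mulN1r.
pose F i (x : pt) := x 0 i * dth (sqn x).
pose dF i (x : pt) := dth (sqn x) + x 0 i * (dth1 (sqn x) * (2 * x 0 i)).
have M1 : 1 <= 1 + a + b by rewrite -addrA lerDl addr_ge0// ltW.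
apply/eqP; transitivity (intRn (fun x : pt => \sum_i dF i x)).
  congr intRn; apply/funext => x; rewrite /dF big_split /= sumr_const card_ord.
  have -> : \sum_i x 0 i * (dth1 (sqn x) * (2 * x 0 i)) = 2 * sqn x * dth1 (sqn x).
    rewrite /sqn mulr_sumr mulr_suml; apply: eq_bigr => i _; ring.
  have := theta_tent m (sqn x) a0; have := theta_tent m (sqn x) b0.
  rewrite -hn -mulr_natl /dth /dth1 => h1 h2; lra.
apply: (@divergence_theorem _ _ F dF (1 + a + b)).
- by rewrite (le_trans ler01).
- move=> i x j xM; have xs := far_sqn M1 xM; rewrite /F /dth /theta !splice_ge; last 2 first.
  + by apply: ltW; apply: lt_trans xs; lra.
  + by apply: ltW; apply: lt_trans xs; lra.
  by rewrite subrr mulr0.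
- move=> i x; have := is_deriveMf (is_derive_coord x i i) (is_derive_radial i (dthd (sqn x))).
  by rewrite eqxx mul1r.
- have c1 : continuous dth1.
    by move=> t; apply: cvgB; exact: theta1_cont.
  have cd t : {for t, continuous dth} by exact: derive_cont (dthd t).
  move=> i x; have h1 := @radial_cont R n dth x (cd _).
  have h2 := @radial_cont R n dth1 x (c1 _).
  have h3 : {for x, continuous (fun y : pt => 2 * y 0 i)}.
    exact: cvgM (cvg_cst _) (@coord_cont R n i x).
  exact: cvgD h1 (cvgM (@coord_cont R n i x) (cvgM h2 h3)).
Qed.

Let ball01 : set (n.-tuple RT) := [set t | \sum_i tnth t i ^+ 2 <= 1].

Let sqn_row (t : n.-tuple RT) : sqn (row t) = \sum_i tnth t i ^+ 2.
Proof. by apply: eq_bigr => i _; rewrite row_coord. Qed.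

Let ball01E : ball01 = ~` (row @^-1` [set x : pt | 1 < sqn x]).
Proof.
apply/seteqP; split=> t; rewrite /ball01 /= sqn_row.
  by rewrite leNgt => /negP.
by move/negP; rewrite -leNgt.
Qed.

Let measurable_ball01 : measurable ball01.
Proof.
rewrite ball01E; apply: measurableC; apply: open_measurable_row.
exact: open_sqn_gt.
Qed.

Let chi (x : pt) : R := if sqn x <= 1 then 1 else 0.

Let chiE : chi \o row = \1_ball01.
Proof.
apply/funext => t; rewrite indicE /chi /= sqn_row.
by case: ifPn => h; [rewrite mem_set|rewrite memNset//; exact/negP].
Qed.

Let intableRn_chi : intableRn chi.
Proof.
apply: (@integrable_supported _ _ _ 1 1).
- by rewrite chiE; exact: measurable_indic.
- by move=> x; rewrite /chi; case: ifP; rewrite ?normr1 ?normr0.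
- by move=> x j xj; rewrite /chi leNgt (far_sqn _ xj).
Qed.

Let intRn_chi : intRn chi = ball_volume.
Proof.
rewrite /intRn (_ : (fun t => chi (row t)) = \1_ball01); last exact: chiE.
by rewrite /Rintegral integral_indic// setIT.
Qed.

Let P a (x : pt) : R := splice a (fun t => a - t) (fun=> 0) (sqn x).

Let tentE a : 0 < a ->
  (fun x : pt => tent m a (sqn x)) = (fun x => m.+2%:R * a^-1 ^+ m.+2 * P a x).
Proof.
move=> a0; apply/funext => x; rewrite /tent /P /splice; case: ifP => // _.
by rewrite mulr0.
Qed.

Let PE a : 0 < a ->
  P a = (fun x : pt => m.+2%:R^-1 * a ^+ m.+2 * tent m a (sqn x)).
Proof.
move=> a0; apply/funext => x; have := congr1 (@^~ x) (tentE a0) => /= ->.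
rewrite mulrA -[_ * (m.+2%:R * _)]mulrACA mulVf ?pnatr_eq0// mul1r -exprMn.
by rewrite mulfV ?gt_eqF// expr1n mul1r.
Qed.

Let intableRn_P a : 0 < a -> intableRn (P a).
Proof.
move=> a0; rewrite PE//; apply: Cc_integrable.
by apply: Cc_mul (Cc_tent _); exact: cst_continuous.
Qed.

Let intRn_P a : 0 < a ->
  intRn (P a) = m.+2%:R^-1 * a ^+ m.+2 * intRn (fun x : pt => tent m 1 (sqn x)).
Proof.
move=> a0; rewrite PE// intRn_scale; last exact/Cc_integrable/Cc_tent.
by rewrite (tent_mass_const a0 ltr01).
Qed.

Let intableRn_PB b : 0 < b -> intableRn (fun x => P b x - P 1 x).
Proof. by move=> b0; apply: intableRn_sub; exact: intableRn_P. Qed.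

(** The tents average the indicators of balls, so their mass is determined by
    the volume of the unit ball: their primitives, of mass proportional to
    [a ^+ m.+2], are compared with the indicator from both sides, and the
    difference quotients at [a = 1] are squeezed. *)
Lemma tent_mass a : 0 < a -> intRn (fun x : pt => tent m a (sqn x)) = ball_volume.
Proof.
move=> a0; rewrite (tent_mass_const a0 ltr01).
set kappa := intRn _.
pose q b := m.+2%:R^-1 * kappa * \sum_(i < m.+2) b ^+ i - ball_volume.
have diff b : 0 < b ->
    intRn (fun x => P b x - P 1 x) = (b - 1) * (m.+2%:R^-1 * kappa * \sum_(i < m.+2) b ^+ i).
  move=> b0; rewrite intRn_sub; [|exact: intableRn_P|exact: intableRn_P].
  rewrite !intRn_P// expr1n -/kappa [RHS]mulrCA -subrX1; ring.
have q_lt b : 0 < b < 1 -> q b <= 0.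
  move=> /andP[b0 b1]; rewrite /q subr_le0 -intRn_chi.
  have := diff b b0; rewrite -opprB mulNr => /eqP; rewrite -eqr_oppLR => /eqP d.
  rewrite -(@ler_pM2l _ (1 - b)) ?subr_gt0// -d -mulN1r -!intRn_scale//; last first.
    exact: intableRn_PB.
  apply: intRn_le; [exact: intableRn_scale (intableRn_PB b0)|exact: intableRn_scale|].
  - move=> x; rewrite /P /chi /splice; case: (ltP (sqn x) b) => xb.
      have x1 : sqn x < 1 by rewrite (lt_trans xb).
      by rewrite x1 (ltW x1) mulN1r; lra.
    case: (ltP (sqn x) 1) => x1; first by rewrite (ltW x1); lra.
    by case: ifP => _; rewrite ?mulN1r; lra.
have q_gt b : 1 < b -> 0 <= q b.
  move=> b1; have b0 : 0 < b by rewrite (lt_trans _ b1).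
  rewrite /q subr_ge0 -intRn_chi -(@ler_pM2l _ (b - 1)) ?subr_gt0// -diff// -intRn_scale//.
  apply: intRn_le; [exact: intableRn_scale|exact: intableRn_PB|] => x.
  rewrite /P /chi /splice; case: (ltP (sqn x) 1) => x1.
    by rewrite (lt_trans x1 b1) (ltW x1); lra.
  by case: (ltP (sqn x) b) => xb; case: ifP => xl; lra.
have cq : continuous q.
  move=> b; have cs : (fun b : R => \sum_(i < m.+2) b ^+ i) =
      horner (\poly_(i < m.+2) 1).
    by apply/funext => y; rewrite horner_poly; apply: eq_bigr => i _; rewrite mul1r.
  have := @continuous_horner R (\poly_(i < m.+2) 1) b; rewrite -cs => ch.
  exact: cvgB (cvgM (cvg_cst _) ch) (cvg_cst _).
have q1 : q 1 = kappa - ball_volume.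
  rewrite /q (eq_bigr (fun=> 1)) => [|i _]; last exact: expr1n.
  by rewrite sumr_const card_ord mulrAC mulVf ?pnatr_eq0// mul1r.
apply/eqP; rewrite -subr_eq0 -q1 eq_le; apply/andP; split; rewrite leNgt; apply/negP => q10.
- have : \forall b \near (1 : R), 0 < q b by exact: cvgr_gt (cq 1) _ q10.
  move=> /nbhs_ballP[e /= e0 eq].
  pose d := Num.min e 1 / 2.
  have d0 : 0 < d by rewrite divr_gt0// lt_min e0 ltr01.
  have de : d < e by rewrite /d ltr_pdivrMr// mulr_natr mulr2n gt_min ltr_pwDr.
  have d1 : d < 1 by rewrite /d ltr_pdivrMr// mul1r gt_min ltr1n orbT.
  have := eq (1 - d); rewrite /ball /= opprB addrC subrK gtr0_norm// => /(_ de).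
  by rewrite ltNge q_lt//; apply/andP; split; lra.
- have : \forall b \near (1 : R), q b < 0 by exact: cvgr_lt (cq 1) _ q10.
  move=> /nbhs_ballP[e /= e0 eq].
  have := eq (1 + e / 2); rewrite /ball /= opprD addNKr normrN gtr0_norm ?divr_gt0//.
  rewrite ltr_pdivrMr// ltr_pMr// ltr1n => /(_ isT).
  by rewrite ltNge q_gt// ltrDl divr_gt0.
Qed.

End tent_mass.

(** * The Green equation *)

Section green_equation.
Context {R : realType}.
Variables (n m : nat) (g : R -> R) (c : R).
Hypothesis hn : n = m.+1.*2.
Hypothesis gP : green_profile m g c.
Local Notation pt := 'rV[R]_n.
Implicit Types (a t : R) (x : pt) (phi : pt -> R).

(** The Laplacian of the metric multiplied by the volume density, see
    [laplacian_vol]. *)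
Definition wlap phi x : R :=
  \sum_i partial i (fun y => conf (sqn y) ^+ m * partial i phi y) x.

Lemma test_support phi : test_function phi ->
  exists M : R, 0 <= M /\ forall x j, M < `|x 0 j| -> phi x = 0.
Proof.
case=> _ /compact_coord_bounded [M [M0 HM]]; exists M; split=> // x j xM.
apply: contrapT => /eqP phix; move: xM; rewrite ltNge HM//.
exact: (@subset_closure _ [set x | phi x != 0]).
Qed.

Lemma smooth_weighted phi i : smooth_on setT phi ->
  smooth_on setT (fun y => conf (sqn y) ^+ m * partial i phi y).
Proof.
move=> sphi; apply: smooth_mul; [exact: openT| |exact: smooth_partial].
by apply: smooth_exp; [exact: openT|exact: smooth_conf].
Qed.

Lemma wlap_summand_cont phi i : smooth_on setT phi ->
  continuous (partial i (fun y => conf (sqn y) ^+ m * partial i phi y)).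
Proof.
by move=> sphi x; exact: smooth_cont (smooth_partial i (smooth_weighted i sphi)) I.
Qed.

Lemma partial_supp phi i (M : R) : smooth_on setT phi ->
  (forall x j, M < `|x 0 j| -> phi x = 0) ->
  forall x j, M < `|x 0 j| -> partial i phi x = 0.
Proof.
move=> sphi phi0 x j xM.
exact: derive_outside_cube phi0 xM (smooth_derive i sphi (I : setT x)).
Qed.

Lemma Cc_wlap phi : test_function phi -> Cc (wlap phi).
Proof.
move=> tphi; have [M [M0 phi0]] := test_support tphi; have [sphi _] := tphi.
apply: Cc_sum => i; split; first exact: wlap_summand_cont.
exists M; split=> // x j xM.
apply: (@partial_supp (fun y => conf (sqn y) ^+ m * partial i phi y) i M) xM.
  exact: smooth_weighted.
by move=> y k yM; rewrite (partial_supp i sphi phi0 yM) mulr0.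
Qed.

Lemma Cc_test phi : test_function phi -> Cc phi.
Proof.
move=> tphi; have [M [M0 phi0]] := test_support tphi; have [sphi _] := tphi.
by split; [move=> x; exact: smooth_cont sphi I|exists M].
Qed.

Lemma green_reg_cont a : 0 < a <= 1 -> continuous (fun x => green_reg m g a (sqn x)).
Proof.
move=> a01 x.
exact: (@radial_cont R n _ x (derive_cont (is_derive_green_reg gP (sqn x) a01))).
Qed.

(** Green's second identity for the regularised Green function: the flux of
    its gradient is the field [theta a], whose divergence is the tent. *)
Lemma green_reg_identity a phi : 0 < a <= 1 -> test_function phi ->
  intRn (fun x => green_reg m g a (sqn x) * wlap phi x) =
  - (2 * m%:R * n%:R) * intRn (fun x => tent m a (sqn x) * phi x).
Proof.
move=> a01 tphi; have [M [M0 phi0]] := test_support tphi; have [sphi _] := tphi.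
have [a0 a1] := andP a01.
pose W i y := conf (sqn y) ^+ m * partial i phi y.
pose F i x := green_reg m g a (sqn x) * W i x + 2 * m%:R * (x 0 i * theta m a (sqn x) * phi x).
pose dF i x := green_reg m g a (sqn x) * partial i (W i) x +
  2 * m%:R * ((theta m a (sqn x) + x 0 i * (theta1 m a (sqn x) * (2 * x 0 i))) * phi x).
have Z : intRn (fun x => \sum_i dF i x) = 0.
  apply: (@divergence_theorem _ _ F dF M) => //.
  - move=> i x j xM; rewrite /F /W (phi0 x j xM) (partial_supp i sphi phi0 xM).
    by rewrite !mulr0 addr0.
  - move=> i x.
    have d1 := is_deriveMf (is_derive_radial i (is_derive_green_reg gP (sqn x) a01))
      (smooth_derive i (smooth_weighted i sphi) (I : setT x)).
    have d2 := is_deriveMf (is_derive_coord x i i)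
      (is_derive_radial i (is_derive_theta m (sqn x) a0)).
    have d3 := is_deriveMf d2 (smooth_derive i sphi (I : setT x)).
    have d4 := is_deriveMf (is_derive_cst (2 * m%:R : R) x (delta_mx 0 i)) d3.
    have := is_deriveDf d1 d4; move/is_derive_subst; apply.
    rewrite /dF eqxx mul1r mul0r add0r /W.
    set A := partial i _ x; rewrite exprVn.
    by rewrite /cst; field; rewrite expf_neq0// conf_neq0.
  - move=> i x.
    have c1 : {for x, continuous (fun y : pt => green_reg m g a (sqn y))}.
      exact: green_reg_cont.
    have c2 : {for x, continuous (partial i (W i))} by exact: wlap_summand_cont.
    have c3 : {for x, continuous (fun y : pt => theta m a (sqn y))}.
      exact: (@radial_cont R n _ x (@theta_cont R m a a0 (sqn x))).
    have c4 : {for x, continuous (fun y : pt => theta1 m a (sqn y))}.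
      exact: (@radial_cont R n _ x (@theta1_cont R m a a0 (sqn x))).
    have c5 := @coord_cont R n i x.
    have c6 : {for x, continuous phi} by exact: smooth_cont sphi I.
    exact: cvgD (cvgM c1 c2) (cvgM (cvg_cst _)
      (cvgM (cvgD c3 (cvgM c5 (cvgM c4 (cvgM (cvg_cst _) c5)))) c6)).
have E : (fun x => \sum_i dF i x) = (fun x => green_reg m g a (sqn x) * wlap phi x +
    2 * m%:R * n%:R * (tent m a (sqn x) * phi x)).
  apply/funext => x; rewrite /dF big_split /= -mulr_sumr; congr (_ + _).
  rewrite -mulr_sumr -mulr_suml big_split /= sumr_const card_ord.
  have -> : \sum_i x 0 i * (theta1 m a (sqn x) * (2 * x 0 i)) = 2 * sqn x * theta1 m a (sqn x).
    rewrite /sqn mulr_sumr mulr_suml; apply: eq_bigr => i _; ring.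
  rewrite -[theta m a (sqn x) *+ n]mulr_natl.
  have := theta_tent m (sqn x) a0; rewrite -hn => ->; ring.
have it : intableRn (fun x => tent m a (sqn x) * phi x).
  apply: Cc_integrable; apply: Cc_mul (Cc_test tphi).
  by case: (@Cc_tent R n m a).
have ig : intableRn (fun x => green_reg m g a (sqn x) * wlap phi x).
  by apply: Cc_integrable; apply: Cc_mul (Cc_wlap tphi); exact: green_reg_cont.
move: Z; rewrite E intRn_add ?intRn_scale//; last exact: intableRn_scale.
by move/eqP; rewrite addr_eq0 => /eqP ->; rewrite mulNr.
Qed.

(** The tents form an approximate identity, of total mass the volume of the
    unit ball. *)
Lemma tent_limit phi e : test_function phi -> 0 < e ->
  exists d : R, 0 < d /\ forall a, 0 < a < d ->
    `|intRn (fun x => tent m a (sqn x) * phi x) - ball_volume n * phi 0| <= e * ball_volume n.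
Proof.
move=> tphi e0; have [cphi _] := Cc_test tphi.
have : \forall x \near (0 : pt), `|phi 0 - phi x| <= e.
  by move/cvgrPdist_le: (cphi 0); exact.
move=> /nbhs_ballP[d /= d0 dphi]; exists (d ^+ 2); split; first exact: exprn_gt0.
move=> a /andP[a0 ad].
have it : intableRn (fun x : pt => tent m a (sqn x)) by exact/Cc_integrable/Cc_tent.
have itp : intableRn (fun x => tent m a (sqn x) * phi x).
  apply: Cc_integrable; apply: Cc_mul (Cc_test tphi).
  by case: (@Cc_tent R n m a).
rewrite -(tent_mass hn a0).
have H x : `|tent m a (sqn x) * phi x - phi 0 * tent m a (sqn x)| <= e * tent m a (sqn x).
  rewrite [phi 0 * _]mulrC -mulrBr normrM ger0_norm ?tent_ge0// [leRHS]mulrC.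
  have [xa|xa] := leP a (sqn x); first by rewrite tent_ge// !mul0r.
  apply: ler_wpM2l; first exact: tent_ge0.
  rewrite distrC; apply: dphi; apply: rV_ballP => // j.
  rewrite mxE sub0r normrN -(@ltr_pXn2r _ 2) ?nnegrE ?(ltW d0)//.
  rewrite real_normK ?num_real// (le_lt_trans (coord_sqn x j))//.
  exact: lt_trans xa ad.
rewrite (mulrC _ (phi 0)) -!intRn_scale// -intRn_sub//; last exact: intableRn_scale.
have iD := intableRn_sub itp (intableRn_scale (phi 0) it).
rewrite ler_norml -mulN1r -intRn_scale; last exact: intableRn_scale.
apply/andP; split; apply: intRn_le => //; try exact: intableRn_scale.
- by apply: intableRn_scale; exact: intableRn_scale.
- by move=> x; rewrite mulN1r; have := H x; rewrite ler_norml => /andP[].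
- by move=> x; have := H x; rewrite ler_norml => /andP[].
Qed.

End green_equation.

Section green_equation_limit.
Context {R : realType}.
Variables (n m : nat) (g : R -> R) (c : R).
Hypothesis hn : n = m.+1.*2.
Hypothesis m_gt0 : (0 < m)%N.
Hypothesis gP : green_profile m g c.
Local Notation RT := (measurableTypeR R).
Local Notation lebn := (@lebesgue_tuple R n).
Local Notation pt := 'rV[R]_n.
Local Notation row := (@row_of_tuple R n).
Implicit Types (a t : R) (x : pt) (phi h : pt -> R).

Lemma measurable_row_punctured h : (forall x, x != 0 -> {for x, continuous h}) ->
  measurable_fun setT (h \o row).
Proof.
move=> ch; set A := row @^-1` (~` [set 0]).
have mA : measurable A by apply: open_measurable_row; exact: open_nonzero.
have -> : [set: n.-tuple RT] = A `|` ~` A by rewrite setUv.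
apply/measurable_funU => //; first exact: measurableC.
split.
  by apply: measurable_row_on; [exact: open_nonzero|move=> x /eqP; exact: ch].
apply: (@eq_measurable_fun _ _ _ _ _ (cst (h 0))); last exact: measurable_cst.
by move=> t; rewrite inE /A /= => /contrapT ->.
Qed.

Lemma inv_pow_cont x : x != 0 -> {for x, continuous (fun x => (sqn x)^-1 ^+ m)}.
Proof.
move=> x0; have s0 : sqn x != 0 by rewrite sqn_eq0.
exact: (@radial_cont R n (fun t => t^-1 ^+ m) x
  (derive_cont (is_derive_expf m (is_derive_inv s0)))).
Qed.

Let half : R := 2^-1.

(** On the dyadic shell where [t] is comparable with [2^-j], the tent of radius
    [2^-j] dominates [t^-m]. *)
Lemma dyadic_tent t : 0 < t < 2^-1 ->
  exists j, t^-1 ^+ m <= 4 ^+ m * (half ^+ j * tent m (half ^+ j) t).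
Proof.
move=> /andP[t0 t12].
have exj : exists j, half ^+ j <= 4 * t.
  have h1 : `|half| < 1 by rewrite gtr0_norm ?invr_gt0// invf_lt1// ltr1n.
  have t4 : 0 < 4 * t by rewrite mulr_gt0.
  have /cvgrPdist_lt/(_ _ t4)[j _ jP] := cvg_expr h1.
  exists j; have := jP j (leqnn j); rewrite sub0r normrN ger0_norm ?exprn_ge0 ?invr_ge0//.
  exact: ltW.
pose j := ex_minn exj; exists j.
have [j4 jmin] : half ^+ j <= 4 * t /\ forall k, half ^+ k <= 4 * t -> (j <= k)%N.
  by rewrite /j; case: ex_minnP.
have j2 : 2 * t <= half ^+ j.
  case: (posnP j) => [->|j0]; first by rewrite expr0; lra.
  rewrite leNgt; apply/negP => jt.
  have : half ^+ j.-1 <= 4 * t.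
    have : half ^+ j = half * half ^+ j.-1 by rewrite -exprS prednK.
    by rewrite /half => e; lra.
  by move=> /jmin; rewrite leqNgt prednK// leqnn.
move: (half ^+ j) j4 j2 => a j4 j2 {jmin}.
have a0 : 0 < a by lra.
have at4 : t^-1 ^+ m <= 4 ^+ m * a^-1 ^+ m.
  rewrite -exprMn; apply: lerXn2r; rewrite ?nnegrE ?invr_ge0 ?mulr_ge0 ?invr_ge0 ?(ltW t0) ?(ltW a0)//.
  by rewrite ler_pdivlMr// ler_pdivrMl// mulrC.
apply: le_trans at4 _; apply: ler_wpM2l; first by rewrite exprn_ge0.
rewrite /tent splice_lt; last lra.
have -> : a * (m.+2%:R * a^-1 ^+ m.+2 * (a - t)) = a^-1 ^+ m * (m.+2%:R * (1 - t / a)).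
  by rewrite !exprS; field; rewrite gt_eqF.
rewrite -[leLHS]mulr1; apply: ler_wpM2l; first by rewrite exprn_ge0 ?invr_ge0 ?ltW.
have ta : t / a <= 2^-1 by rewrite ler_pdivrMr//; lra.
have m2 : 2 <= m.+2%:R :> R by rewrite ler_nat.
nra.
Qed.

Definition sing x : R := if sqn x < 2^-1 then (sqn x)^-1 ^+ m else 0.

Lemma measurable_sing : measurable_fun setT (sing \o row).
Proof.
have mB : measurable (row @^-1` [set x : pt | sqn x < 2^-1]).
  by apply: open_measurable_row; exact: open_sqn_lt.
rewrite (_ : sing \o row = (\1_(row @^-1` [set x : pt | sqn x < 2^-1]) : _ -> R) \*
   ((fun x => (sqn x)^-1 ^+ m) \o row)).
  apply: measurable_funM; first exact: measurable_indic.
  exact: measurable_row_punctured inv_pow_cont.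
apply/funext => t; rewrite /sing /= indicE; case: ifPn => h.
  by rewrite mem_set//= mul1r.
by rewrite memNset/= ?mul0r//; exact/negP.
Qed.

Lemma sing_ge0 x : 0 <= sing x.
Proof. by rewrite /sing; case: ifP => // _; rewrite exprn_ge0// invr_ge0 sqn_ge0. Qed.

(** The tents of dyadic radii have the same mass, so the weighted sum that
    dominates the singularity has finite mass. *)
Lemma intableRn_sing : intableRn sing.
Proof.
apply/integrableP; split; first by apply/measurable_EFinP; exact: measurable_sing.
pose f k (t : n.-tuple RT) := (4 ^+ m * (half ^+ k * tent m (half ^+ k) (sqn (row t))))%:E.
have h0 k : 0 < half ^+ k.
  by apply: exprn_gt0; rewrite invr_gt0.
have f0 k (t : n.-tuple RT) : (0 <= f k t)%E.
  rewrite lee_fin; apply: mulr_ge0; first by rewrite exprn_ge0.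
  by apply: mulr_ge0; [exact: ltW|exact: tent_ge0].
have it k : intableRn (fun x : pt => tent m (half ^+ k) (sqn x)) by exact/Cc_integrable/Cc_tent.
have itf k : lebn.-integrable setT (f k).
  exact: (intableRn_scale (4 ^+ m) (intableRn_scale (half ^+ k) (it k))).
have mf k : measurable_fun setT (f k) by case/integrableP: (itf k).
apply: (@le_lt_trans _ _ (\int[lebn]_t \sum_(k <oo) f k t)%E).
  apply: ge0_le_integral => //.
  - by apply: measurableT_comp => //; apply/measurable_EFinP; exact: measurable_sing.
  - exact: ge0_emeasurable_sum.
  move=> t _; rewrite /= ger0_norm ?sing_ge0//.
  have [t0|] := boolP (0 < sqn (row t) < 2^-1); last first.
    rewrite /sing; case: ifPn => [_|_ _]; last by rewrite nneseries_ge0.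
    rewrite andbT -leNgt => s0; have -> : sqn (row t) = 0.
      by apply/eqP; rewrite eq_le s0 sqn_ge0.
    by rewrite invr0 expr0n gtn_eqF// nneseries_ge0.
  have [j tj] := dyadic_tent t0.
  rewrite /sing; case/andP: t0 => _ ->.
  apply: (@le_trans _ _ (f j t)); first by rewrite lee_fin.
  apply: le_trans (nneseries_lim_ge j.+1 _) => //.
  by rewrite big_nat_recr//= leeDr// sume_ge0.
rewrite integral_nneseries//.
have E k : (\int[lebn]_t f k t = (2 * 4 ^+ m * ball_volume n / (2 ^ k.+1)%:R)%:E)%E.
  have := intRn_scale (4 ^+ m) (intableRn_scale (half ^+ k) (it k)).
  rewrite (intRn_scale (half ^+ k) (it k)) (tent_mass hn (h0 k)) /intRn /Rintegral => e.
  rewrite -[LHS]fineK; last exact: integrable_fin_num.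
  rewrite [fine _]e; congr EFin; rewrite natrX exprS /half exprVn; field.
  by rewrite expf_neq0.
under eq_eseriesr do rewrite E.
apply: le_lt_trans (epsilon_trick0 _ _) _; last exact: ltry.
by rewrite mulr_ge0// fine_ge0.
Qed.

Lemma inv_pow_le x : (sqn x)^-1 ^+ m <= sing x + 2 ^+ m.
Proof.
rewrite /sing; case: ltP => h; first by rewrite lerDl exprn_ge0.
rewrite add0r; apply: lerXn2r; rewrite ?nnegrE ?invr_ge0 ?sqn_ge0//.
by rewrite -[leRHS]invrK lef_pV2 ?posrE ?invr_gt0// (lt_le_trans _ h)// invr_gt0.
Qed.

Lemma green_cont x : x != 0 -> {for x, continuous (fun x => g (sqn x))}.
Proof. by move=> /eqP x0; exact: smooth_cont (smooth_green gP) x0. Qed.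

Lemma green_bound x : `|g (sqn x)| <= (sqn x)^-1 ^+ m + c.
Proof.
have [_ _ _ gb _] := gP; have /andP[g1 g2] := gb _ (sqn_ge0 x).
by rewrite ger0_norm// (le_trans _ g1)// exprn_ge0// invr_ge0 sqn_ge0.
Qed.

Lemma intableRn_dom (f h : pt -> R) : measurable_fun setT (f \o row) -> intableRn h ->
  (forall x, `|f x| <= h x) -> intableRn f.
Proof.
move=> mf hi fh; apply: (le_integrable measurableT _ _ hi).
  exact/measurable_EFinP.
by move=> t _; rewrite /= lee_fin (le_trans (fh _))// ler_norm.
Qed.

Let cube (M : R) x : R := if `[< forall j, `|x 0 j| <= M >] then 1 else 0.

Let intableRn_cube M : 0 <= M -> intableRn (cube M).
Proof.
move=> M0; apply: (@integrable_supported _ _ _ M 1).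
- rewrite (_ : cube M \o row = \1_(box [tuple of nseq n (0 : RT)] M)).
    by apply: measurable_indic; exact: measurable_box.
  apply/funext => t; rewrite indicE /cube /=; case: asboolP => tM.
    by rewrite mem_set// => i; rewrite tnth_nseq subr0 -row_coord.
  rewrite memNset// => tB; apply: tM => i.
  by have := tB i; rewrite tnth_nseq subr0 row_coord.
- by move=> x; rewrite /cube; case: ifP; rewrite ?normr1 ?normr0.
- move=> x j xM; rewrite /cube asboolF// => /(_ j).
  by rewrite leNgt xM.
Qed.

(** An integrable majorant, on a cube, of the products of the Green function and
    of its regularisations with a function bounded by [C]. *)
Let dom (M C A : R) x : R := C * (A * (sing x + 2 ^+ m * cube M x) + c * cube M x).

Let intableRn_domf M C A : 0 <= M -> intableRn (dom M C A).
Proof.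
move=> M0; apply: intableRn_scale; apply: intableRn_add; last exact/intableRn_scale/intableRn_cube.
apply: intableRn_scale; apply: intableRn_add; first exact: intableRn_sing.
exact/intableRn_scale/intableRn_cube.
Qed.

Let dom_bound (M C A : R) h x (r : R) : 0 <= A -> 0 <= C ->
  (forall x j, M < `|x 0 j| -> h x = 0) -> (forall x, `|h x| <= C) ->
  `|r| <= A * (sqn x)^-1 ^+ m + c -> `|r * h x| <= dom M C A x.
Proof.
move=> A0 C0 h0 hC rA; have [c0 _ _ _ _] := gP; have S0 := sing_ge0 x.
rewrite normrM /dom /cube; case: asboolP => xM.
  rewrite !mulr1 mulrC; apply: ler_pM => //.
  by apply: le_trans rA _; rewrite lerD2r; apply: ler_wpM2l => //; exact: inv_pow_le.
have [j /negP] := (existsNP _).2 xM; rewrite -ltNge => /h0 ->.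
by rewrite normr0 !mulr0 !addr0 !mulr_ge0.
Qed.

Lemma intableRn_green h (M C : R) : 0 <= M -> 0 <= C -> measurable_fun setT (h \o row) ->
  (forall x j, M < `|x 0 j| -> h x = 0) -> (forall x, `|h x| <= C) ->
  intableRn (fun x => g (sqn x) * h x).
Proof.
move=> M0 C0 mh h0 hC; apply: (@intableRn_dom _ (dom M C 1)); last first.
- by move=> x; apply: dom_bound => //; rewrite mul1r green_bound.
- exact: intableRn_domf.
by apply: measurable_funM => //; exact: measurable_row_punctured green_cont.
Qed.

(** The regularised functions converge to the Green function off the pole, and
    the tents on the other side of their identity to a multiple of the Dirac
    mass. *)
Lemma green_weak phi : test_function phi ->
  intRn (fun x => g (sqn x) * wlap m phi x) = - (2 * m%:R * n%:R * ball_volume n) * phi 0.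
Proof.
move=> tphi; pose w := wlap m phi; have cw : Cc w by exact: Cc_wlap.
have [C wC] := Cc_bounded cw; have [cont_w [M [M0 w0]]] := cw.
have C0 : 0 <= C by rewrite (le_trans _ (wC 0)).
have [c0 _ _ _ _] := gP.
pose a k : R := k.+1%:R^-1.
have a01 k : 0 < a k <= 1 by rewrite invr_gt0 ltr0n/= invf_le1// ler1n.
have a_lt (d : R) : 0 < d -> \forall k \near \oo, a k < d.
  move=> d0; near=> k; near: k.
  exact: (near_infty_natSinv_lt (PosNum d0)).
pose A : R := 1 + m%:R * m.+2%:R.
have A0 : 0 <= A by rewrite addr_ge0// mulr_ge0.
pose f k x := green_reg m g (a k) (sqn x) * w x.
pose f_ x := g (sqn x) * w x.
have mw : measurable_fun setT (w \o row) by exact: measurable_row.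
have w00 x j : M < `|x 0 j| -> w x = 0 by exact: w0.
have mf k : measurable_fun setT (f k \o row).
  apply: measurable_row => x.
  have h1 : {for x, continuous (fun y : pt => green_reg m g (a k) (sqn y))}.
    exact: (green_reg_cont gP).
  exact: cvgM h1 (cont_w x).
have if_ : intableRn f_ by exact: intableRn_green M0 C0 mw w00 wC.
have if1 k : intableRn (f k).
  apply: Cc_integrable; apply: Cc_mul cw; exact: (green_reg_cont gP).
have n0 : (0 < n)%N by rewrite hn.
(* The pole is a null set: it is a box of side zero. *)
have null0 : lebn.-negligible [set t | row t = 0].
  apply: (@negligibleS _ _ _ _ (box [tuple of nseq n (0 : RT)] 0)).
    by move=> t /= t0 i; rewrite tnth_nseq subr0 -row_coord t0 mxE normr0.
  apply/negligibleP; first exact: measurable_box.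
  by rewrite [LHS](lebesgue_box _ (lexx 0)) mulr0 expr0n gtn_eqF.
have ae_ne0 (P : n.-tuple RT -> Prop) : (forall t : n.-tuple RT, row t != 0 -> P t) ->
    {ae lebn, forall t : n.-tuple RT, P t}.
  move=> HP; apply: negligibleS null0 => t /= nP.
  by apply/eqP; apply/negPn/negP => t0; apply: nP; exact: HP.
have lim2 : intRn (f k) @[k --> \oo] --> intRn f_.
  have [|||||_ _ lim1] := @dominated_convergence _ _ _ lebn setT measurableT
    (fun k => EFin \o (f k \o row)) (EFin \o (f_ \o row)) (EFin \o (dom M C A \o row)).
  - by move=> k; apply/measurable_EFinP.
  - exact: measurable_int if_.
  - apply: ae_ne0 => t t0 _; rewrite -sqn_gt0 in t0.
    apply: cvg_near_cst; near=> k; rewrite /= /f /f_ green_reg_ge//.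
    by apply: ltW; near: k; exact: a_lt.
  - exact: intableRn_domf.
  - apply: ae_ne0 => t t0 k _; rewrite lee_fin; apply: dom_bound => //.
    by apply: green_reg_bound; rewrite ?sqn_gt0.
  have e1 : [sequence (\int[lebn]_x (EFin \o (f k \o row)) x)%E]_k = EFin \o (fun k => intRn (f k)).
    apply/funext => k /=; rewrite -[LHS]fineK//.
    exact: (integrable_fin_num measurableT (if1 k)).
  have e2 : (\int[lebn]_x (EFin \o (f_ \o row)) x)%E = (intRn f_)%:E.
    by rewrite -[LHS]fineK//; exact: (integrable_fin_num measurableT if_).
  by move: lim1; rewrite e1 e2 => /fine_cvgP[].
have lim3 : intRn (f k) @[k --> \oo] --> - (2 * m%:R * n%:R * ball_volume n) * phi 0.
  have v0 : 0 <= ball_volume n :> R by exact: fine_ge0.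
  have lim4 : intRn (fun x => tent m (a k) (sqn x) * phi x) @[k --> \oo] -->
      ball_volume n * phi 0.
    apply/cvgrPdist_le => e e0.
    have e1 : 0 < e / (ball_volume n + 1) by rewrite divr_gt0// ltr_wpDl.
    have [d [d0 dP]] := tent_limit hn tphi e1.
    near=> k; rewrite distrC; apply: le_trans (dP (a k) _) _.
      by have /andP[-> _] := a01 k; near: k; exact: a_lt.
    rewrite mulrAC ler_pdivrMr; last by rewrite ltr_wpDl.
    by apply: ler_wpM2l; [exact: ltW|rewrite lerDl].
  rewrite (_ : (fun k => intRn (f k)) = fun k => - (2 * m%:R * n%:R) *
      intRn (fun x => tent m (a k) (sqn x) * phi x)); last first.
    by apply/funext => k; exact: (green_reg_identity hn gP (a01 _) tphi).
  rewrite (_ : _ * phi 0 = - (2 * m%:R * n%:R) * (ball_volume n * phi 0)); last ring.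
  exact: cvgM (cvg_cst _) lim4.
exact: cvg_unique lim2 lim3.
Unshelve. all: by end_near. Qed.

End green_equation_limit.

(** * Harmonic functions: weak form and minimum principle *)

Section second_derivative.
Context {R : realType}.

Lemma is_derive_line {V : normedModType R} (f : V -> R) (x v : V) (s d : R) :
  is_derive (s *: v + x) v f d -> is_derive s 1 (fun r => f (r *: v + x)) d.
Proof.
move=> /is_derive_lineP fd.
have ds : is_derive s 1 (fun r : R => r + - s) 1.
  by have := is_deriveDf (is_derive_idR s) (is_derive_cstR s (- s)); rewrite addr0.
rewrite -(subrr s) in fd; have := is_derive_comp_line ds fd; rewrite mulr1.
rewrite (_ : (fun _ => _) = fun r => f (r *: v + x))//.
by apply/funext => r; rewrite addrA -scalerDl subrK.
Qed.

Lemma min_second_derivative (f f' : R -> R) (r d : R) : 0 < r ->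
  (forall s : R, `|s| < r -> is_derive s 1 f (f' s)) -> is_derive (0 : R) 1 f' d ->
  (forall s : R, `|s| < r -> f 0 <= f s) -> f' 0 = 0 /\ 0 <= d.
Proof.
move=> r0 fd f'd fmin.
have in0 (s : R) : s \in `](- r), r[ -> `|s| < r by rewrite in_itv/= ltr_norml.
have f'0 : f' 0 = 0.
  have fdr (s : R) : s \in `](- r), r[ -> derivable f s 1 by move=> /in0 /fd [].
  have [|||_ D0] := @derive1_at_min R f (- r) r 0 _ fdr.
  - by rewrite ge0_cp// ltW.
  - by rewrite in_itv/= oppr_lt0 r0.
  - by move=> s /in0; exact: fmin.
  have z : `|0 : R| < r by rewrite normr0.
  by have [_ <-] := fd 0 z.
split=> //; rewrite leNgt; apply/negP => d0.
have e0 : 0 < - d / 2 by rewrite divr_gt0// oppr_gt0.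
have /is_derive_quotient /(_ _ e0) := f'd.
move=> /nbhs_ballP[e /= eg0 eP].
have f'neg (h : R) : 0 < h < e -> f' h < 0.
  move=> /andP[h0 he]; have := eP h; rewrite /ball /= sub0r normrN gtr0_norm//.
  move=> /(_ he); rewrite gt_eqF// => /(_ isT); rewrite addr0 f'0 subr0.
  rewrite ler_norml => /andP[+ _] => H.
  have : h^-1 * f' h <= d / 2 by lra.
  rewrite ler_pdivrMl// => /le_lt_trans; apply; rewrite pmulr_rlt0//; lra.
pose h := Num.min e r / 2.
have h0 : 0 < h by rewrite divr_gt0// lt_min eg0.
have hmin : h < Num.min e r by rewrite /h ltr_pdivrMr// ltr_pMr ?ltr1n// lt_min eg0.
have [he hr] : h < e /\ h < r by move: hmin; rewrite lt_min => /andP.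
have fdh (s : R) : 0 <= s <= h -> is_derive s 1 f (f' s).
  by move=> /andP[s0 sh]; apply: fd; rewrite ger0_norm// (le_lt_trans sh).
have [||s] := @MVT R f f' 0 h h0.
- by move=> s; rewrite in_itv/= => /andP[s0 sh]; apply: fdh; rewrite !ltW.
- apply: derivable_within_continuous => s; rewrite in_itv/= => sh.
  by have [] := fdh s sh.
rewrite in_itv/= subr0 => /andP[s0 sh] E.
have := fmin h; rewrite gtr0_norm// => /(_ hr); rewrite -subr_ge0 E.
by rewrite leNgt nmulr_rlt0 ?h0// f'neg// s0 (lt_trans sh).
Qed.

End second_derivative.

Section harmonic.
Context {R : realType}.
Variables (n m : nat).
Local Notation pt := 'rV[R]_n.
Local Notation punct := (~` [set (0 : pt)]).
Implicit Types (x y : pt) (f h phi V : pt -> R).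

Local Notation W := (fun i f y => conf (sqn y) ^+ m * partial i f y).

Lemma is_derive_weight i x : exists d : R,
  is_derive x (delta_mx 0 i) (fun y : pt => conf (sqn y) ^+ m) d.
Proof.
have s : smooth_on setT (fun y : pt => conf (sqn y) ^+ m).
  by apply: smooth_exp; [exact: openT|exact: smooth_conf].
by exists (partial i (fun y : pt => conf (sqn y) ^+ m) x); exact: smooth_derive s I.
Qed.

(** At a minimum the first derivatives vanish, so the derivative of the weight
    does not contribute. *)
Lemma wlap_min V y : smooth_on punct V -> y != 0 ->
  (\forall x \near y, V y <= V x) -> 0 <= wlap m V y.
Proof.
move=> sV y0 /nbhs_ballP[r1 /= r10 Vmin].
have [r2 /= r20 yne] : exists2 r2 : R, 0 < r2 & forall x, ball y r2 x -> x != 0.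
  have /nbhs_ballP[r2 /= r20 yne] : nbhs y punct.
    by apply: open_nbhs_nbhs; split; [exact: open_nonzero|exact/eqP].
  by exists r2 => // x /yne /eqP.
pose r := Num.min r1 r2; have r0 : 0 < r by rewrite lt_min r10.
apply: sumr_ge0 => i _.
have inb (s : R) : `|s| < r -> ball y r (s *: delta_mx 0 i + y).
  move=> sr; apply: rV_ballP => // j; rewrite !mxE opprD addrCA subrr addr0 normrN eqxx/=.
  by case: (j == i); rewrite ?mulr1// mulr0 normr0.
have bl r' x : r <= r' -> ball y r x -> ball y r' x by move=> rr; apply: le_ball.
have ne (s : R) : `|s| < r -> s *: delta_mx 0 i + y != 0.
  by move=> /inb /(bl r2) => H; apply: yne; apply: H; rewrite /r ge_min lexx orbT.
have sP := smooth_partial i sV.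
have dV (s : R) : `|s| < r -> is_derive s 1 (fun s => V (s *: delta_mx 0 i + y))
    (partial i V (s *: delta_mx 0 i + y)).
  by move=> /ne/eqP sne; apply: is_derive_line; exact: smooth_derive sV sne.
have y0' : punct y by exact/eqP.
have dP : is_derive (0 : R) 1 (fun s => partial i V (s *: delta_mx 0 i + y))
    (partial i (partial i V) y).
  by apply: is_derive_line; rewrite scale0r add0r; exact: smooth_derive sP y0'.
have [|P0 PP] := min_second_derivative r0 dV dP.
  move=> s /inb sb; rewrite scale0r add0r; apply: Vmin; apply: bl sb.
  by rewrite /r ge_min lexx.
rewrite scale0r add0r in P0.
have [d wd] := is_derive_weight i y.
rewrite (partialE (is_deriveMf wd (smooth_derive i sP y0'))) P0 mulr0 add0r.
by rewrite mulr_ge0// exprn_ge0// ltW// conf_gt0.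
Qed.

Lemma smooth_W i f : smooth_on punct f -> smooth_on punct (W i f).
Proof.
move=> sf; apply: smooth_mul; [exact: open_nonzero| |exact: smooth_partial].
apply: smooth_exp; first exact: open_nonzero.
exact: smooth_sub smooth_conf.
Qed.

Lemma wlap_scaleD f h (k : R) y : smooth_on punct f -> smooth_on punct h ->
  y != 0 -> wlap m (fun x => f x + k * h x) y = wlap m f y + k * wlap m h y.
Proof.
move=> sf sh y0; have py : punct y by exact/eqP.
rewrite /wlap mulr_sumr -big_split /=; apply: eq_bigr => i _.
transitivity (partial i (fun x => W i f x + k * W i h x) y).
  apply: near_eq_partial; apply: (open_near open_nonzero py) => x px.
  have := is_deriveDf (smooth_derive i sf px)
    (is_deriveMf (is_derive_cst (k : R) x (delta_mx 0 i)) (smooth_derive i sh px)).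
  by move=> /partialE ->; rewrite mul0r add0r /cst; ring.
have := is_deriveDf (smooth_derive i (smooth_W i sf) py)
    (is_deriveMf (is_derive_cst (k : R) y (delta_mx 0 i)) (smooth_derive i (smooth_W i sh) py)).
by move=> /partialE ->; rewrite mul0r add0r.
Qed.

Lemma wlap_cst (k : R) y : wlap m (fun=> k) y = 0.
Proof.
rewrite /wlap big1// => i _.
have -> : (fun y : pt => conf (sqn y) ^+ m * partial i (fun=> k) y) = fun=> 0.
  by apply/funext => x; rewrite (partialE (is_derive_cst _ _ _)) mulr0.
exact: partialE (is_derive_cst _ _ _).
Qed.

(** The square of a harmonic function is strictly subharmonic where the gradient
    does not vanish. *)
Lemma wlap_sqr f y : smooth_on punct f -> y != 0 -> wlap m f y = 0 ->
  wlap m (fun x => f x * f x) y = 2 * conf (sqn y) ^+ m * \sum_i partial i f y ^+ 2.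
Proof.
move=> sf y0 fy; have py : punct y by exact/eqP.
transitivity (\sum_i (2 * (partial i f y * W i f y) + 2 * f y * partial i (W i f) y)).
  apply: eq_bigr => i _.
  transitivity (partial i (fun x => 2 * (f x * W i f x)) y).
    apply: near_eq_partial; apply: (open_near open_nonzero py) => x px.
    have := is_deriveMf (smooth_derive i sf px) (smooth_derive i sf px).
    by move=> /partialE ->; ring.
  have := is_deriveMf (is_derive_cst (2 : R) y (delta_mx 0 i))
    (is_deriveMf (smooth_derive i sf py) (smooth_derive i (smooth_W i sf) py)).
  by move=> /partialE ->; rewrite mul0r add0r /cst; ring.
rewrite big_split /= -[X in _ + X]mulr_sumr -/(wlap m f y) fy mulr0 addr0.
by rewrite mulr_sumr; apply: eq_bigr => i _; ring.
Qed.

End harmonic.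

Section comparison.
Context {R : realType}.
Variables (n m : nat) (g : R -> R) (c : R).
Hypothesis hn : n = m.+1.*2.
Hypothesis m_gt0 : (0 < m)%N.
Hypothesis gP : green_profile m g c.
Local Notation pt := 'rV[R]_n.
Local Notation punct := (~` [set (0 : pt)]).
Local Notation G := (fun x : pt => g (sqn x)).
Implicit Types (x y : pt) (H phi : pt -> R).

Lemma partial_green i x : x != 0 -> partial i G x =
  - (m%:R * (sqn x)^-1 ^+ m.+1 * (conf (sqn x))^-1 ^+ m) * (2 * x 0 i).
Proof.
move=> x0; have [_ _ dg _ _] := gP; apply: partialE; apply: is_derive_radial.
by apply: dg; rewrite sqn_gt0.
Qed.

Lemma wlap_green y : y != 0 -> wlap m G y = 0.
Proof.
move=> y0; have py : punct y by exact/eqP.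
have s0 : sqn y != 0 by rewrite sqn_eq0.
pose th t : R := t^-1 ^+ m.+1.
have thd : is_derive (sqn y) 1 th (- m.+1%:R * (sqn y)^-1 ^+ m.+2).
  have := is_derive_expf m.+1 (is_derive_inv s0).
  by move/is_derive_subst; apply; rewrite /= !exprS; ring.
transitivity (\sum_i - (2 * m%:R) * (th (sqn y) + y 0 i ^+ 2 *
   (- m.+1%:R * (sqn y)^-1 ^+ m.+2 * 2))).
  apply: eq_bigr => i _.
  transitivity (partial i (fun x : pt => - (2 * m%:R) * (x 0 i * th (sqn x))) y).
    apply: near_eq_partial; apply: (open_near open_nonzero py) => x /eqP x0.
    rewrite partial_green// /th !exprVn; field.
    by rewrite !expf_neq0 ?conf_neq0 ?sqn_eq0.
  have := is_deriveMf (is_derive_cst (- (2 * m%:R) : R) y (delta_mx 0 i))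
    (is_deriveMf (is_derive_coord y i i) (is_derive_radial i thd)).
  by move=> /partialE ->; rewrite eqxx mul0r add0r mul1r /cst; ring.
rewrite -mulr_sumr big_split /= sumr_const card_ord -mulr_suml -/(sqn y).
rewrite -[th _ *+ n]mulr_natl (_ : n%:R = 2 * m.+1%:R :> R); last by rewrite hn -muln2 natrM mulrC.
rewrite /th !exprS; move: ((sqn y)^-1 ^+ m) => z.
by field.
Qed.

Lemma green_gt0 x : x != 0 -> 0 < g (sqn x).
Proof.
rewrite -sqn_gt0 => x0; have [_ _ _ gb _] := gP.
have /andP[g1 _] := gb _ (ltW x0); apply: lt_le_trans g1.
by rewrite exprn_gt0// invr_gt0.
Qed.

Lemma compact_annulus (a b : R) : 0 <= b ->
  compact [set x : pt | a <= sqn x <= b ^+ 2].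
Proof.
move=> b0; apply: bounded_closed_compact.
  exists b; split; first exact: num_real.
  move=> M bM x /= /andP[_ xb]; rewrite /Num.norm /= mx_normrE.
  apply/bigmax_leP; split=> [|[i j] _ /=]; first by rewrite (le_trans b0)// ltW.
  rewrite (ord1 i); apply: le_trans (ltW bM); exact: cube_sqn.
have -> : [set x : pt | a <= sqn x <= b ^+ 2] =
    ~` ([set x | sqn x < a] `|` [set x | b ^+ 2 < sqn x]).
  apply/seteqP; split=> x /=.
    by move=> /andP[ax xb] [|]; rewrite ltNge ?ax ?xb.
  by move=> /not_orP[/negP + /negP]; rewrite -!leNgt => -> ->.
by apply: open_closedC; apply: openU; [exact: open_sqn_lt|exact: open_sqn_gt].
Qed.

(** A positive harmonic function with at least the same singularity dominates
    the Green function: the difference, made strictly superharmonic by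
    subtracting a small multiple of [G ^ 2], has no interior minimum on an
    annulus, and is positive near the pole and at infinity. *)
Lemma green_le H : smooth_on punct H -> (forall x, x != 0 -> 0 < H x) ->
  (forall y, y != 0 -> wlap m H y = 0) ->
  (forall e, 0 < e -> exists2 d : R, 0 < d &
     forall x, 0 < sqn x < d -> g (sqn x) <= (1 + e) * H x) ->
  forall x, x != 0 -> g (sqn x) <= H x.
Proof.
move=> sH H0 hH Hnear x1 x10; have sG := smooth_green gP (n := n).
apply/ler_addgt0Pr => e e0.
pose ep := e / (H x1 + 1).
have Hx1 := H0 _ x10.
have ep0 : 0 < ep by rewrite divr_gt0// ltr_wpDr// ltW.
suff : 0 <= (1 + ep) * H x1 - g (sqn x1) + ep.
  have : ep * (H x1 + 1) = e by rewrite /ep divfK// gt_eqF// ltr_wpDr// ltW.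
  lra.
pose V0 x := (1 + ep) * H x - g (sqn x) + ep.
rewrite -/(V0 x1) leNgt; apply/negP => V1.
have [d d0 dP] := Hnear _ ep0.
have V0near x : 0 < sqn x < d -> 0 < V0 x.
  by move=> /dP; rewrite /V0; lra.
have [_ _ _ gb glim] := gP; have [T TP] := glim _ ep0.
have V0far x : x != 0 -> T <= sqn x -> 0 < V0 x.
  move=> /H0 Hx /TP gx; rewrite /V0.
  have : 0 < (1 + ep) * H x by rewrite mulr_gt0// addr_gt0.
  lra.
pose s1 := sqn x1; have s10 : 0 < s1 by rewrite sqn_gt0.
pose a := Num.min (d / 2) s1.
have a0 : 0 < a by rewrite lt_min divr_gt0.
pose b := 1 + `|T| + s1.
have b1 : 1 <= b by rewrite /b -addrA lerDl addr_ge0// ltW.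
have bT : T < b ^+ 2.
  have : b <= b ^+ 2 by rewrite expr2 ler_peMl// (le_trans ler01).
  apply: lt_le_trans; rewrite /b; have := ler_norm T; lra.
have bs : s1 <= b ^+ 2.
  have : b <= b ^+ 2 by rewrite expr2 ler_peMl// (le_trans ler01).
  by apply: le_trans; rewrite /b lerDr addr_ge0.
pose A := [set x : pt | a <= sqn x <= b ^+ 2].
have A1 : A x1 by rewrite /A /= bs andbT /a ge_min lexx orbT.
have Ane x : A x -> x != 0.
  by move=> /andP[ax _]; rewrite -sqn_gt0 (lt_le_trans a0).
pose B := a^-1 ^+ m + c.
have GB x : A x -> 0 <= g (sqn x) <= B.
  move=> Ax; have := Ane _ Ax; move=> /green_gt0/ltW -> /=.
  have /andP[_ g2] := gb _ (sqn_ge0 x); apply: le_trans g2 _.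
  rewrite lerD2r; apply: lerXn2r; rewrite ?nnegrE ?invr_ge0 ?sqn_ge0 ?(ltW a0)//.
  rewrite lef_pV2 ?posrE ?sqn_gt0//; last exact: Ane.
  by case/andP: Ax.
have B0 : 0 <= B by have /andP[g0 gB] := GB _ A1; exact: le_trans gB.
pose w := - V0 x1; have w0 : 0 < w by rewrite oppr_gt0.
pose et := w / (2 * (B ^+ 2 + 1)).
have et0 : 0 < et by rewrite divr_gt0// mulr_gt0// ltr_wpDl// sqr_ge0.
have etB : et * B ^+ 2 < w.
  have q0 : 0 <= B ^+ 2 by exact: sqr_ge0.
  rewrite /et mulrAC ltr_pdivrMr; first nra.
  by rewrite mulr_gt0// ltr_wpDl.
pose Gs x := g (sqn x) * g (sqn x).
pose V x := V0 x + - et * Gs x.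
have oP := @open_nonzero R n.
have sV0 : smooth_on punct V0 := smooth_add oP (smooth_add oP
  (smooth_mul oP (smooth_cst (1 + ep) oP) sH) (smooth_opp oP sG)) (smooth_cst ep oP).
have sGs : smooth_on punct Gs := smooth_mul oP sG sG.
have sV : smooth_on punct V := smooth_add oP sV0 (smooth_mul oP (smooth_cst (- et) oP) sGs).
have [y yA ymin] : exists2 y, y \in A & forall x, x \in A -> V y <= V x.
  apply: EVT_min_rV; first by exists x1.
    by apply: compact_annulus; exact: le_trans b1.
  apply: continuous_in_subspaceT => x; rewrite inE => /Ane/eqP xp.
  exact: smooth_cont sV xp.
rewrite inE in yA; have y0 := Ane _ yA; have py : punct y by exact/eqP.
have Vy : V y <= V0 x1.
  apply: le_trans (ymin x1 _) _; first by rewrite inE.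
  by rewrite /V mulNr gerDl oppr_le0 mulr_ge0 ?(ltW et0)// mulr_ge0 ?(ltW (green_gt0 x10)).
(* [et] is so small that the perturbation cannot move the minimum to where the
   unperturbed function is positive. *)
have V0y : V0 y <= 0.
  rewrite leNgt; apply/negP => V0y.
  have : et * Gs y <= et * B ^+ 2.
    have /andP[g1 g2] := GB _ yA; apply: ler_wpM2l; first exact: ltW.
    by rewrite /Gs expr2; apply: ler_pM.
  by move: Vy; rewrite /V mulNr; move: etB; rewrite /w; lra.
have y_d : d <= sqn y.
  rewrite leNgt; apply/negP => yd; move: V0y; rewrite leNgt V0near//.
  by rewrite yd sqn_gt0 y0.
have y_T : sqn y < T.
  by rewrite ltNge; apply/negP => yT; move: V0y; rewrite leNgt V0far.
have Vloc : \forall x \near y, V y <= V x.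
  have oA : open ([set x : pt | a < sqn x] `&` [set x | sqn x < b ^+ 2]).
    by apply: openI; [exact: open_sqn_gt|exact: open_sqn_lt].
  apply: (open_near oA) => [|x [/= ax xb]]; last first.
    by apply: ymin; rewrite inE /A /= !ltW.
  split; last exact: lt_trans bT.
  rewrite /=; apply: lt_le_trans y_d.
  by rewrite /a gt_min ltr_pdivrMr// ltr_pMr// ltr1n.
have := wlap_min m sV y0 Vloc.
have -> : wlap m V y = - et * (2 * conf (sqn y) ^+ m * \sum_i partial i G y ^+ 2).
  rewrite (wlap_scaleD m (- et) sV0 sGs y0) (wlap_sqr sG y0 (wlap_green y0)).
  have -> : V0 = (fun x => (ep + - 1 * g (sqn x)) + (1 + ep) * H x).
    by apply/funext => x; rewrite /V0; ring.
  have s2 := smooth_add oP (smooth_cst ep oP) (smooth_mul oP (smooth_cst (- 1) oP) sG).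
  rewrite (wlap_scaleD m (1 + ep) s2 sH y0) (hH y y0) mulr0 addr0.
  rewrite (wlap_scaleD m (- 1) (smooth_cst ep oP) sG y0) wlap_cst (wlap_green y0).
  by rewrite mulr0 addr0 add0r.
rewrite leNgt mulNr oppr_lt0 mulr_gt0// mulr_gt0//.
  by rewrite mulr_gt0// exprn_gt0// conf_gt0.
rewrite lt_neqAle eq_sym; apply/andP; split; last by apply: sumr_ge0 => i _; exact: sqr_ge0.
rewrite psumr_neq0; last by move=> i _; exact: sqr_ge0.
have [i yi] : exists i, y 0 i != 0.
  apply: contrapT => ny; move/negP: y0; apply; apply/eqP/rowP => i.
  by rewrite mxE; apply/eqP; apply: contrapT => /negP yi; apply: ny; exists i.
apply/hasP; exists i; first exact: mem_index_enum.
rewrite lt_neqAle sqr_ge0 andbT eq_sym sqrf_eq0 partial_green//=.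
rewrite !mulf_eq0 oppr_eq0 !mulf_eq0 !expf_eq0 !invr_eq0 (negPf yi) sqn_eq0 (negPf y0).
by rewrite (negPf (conf_neq0 _)) !andbF !pnatr_eq0 eqn0Ngt m_gt0.
Qed.

End comparison.

Section weak_harmonic.
Context {R : realType}.
Variables (n m : nat).
Local Notation RT := (measurableTypeR R).
Local Notation pt := 'rV[R]_n.
Local Notation row := (@row_of_tuple R n).
Local Notation punct := (~` [set (0 : pt)]).
Local Notation W := (fun i f y => conf (sqn y) ^+ m * partial i f y).
Implicit Types (x y : pt) (H phi : pt -> R).

Lemma smooth_wlap H : smooth_on punct H -> smooth_on punct (wlap m H).
Proof.
move=> sH; apply: smooth_sum; first exact: open_nonzero.
move=> i; apply: smooth_partial; exact: smooth_W.
Qed.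

Section second_identity.
Variables (H phi : pt -> R) (rho : R).
Hypotheses (sH : smooth_on punct H) (tphi : test_function phi) (rho0 : 0 < rho).
Hypothesis phi_near : forall x, sqn x < rho -> phi x = 0.

Let sphi : smooth_on setT phi. Proof. by case: tphi. Qed.

Let near0 x (f : pt -> R) : sqn x < rho -> (forall y, sqn y < rho -> f y = 0) ->
  \forall y \near x, f y = (fun=> 0) y.
Proof. by move=> xr; apply: open_near; [exact: open_sqn_lt|]. Qed.

Let partial_near (f : pt -> R) i : (forall y, sqn y < rho -> f y = 0) ->
  forall x, sqn x < rho -> partial i f x = 0.
Proof.
move=> f0 x xr; rewrite (near_eq_partial i (near0 xr f0)).
exact: partialE (is_derive_cst _ _ _).
Qed.

Let W_near i x : sqn x < rho -> W i phi x = 0.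
Proof. by move=> xr /=; rewrite (partial_near i phi_near xr) mulr0. Qed.

Let dW_near i x : sqn x < rho -> partial i (W i phi) x = 0.
Proof. by apply: partial_near => y; exact: W_near. Qed.

Let wlap_near x : sqn x < rho -> wlap m phi x = 0.
Proof. by move=> xr; rewrite /wlap big1// => i _; exact: dW_near. Qed.

Let origin x : ~ punct x -> sqn x < rho.
Proof. by move=> /contrapT ->; rewrite sqn0. Qed.

Let cont_near (f : pt -> R) : (forall x, punct x -> {for x, continuous f}) ->
  (forall x, sqn x < rho -> f x = 0) -> continuous f.
Proof.
move=> cf f0 x; have [px|/origin xr] := pselect (punct x); first exact: cf.
apply: (@near_eq_cont _ _ (fun=> 0)); last exact: cst_continuous.
by apply: filterS (near0 xr f0) => y /esym.
Qed.

Let Cc_near (f : pt -> R) : continuous f -> (forall x, phi x = 0 -> f x = 0) -> Cc f.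
Proof.
move=> cf f0; split=> //; have [M [M0 phi0]] := test_support tphi.
by exists M; split=> // x j xM; apply: f0; exact: phi0 xM.
Qed.

Lemma Cc_H_wlap : Cc (fun x => H x * wlap m phi x).
Proof.
have [cw [M [M0 w0]]] := Cc_wlap m tphi; split.
  apply: cont_near => x; last by move=> xr; rewrite wlap_near// mulr0.
  by move=> px; exact: cvgM (smooth_cont sH px) (cw x).
by exists M; split=> // x j xM; rewrite (w0 x j xM) mulr0.
Qed.

Lemma Cc_phi_wlap : Cc (fun x => phi x * wlap m H x).
Proof.
apply: Cc_near => [|x ->]; last by rewrite mul0r.
apply: cont_near => x; last by move=> xr; rewrite phi_near// mul0r.
move=> px; apply: (cvgM (smooth_cont sphi I : {for x, continuous phi})).
exact: smooth_cont (smooth_wlap sH) px.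
Qed.

(** Green's second identity; the function may be singular at the pole because
    the test function vanishes around it. *)
Lemma second_identity :
  intRn (fun x => H x * wlap m phi x) = intRn (fun x => phi x * wlap m H x).
Proof.
have [M [M0 phi0]] := test_support tphi.
pose F i x := H x * W i phi x - phi x * W i H x.
pose dF i x := H x * partial i (W i phi) x - phi x * partial i (W i H) x.
have swphi i : smooth_on setT (W i phi) by exact: smooth_weighted.
have dF0 i x : sqn x < rho -> dF i x = 0.
  by move=> xr; rewrite /dF dW_near// phi_near// mulr0 mul0r subrr.
have Z : intRn (fun x => \sum_i dF i x) = 0.
  apply: (@divergence_theorem _ _ F dF M) => //.
  - move=> i x j xM; rewrite /F (phi0 x j xM) (partial_supp i sphi phi0 xM).
    by rewrite !mulr0 mul0r subrr.
  - move=> i x; have [px|/origin xr] := pselect (punct x); last first.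
      rewrite dF0//; apply: near_eq_is_derive (is_derive_cst (0 : R) x _).
      apply: filterS (near0 xr (_ : forall y, sqn y < rho -> F i y = 0)); first by move=> y /esym.
      by move=> y yr; rewrite /F W_near// phi_near// mulr0 mul0r subrr.
    have d1 := is_deriveMf (smooth_derive i sH px) (smooth_derive i (swphi i) (I : setT x)).
    have d2 := is_deriveMf (smooth_derive i sphi (I : setT x))
      (smooth_derive i (smooth_W m i sH) px).
    have d3 := is_deriveMf (is_derive_cst (-1 : R) x (delta_mx 0 i)) d2.
    have := is_deriveDf d1 d3.
    rewrite (_ : (fun y => _ + cst (-1) y * _) = F i); last first.
      by apply/funext => y; rewrite /F /cst mulN1r.
    move/is_derive_subst; apply; rewrite /dF /cst.
    move: (partial i (W i phi) x) (partial i (W i H) x) => P Q /=.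
    by move: (partial i H x) (partial i phi x) => p q; ring.
  - move=> i; apply: cont_near => [x px|]; last exact: dF0.
    have c1 : {for x, continuous H} by exact: smooth_cont sH px.
    have c2 : {for x, continuous (partial i (W i phi))}.
      exact: (smooth_cont (smooth_partial i (swphi i)) I).
    have c3 : {for x, continuous phi} by exact: smooth_cont sphi I.
    have c4 : {for x, continuous (partial i (W i H))}.
      exact: (smooth_cont (smooth_partial i (smooth_W m i sH)) px).
    exact: cvgB (cvgM c1 c2) (cvgM c3 c4).
apply/eqP; rewrite -subr_eq0 -intRn_sub; last 2 first.
- exact/Cc_integrable/Cc_H_wlap.
- exact/Cc_integrable/Cc_phi_wlap.
rewrite -Z; apply/eqP; congr intRn; apply/funext => x.
rewrite /wlap (mulr_sumr _ _ _ (H x)) (mulr_sumr _ _ _ (phi x)) -sumrB; exact: erefl.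
Qed.

End second_identity.

Definition blob (y : pt) (r : R) x : R := expinv 0 (r ^+ 2 - sqn (x - y)).

Lemma blob_far y r x : r ^+ 2 <= sqn (x - y) -> blob y r x = 0.
Proof. by move=> rx; rewrite /blob expinv_le0// subr_le0. Qed.

Lemma blob_supp y r x i : 0 < r -> blob y r x != 0 -> `|x 0 i - y 0 i| < r.
Proof.
move=> r0; apply: contraNT; rewrite -leNgt => rx; apply/eqP/blob_far.
apply: le_trans (coord_sqn _ i); rewrite !mxE -[leRHS]real_normK ?num_real//.
by apply: lerXn2r => //; rewrite nnegrE ltW.
Qed.

Lemma test_blob y r : 0 < r -> test_function (blob y r).
Proof.
move=> r0; have oT := @openT pt; split.
  apply: smooth_expinv => //; apply: smooth_add => //; first exact: smooth_cst.
  apply: smooth_opp => //; apply: smooth_sum => // i; apply: smooth_exp => //.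
  apply: (@smooth_eq _ _ _ (fun x : pt => x 0 i + - y 0 i)) => //.
    by move=> x _; rewrite !mxE.
  by apply: smooth_add => //; [exact: smooth_coord|exact: smooth_cst].
pose M := r + \sum_i `|y 0 i|.
apply: (@subclosed_compact _ _ [set x : pt | forall i, `|x 0 i| <= M]).
- exact: closed_closure.
- exact: compact_cube.
- have cl : closed [set x : pt | forall i, `|x 0 i| <= M].
    by apply: compact_closed; [exact: norm_hausdorff|exact: compact_cube].
  rewrite [X in _ `<=` X]((closure_id _).1 cl).
  apply: closureS => x /= bx i; have xy := blob_supp i r0 bx.
  rewrite -[x 0 i](subrK (y 0 i)) (le_trans (ler_normD _ _))// lerD ?(ltW xy)//.
  by rewrite (bigD1 i)//= lerDl sumr_ge0.
Qed.

Lemma blob_ge0 y r x : 0 <= blob y r x. Proof. exact: expinv_ge0. Qed.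

Lemma intRn_blob_gt0 y r : 0 < r -> 0 < intRn (blob y r).
Proof.
move=> r0; pose r' := r / (2 * n.+1%:R).
have r'0 : 0 < r' by rewrite divr_gt0// mulr_gt0.
pose b := [tuple (y 0 i : RT) | i < n].
pose K := expR (- (2 / r ^+ 2)).
pose chi x : R := if `[< forall j, `|x 0 j - y 0 j| <= r' >] then 1 else 0.
have chiE : chi \o row = \1_(box b r').
  apply/funext => t; rewrite indicE /chi /=; case: asboolP => tM.
    by rewrite mem_set// => i; rewrite tnth_mktuple -row_coord.
  rewrite memNset// => tB; apply: tM => i.
  by have := tB i; rewrite tnth_mktuple row_coord.
have ichi : intableRn chi.
  apply: (@integrable_box _ _ b r' _ 1).
  - by rewrite chiE; apply: measurable_indic; exact: measurable_box.
  - by move=> t; rewrite /= /chi; case: ifP; rewrite ?normr1 ?normr0.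
  - move=> t tB; rewrite /= /chi asboolF// => tb; apply: tB => i.
    by rewrite tnth_mktuple -row_coord.
have ib : intableRn (blob y r) by apply: Cc_integrable; exact/Cc_test/test_blob.
have : K * intRn chi <= intRn (blob y r).
  rewrite -intRn_scale//; apply: intRn_le => //; first exact: intableRn_scale.
  move=> x; rewrite /chi; case: asboolP => xy; last by rewrite mulr0 blob_ge0.
  have xyr : sqn (x - y) <= r ^+ 2 / 2.
    apply: le_trans (@sqn_le_cube _ _ _ r' _) _; first by move=> i; rewrite !mxE.
    rewrite /r' expr_div_n mulrCA; apply: ler_wpM2l; first exact: sqr_ge0.
    have n0 : 0 <= n%:R :> R by [].
    rewrite -[n.+1%:R]natr1; move: (n%:R : R) n0 => N N0.
    have D0 : 0 < (2 * (N + 1)) ^+ 2 by rewrite exprn_gt0// mulr_gt0// ltr_wpDl.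
    rewrite ler_pdivrMr//.
    have -> : 2^-1 * (2 * (N + 1)) ^+ 2 = 2 * N ^+ 2 + 4 * N + 2 by field.
    by have := sqr_ge0 N; lra.
  have r20 : 0 < r ^+ 2 by rewrite exprn_gt0.
  rewrite mulr1 /blob /expinv ifT; last by lra.
  rewrite expr0 mul1r /K ler_expR lerN2 -invf_div lef_pV2 ?posrE; lra.
apply: lt_le_trans; apply: mulr_gt0; first exact: expR_gt0.
rewrite /intRn (_ : (fun t => chi (row t)) = \1_(box b r')); last exact: chiE.
rewrite /Rintegral integral_indic//; last exact: measurable_box.
by rewrite setIT [X in fine X](lebesgue_box b (ltW r'0)) /= exprn_gt0// mulr_gt0.
Qed.

(** The fundamental lemma of the calculus of variations, applied to the
    Laplacian of a function that is harmonic in the sense of distributions. *)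
Lemma weak_harmonic H : smooth_on punct H ->
  (forall phi, test_function phi -> phi 0 = 0 ->
     intRn (fun x => H x * wlap m phi x) = 0) ->
  forall y, y != 0 -> wlap m H y = 0.
Proof.
move=> sH weak y y0; apply/eqP/negPn/negP => q0.
have py : punct y by exact/eqP.
have s0 : 0 < sqn y by rewrite sqn_gt0.
have cq : {for y, continuous (wlap m H)}.
  exact: smooth_cont (smooth_wlap sH) py.
pose k x := wlap m H y * wlap m H x.
have ck : {for y, continuous k} by exact: cvgM (cvg_cst _) cq.
have ky : 0 < k y by rewrite /k -expr2 exprn_even_gt0.
have k2 : k y / 2 < k y by rewrite ltr_pdivrMr// ltr_pMr// ltr1n.
have s2 : sqn y / 2 < sqn y by rewrite ltr_pdivrMr// ltr_pMr// ltr1n.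
have : \forall x \near y, k y / 2 < k x /\ sqn y / 2 < sqn x.
  near=> x; split; near: x; first exact: (cvgr_gt _ ck).
  by apply: (cvgr_gt (sqn y)) => //; exact: sqn_cont.
move=> /nbhs_ballP[r /= r0 rP].
have supp x : blob y r x != 0 -> k y / 2 < k x /\ sqn y / 2 < sqn x.
  move=> bx; apply: rP; apply: rV_ballP => // j; rewrite distrC.
  exact: blob_supp.
have tb := test_blob y r0.
have near0 x : sqn x < sqn y / 2 -> blob y r x = 0.
  move=> xs; apply/eqP/negPn/negP => /supp[_]; rewrite ltNge; apply/negP/negPn.
  exact: ltW.
have rho0 : 0 < sqn y / 2 by rewrite divr_gt0.
have : intRn (fun x => blob y r x * wlap m H x) = 0.
  rewrite -(second_identity sH tb rho0 near0) weak// near0// sqn0//.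
have ib := Cc_integrable (Cc_phi_wlap sH tb rho0 near0).
have ib0 : intableRn (blob y r) by apply: Cc_integrable; exact/Cc_test.
move=> /(congr1 ( *%R (wlap m H y))); rewrite mulr0 -intRn_scale// => Z.
have : k y / 2 * intRn (blob y r) <= 0.
  rewrite -Z -intRn_scale//; apply: intRn_le; [exact: intableRn_scale|exact: intableRn_scale|].
  move=> x; have [->|/supp[kx _]] := eqVneq (blob y r x) 0.
    by rewrite mul0r !mulr0.
  rewrite mulrCA -/(k x) mulrC; apply: ler_wpM2l; first exact: blob_ge0.
  exact: ltW.
by rewrite leNgt mulr_gt0// ?divr_gt0// intRn_blob_gt0.
Unshelve. all: by end_near. Qed.

End weak_harmonic.

(** * The metric and its curvature *)

Section curvature.
Context {R : realType} {n : nat}.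
Local Notation pt := 'rV[R]_n.
Implicit Types (x u v w : pt) (i j k l : 'I_n).

Definition metric x : 'M[R]_n := (conf (sqn x))%:M.

Definition dot u v : R := \sum_i u 0 i * v 0 i.

Lemma dotC u v : dot u v = dot v u.
Proof. by apply: eq_bigr => i _; rewrite mulrC. Qed.

Lemma dot_sqn x : dot x x = sqn x.
Proof. by apply: eq_bigr => i _; rewrite expr2. Qed.

Lemma dot_lin a b u v w : dot (a *: u + b *: v) w = a * dot u w + b * dot v w.
Proof.
rewrite /dot !mulr_sumr -big_split /=; apply: eq_bigr => i _; rewrite !mxE; ring.
Qed.

Lemma dot_linr a b u v w : dot w (a *: u + b *: v) = a * dot w u + b * dot w v.
Proof. by rewrite dotC dot_lin ![dot _ w]dotC. Qed.

Lemma gram_expand a b u v : sqn (a *: u + b *: v) =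
  a ^+ 2 * sqn u + 2 * a * b * dot u v + b ^+ 2 * sqn v.
Proof. by rewrite -!dot_sqn dot_lin !dot_linr [dot v u]dotC; ring. Qed.

Lemma gram2_ge0 u v : 0 <= sqn u * sqn v - dot u v ^+ 2.
Proof.
have [->|u0] := eqVneq u 0.
  rewrite sqn0 mul0r sub0r (_ : dot _ _ = 0) ?expr0n ?oppr0//.
  by rewrite /dot big1// => i _; rewrite mxE mul0r.
have su : 0 < sqn u by rewrite sqn_gt0.
have := sqn_ge0 (- dot u v *: u + sqn u *: v); rewrite gram_expand => H.
rewrite -(@pmulr_rge0 _ (sqn u))//; apply: le_trans H _.
by rewrite le_eqVlt; apply/orP; left; apply/eqP; ring.
Qed.

Definition gramq x u v : R := sqn u * dot x v ^+ 2 + sqn v * dot x u ^+ 2 -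
  2 * dot u v * dot x u * dot x v.

Lemma gramq_ge0 x u v : 0 <= gramq x u v.
Proof.
have := sqn_ge0 (dot x v *: u + - dot x u *: v); rewrite gram_expand => H.
by apply: le_trans H _; rewrite le_eqVlt; apply/orP; left; apply/eqP; rewrite /gramq; ring.
Qed.

(** The Gram determinant of three vectors is nonnegative: apply the
    two-vector inequality to the components orthogonal to [u]. *)
Lemma gramq_le x u v : gramq x u v <= sqn x * (sqn u * sqn v - dot u v ^+ 2).
Proof.
have [->|u0] := eqVneq u 0.
  have d0 w : dot w 0 = 0 by rewrite /dot big1// => i _; rewrite mxE mulr0.
  by rewrite /gramq [dot 0 v]dotC !d0 sqn0 expr0n !(mulr0, mul0r, subr0, addr0).
have su : 0 < sqn u by rewrite sqn_gt0.
have := gram2_ge0 (sqn u *: x + - dot x u *: u) (sqn u *: v + - dot u v *: u).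
rewrite !gram_expand dot_lin !dot_linr dot_sqn [dot v u]dotC => H.
rewrite -(@ler_pM2l _ (sqn u ^+ 3)) ?exprn_gt0// -subr_ge0.
apply: le_trans H _; rewrite le_eqVlt; apply/orP; left; apply/eqP.
by rewrite /gramq !exprS expr0; ring.
Qed.

Lemma sum_delta (f : 'I_n -> R) l : \sum_i (i == l)%:R * f i = f l.
Proof.
rewrite (bigD1 l)//= eqxx mul1r big1 ?addr0// => i il.
by rewrite (negPf il) mul0r.
Qed.

Lemma sum_deltaV (f : 'I_n -> R) l : \sum_i (l == i)%:R * f i = f l.
Proof. by rewrite -[RHS]sum_delta; apply: eq_bigr => i _; rewrite eq_sym. Qed.

(** Gradient and Hessian of the exponent [phi x = lconf (sqn x)]. *)
Definition dphi x i : R := 2 * lconf1 (sqn x) * x 0 i.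
Definition hphi x i j : R :=
  2 * lconf1 (sqn x) * (i == j)%:R + 4 * lconf2 (sqn x) * x 0 i * x 0 j.

Lemma is_derive_dphi x i j :
  is_derive x (delta_mx 0 i) (fun y => dphi y j) (hphi x i j).
Proof.
have := is_deriveMf (is_derive_radial i (is_derive_zmul 2 (is_derive_lconf1 (sqn x))))
  (is_derive_coord x i j).
move/is_derive_subst; apply; rewrite /hphi eq_sym; ring.
Qed.

Lemma metricE x i j : metric x i j = (i == j)%:R * conf (sqn x).
Proof. by rewrite mxE; case: eqP => _; rewrite ?mulr1n ?mulr0n ?mul1r ?mul0r. Qed.

Lemma partial_metric x i j l : partial i (fun y => metric y j l) x =
  (j == l)%:R * (2 * conf (sqn x) * dphi x i).
Proof.
apply: partialE; under eq_fun do rewrite metricE.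
have := is_deriveMf (is_derive_cst ((j == l)%:R : R) x (delta_mx 0 i))
   (is_derive_radial i (is_derive_conf (sqn x))).
by move/is_derive_subst; apply; rewrite /dphi /cst; ring.
Qed.

Lemma invmx_metric x : invmx (metric x) = ((conf (sqn x))^-1)%:M.
Proof. exact: invmx_scalar. Qed.

Lemma invmx_metricE x k l : invmx (metric x) k l = (k == l)%:R * (conf (sqn x))^-1.
Proof.
by rewrite invmx_metric mxE; case: eqP => _; rewrite ?mulr1n ?mulr0n ?mul1r ?mul0r.
Qed.

Lemma christoffelE x k i j : christoffel metric x k i j =
  (j == k)%:R * dphi x i + (i == k)%:R * dphi x j - (i == j)%:R * dphi x k.
Proof.
set e := conf (sqn x); have e0 : e != 0 by exact: conf_neq0.
rewrite /christoffel (eq_bigr (fun l => (k == l)%:R * (e^-1 *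
  ((j == l)%:R * (2 * e * dphi x i) + (i == l)%:R * (2 * e * dphi x j)
   - (i == j)%:R * (2 * e * dphi x l))))); last first.
  by move=> l _; rewrite !partial_metric invmx_metricE -/e; ring.
by rewrite sum_deltaV; field.
Qed.

Lemma partial_christoffel x i l j k :
  partial i (fun y => christoffel metric y l j k) x =
  (k == l)%:R * hphi x i j + (j == l)%:R * hphi x i k - (j == k)%:R * hphi x i l.
Proof.
apply: partialE; under eq_fun do rewrite christoffelE.
have d (c : R) a := is_deriveMf (is_derive_cst c x (delta_mx 0 i)) (is_derive_dphi x i a).
have := is_deriveDf (is_deriveDf (d (k == l)%:R j) (d (j == l)%:R k)) (d (- (j == k)%:R) l).
rewrite (_ : (fun y => _ + _ + _) = fun y : pt =>
  (k == l)%:R * dphi y j + (j == l)%:R * dphi y k - (j == k)%:R * dphi y l).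
  by move/is_derive_subst; apply; rewrite /cst; ring.
by apply/funext => y; rewrite /cst mulNr.
Qed.

Definition schouten_a x : R := 2 * lconf1 (sqn x) * (1 + sqn x * lconf1 (sqn x)).
Definition schouten_b x : R := 4 * (lconf2 (sqn x) - lconf1 (sqn x) ^+ 2).

(** The curvature of a conformally flat metric is, up to sign and a conformal
    factor, the Kulkarni-Nomizu product of the flat metric and a tensor of the
    form [schouten_a delta_ij + schouten_b x_i x_j]. *)
Lemma riemann_coefE x l i j k : riemann_coef metric x l i j k =
  (i == k)%:R * (2 * schouten_a x * (j == l)%:R + schouten_b x * x 0 j * x 0 l)
  - (j == k)%:R * (2 * schouten_a x * (i == l)%:R + schouten_b x * x 0 i * x 0 l)
  + x 0 k * (schouten_b x * ((j == l)%:R * x 0 i - (i == l)%:R * x 0 j)).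
Proof.
have S a b : \sum_m christoffel metric x l a m * christoffel metric x m b k =
   dphi x a * christoffel metric x l b k +
   (a == l)%:R * (2 * dphi x b * dphi x k - (b == k)%:R * (4 * lconf1 (sqn x) ^+ 2 * sqn x)) -
   dphi x l * christoffel metric x a b k.
  have -> : dphi x a * christoffel metric x l b k =
      \sum_m (m == l)%:R * (dphi x a * christoffel metric x m b k).
    by rewrite sum_delta.
  have -> : dphi x l * christoffel metric x a b k =
      \sum_m (a == m)%:R * (dphi x l * christoffel metric x m b k).
    by rewrite sum_deltaV.
  have -> : 2 * dphi x b * dphi x k - (b == k)%:R * (4 * lconf1 (sqn x) ^+ 2 * sqn x) =
      \sum_m dphi x m * christoffel metric x m b k.
    under eq_bigr => m _ do rewrite christoffelE mulrBr mulrDr.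
    rewrite sumrB big_split /=.
    under eq_bigr => m _ do rewrite mulrCA.
    rewrite sum_deltaV.
    under [X in _ + X - _]eq_bigr => m _ do rewrite mulrCA.
    rewrite sum_deltaV; congr (_ - _); first ring.
    rewrite -dot_sqn /dot !mulr_sumr; apply: eq_bigr => m _; rewrite /dphi; ring.
  rewrite mulr_sumr -big_split -sumrB; apply: eq_bigr => m _ /=.
  rewrite [christoffel metric x l a m]christoffelE; ring.
rewrite /riemann_coef sumrB !S !partial_christoffel !christoffelE.
rewrite /hphi /dphi /schouten_a /schouten_b.
rewrite [k == j]eq_sym [k == i]eq_sym [j == i]eq_sym.
ring.
Qed.

Lemma riemannE x u v w l : riemann metric x u v w 0 l =
  dot u w * (2 * schouten_a x * v 0 l + schouten_b x * dot x v * x 0 l)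
  - dot v w * (2 * schouten_a x * u 0 l + schouten_b x * dot x u * x 0 l)
  + dot x w * (schouten_b x * (dot x u * v 0 l - dot x v * u 0 l)).
Proof.
rewrite mxE; set a := schouten_a x; set b := schouten_b x.
transitivity (\sum_i \sum_j (
    (u 0 i * w 0 i) * ((2 * a * (j == l)%:R + b * x 0 j * x 0 l) * v 0 j)
  - ((2 * a * (i == l)%:R + b * x 0 i * x 0 l) * u 0 i) * (v 0 j * w 0 j)
  + dot x w * b * ((x 0 i * u 0 i) * ((j == l)%:R * v 0 j)
     - ((i == l)%:R * u 0 i) * (x 0 j * v 0 j)))).
  apply: eq_bigr => i _; apply: eq_bigr => j _.
  transitivity (\sum_k ((i == k)%:R * ((2 * a * (j == l)%:R + b * x 0 j * x 0 l) * u 0 i * v 0 j * w 0 k)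
    - (j == k)%:R * ((2 * a * (i == l)%:R + b * x 0 i * x 0 l) * u 0 i * v 0 j * w 0 k)
    + (b * ((j == l)%:R * x 0 i - (i == l)%:R * x 0 j)) * u 0 i * v 0 j * (x 0 k * w 0 k))).
    by apply: eq_bigr => k _; rewrite riemann_coefE -/a -/b; ring.
  rewrite big_split /= sumrB !sum_deltaV -mulr_sumr -/(dot x w); ring.
have T (p q : 'I_n -> R) : \sum_i \sum_j p i * q j = (\sum_i p i) * (\sum_j q j).
  by rewrite mulr_suml; apply: eq_bigr => i _; rewrite mulr_sumr.
have L (p : pt) : \sum_j (2 * a * (j == l)%:R + b * x 0 j * x 0 l) * p 0 j =
    2 * a * p 0 l + b * dot x p * x 0 l.
  transitivity (\sum_j ((j == l)%:R * (2 * a * p 0 j) + (b * x 0 l) * (x 0 j * p 0 j))).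
    by apply: eq_bigr => j _; ring.
  rewrite big_split /= sum_delta -mulr_sumr -/(dot x p); ring.
under eq_bigr => i _.
  rewrite big_split /= sumrB -mulr_sumr -mulr_sumr -mulr_sumr sumrB -mulr_sumr -mulr_sumr.
  rewrite L sum_delta -/(dot v w) -/(dot x v).
  over.
rewrite big_split /= sumrB -mulr_suml -mulr_suml -mulr_sumr sumrB -mulr_suml -mulr_suml.
by rewrite L sum_delta -/(dot u w) -/(dot x u); ring.
Qed.

Lemma inner_metric x u v : inner metric x u v = conf (sqn x) * dot u v.
Proof.
rewrite /inner mxE /dot mulr_sumr; apply: eq_bigr => j _.
by rewrite mul_mx_scalar !mxE mulrA.
Qed.

Lemma curvature_numerator x u v : inner metric x (riemann metric x u v v) u =
  - conf (sqn x) * (2 * schouten_a x * (sqn u * sqn v - dot u v ^+ 2) +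
    schouten_b x * gramq x u v).
Proof.
rewrite inner_metric mulNr -mulrN; congr (_ * _); rewrite {1}/dot.
under eq_bigr => l _ do rewrite riemannE.
set a := schouten_a x; set b := schouten_b x.
transitivity (\sum_l ((2 * a * dot u v + b * dot x v * dot x u) * (u 0 l * v 0 l)
  + (b * dot u v * dot x v - b * dot v v * dot x u) * (x 0 l * u 0 l)
  - (2 * a * dot v v + b * dot x v ^+ 2) * (u 0 l * u 0 l))).
  by apply: eq_bigr => l _; ring.
rewrite sumrB big_split /= -!mulr_sumr -/(dot u v) -/(dot x u) -/(dot u u).
by rewrite !dot_sqn /gramq; ring.
Qed.

(** The numerator of the sectional curvature is, up to a positive factor,
    [- 2 a D - b Q] where [0 <= Q <= t D]; it is nonnegative because [a <= 0] by
    the slope bound on [ramp], and [2 a + t b <= 0] by its convexity. *)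
Lemma metric_nonneg : nonneg_sectional_curvature metric.
Proof.
move=> x u v _; rewrite /sectional_curvature curvature_numerator !inner_metric !dot_sqn.
set D := sqn u * sqn v - dot u v ^+ 2; have D0 : 0 <= D by exact: gram2_ge0.
have c0 := conf_gt0 (sqn x); have t0 := sqn_ge0 x.
apply: mulr_ge0; last first.
  rewrite invr_ge0 (_ : _ - _ = conf (sqn x) ^+ 2 * D); last by rewrite /D; ring.
  by rewrite mulr_ge0// sqr_ge0.
rewrite mulNr -mulrN; apply: mulr_ge0; first exact: ltW.
have Q0 := gramq_ge0 x u v; have Q1 : gramq x u v <= sqn x * D by exact: gramq_le.
have a0 : schouten_a x <= 0.
  have l1 := lconf1_npos t0; have := mul_lconf1_ge t0.
  rewrite /schouten_a -mulrA pmulr_rle0// => h.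
  by rewrite mulr_le0_ge0//; lra.
have ab : 2 * schouten_a x + sqn x * schouten_b x <= 0.
  have := lconf_slope_le0 t0; rewrite /schouten_a /schouten_b; nra.
rewrite oppr_ge0; have [b0|b0] := leP (schouten_b x) 0.
  have h1 : schouten_a x * D <= 0 by rewrite mulr_le0_ge0.
  have h2 : schouten_b x * gramq x u v <= 0 by rewrite mulr_le0_ge0.
  lra.
have h1 : schouten_b x * gramq x u v <= schouten_b x * (sqn x * D).
  by apply: ler_wpM2l => //; exact: ltW.
have h2 : (2 * schouten_a x + sqn x * schouten_b x) * D <= 0 by rewrite mulr_le0_ge0.
nra.
Qed.

(** At a point off the unit ball, the plane spanned by the radial direction and
    another one sees the strict convexity of [ramp]. *)
Lemma metric_not_flat : (1 < n)%N -> ~ flat metric.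
Proof.
move=> n1 fl; have n0 : (0 < n)%N by exact: ltnW.
pose i0 := Ordinal n0; pose i1 := Ordinal n1.
pose u : pt := delta_mx 0 i0; pose v : pt := delta_mx 0 i1; pose x : pt := 2 *: u.
have dd i j : dot (delta_mx 0 i) (delta_mx 0 j) = (i == j)%:R.
  rewrite /dot -[RHS](sum_delta (fun k => (k == j)%:R)); apply: eq_bigr => k _.
  by rewrite !mxE !eqxx.
have uu : sqn u = 1 by rewrite -dot_sqn dd eqxx.
have vv : sqn v = 1 by rewrite -dot_sqn dd eqxx.
have uv : dot u v = 0 by rewrite dd.
have xE w : dot x w = 2 * dot u w.
  by rewrite -[x]addr0 -(scale0r u) dot_lin mul0r addr0.
have xx : sqn x = 4 by rewrite -dot_sqn xE dotC xE dot_sqn uu; ring.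
have := curvature_numerator x u v; rewrite fl inner_metric.
rewrite (_ : dot 0 u = 0); last by rewrite /dot big1// => i _; rewrite mxE mul0r.
rewrite /gramq !xE uu vv uv dot_sqn uu mulr0 => H.
have s := @lconf_slope_lt0 R 4 ltac:(by rewrite ltr1n).
have /eqP : conf (sqn x) * (4 * (lconf1 (sqn x) + sqn x * lconf2 (sqn x))) = 0.
  by move/esym: H; rewrite /schouten_a /schouten_b xx => H; lra.
rewrite mulf_eq0 (negPf (conf_neq0 _)) mulf_eq0 pnatr_eq0 /= xx.
by rewrite lt_eqF.
Qed.

Lemma metric_riemannian : riemannian_metric metric.
Proof.
split.
- move=> i j; under eq_fun do rewrite metricE.
  apply: smooth_mul; [exact: openT| |exact: smooth_conf].
  by apply: smooth_cst; exact: openT.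
- by move=> x; rewrite tr_scalar_mx.
- move=> x v v0; rewrite -/(inner metric x v v) inner_metric dot_sqn.
  by rewrite mulr_gt0 ?conf_gt0// sqn_gt0.
Qed.

Lemma metric_euclidean_near : euclidean_near metric 0.
Proof.
apply: (open_near (U := [set x : pt | sqn x < 1])).
- exact: open_sqn_lt.
- by rewrite /= sqn0.
- by move=> y /= y1; rewrite /metric conf_le1// ltW.
Qed.

End curvature.

(** * Distance and completeness *)

Section distance.
Context {R : realType} {n : nat}.
Local Notation pt := 'rV[R]_n.
Local Notation g := (@metric R n).
Implicit Types (x y z : pt) (c : R -> pt) (t : R).

Let d1coord c t (i : 'I_n) : C1_curve c ->
  is_derive t 1 (fun s => c s 0 i) (derive1 c t 0 i).
Proof.
move=> [dc _]; have /derivable_mxP dci := dc t.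
apply: DeriveDef; first exact: dci.
by rewrite derive1E (derive_mx (dc t)) mxE.
Qed.

Let comp_cont (f : R -> pt) (h : pt -> R) t : {for t, continuous f} ->
  {for f t, continuous h} -> {for t, continuous (fun s => h (f s))}.
Proof. exact: continuous_comp. Qed.

Let coord_curve_cont (f : R -> pt) (i : 'I_n) :
  continuous f -> continuous (fun t => f t 0 i).
Proof.
move=> cf t; apply: (@comp_cont f (fun x : pt => x 0 i)); first exact: cf.
exact: coord_cont.
Qed.

Let curve_cont c : C1_curve c -> continuous c.
Proof.
move=> [dc _] t; apply: differentiable_continuous; exact/derivable1_diffP.
Qed.

Let sum_cont (F : 'I_n -> R -> R) :
  (forall i, continuous (F i)) -> continuous (fun t => \sum_i F i t).
Proof.
move=> cF t; elim: (index_enum 'I_n) => [|i r IH].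
  by under eq_fun do rewrite big_nil; exact: cst_continuous.
under eq_fun do rewrite big_cons.
have ci : {for t, continuous (F i)} by exact: cF.
exact: cvgD ci IH.
Qed.

Let sqn_curve_cont (f : R -> pt) : continuous f -> continuous (fun t => sqn (f t)).
Proof. by move=> cf t; apply: (@comp_cont f sqn); [exact: cf|exact: sqn_cont]. Qed.

Definition speed c t : R := Num.sqrt (inner g (c t) (derive1 c t) (derive1 c t)).

Lemma speedE c t : speed c t = Num.sqrt (conf (sqn (c t)) * sqn (derive1 c t)).
Proof. by rewrite /speed inner_metric dot_sqn. Qed.

Lemma speed_cont c : C1_curve c -> continuous (speed c).
Proof.
move=> c1 t; have cc := curve_cont c1; have [_ cd] := c1.
rewrite (_ : speed c = Num.sqrt \o (fun s => conf (sqn (c s)) * sqn (derive1 c s))); last first.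
  by apply/funext => s; rewrite speedE.
apply: continuous_comp; last exact: sqrt_continuous.
have h1 : {for t, continuous (fun s => conf (sqn (c s)))}.
  apply: continuous_comp; first exact: sqn_curve_cont.
  exact: derive_cont (is_derive_conf _).
exact: cvgM h1 (@sqn_curve_cont _ cd t).
Qed.

Let integrable01 (f : R -> R) : continuous f ->
  lebesgue_measure.-integrable `[0, 1] (EFin \o f).
Proof.
move=> cf; apply: continuous_compact_integrable; first exact: segment_compact.
exact: continuous_subspaceT.
Qed.

Lemma arc_length_ge0 c : 0 <= arc_length g c.
Proof. by apply: Rintegral_ge0 => t _; exact: sqrtr_ge0. Qed.

Lemma arc_length_ge c (f f' : R -> R) : C1_curve c ->
  (forall t, is_derive t 1 f (f' t)) -> continuous f' ->
  (forall t, `|f' t| <= speed c t) -> `|f 1 - f 0| <= arc_length g c.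
Proof.
move=> c1 fd cf' fs.
have -> : f 1 - f 0 = \int[lebesgue_measure]_(t in `[0, 1]) f' t.
  rewrite /Rintegral (@continuous_FTC2 _ f' f)//.
  - exact: continuous_subspaceT.
  - have cf t : {for t, continuous f} by exact: derive_cont (fd t).
    split; first by move=> x _; case: (fd x).
    + exact: cvg_at_right_filter (cf _).
    + exact: cvg_at_left_filter (cf _).
  - by move=> x _; rewrite derive1E; case: (fd x).
apply: le_trans (le_normr_Rintegral _ _) _ => //; first exact: integrable01.
apply: le_Rintegral => //.
- apply: integrable01 => t; apply: continuous_comp; first exact: cf'.
  exact: norm_continuous.
- exact: integrable01 (speed_cont c1).
Qed.

(** [ln (1 + |x|)], smoothed at the origin, has gradient bounded by the
    conformal factor, since the latter is at least [(1 + |x|^2)^-1]. *)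
Definition height (e : R) x : R := ln (1 + Num.sqrt (e + sqn x)).

Lemma height_arc e c : 0 < e -> C1_curve c ->
  `|height e (c 1) - height e (c 0)| <= arc_length g c.
Proof.
move=> e0 c1; have [dc cd] := c1; have cc := curve_cont c1.
pose v t := e + sqn (c t).
have v0 t : 0 < v t by rewrite /v ltr_pwDl// sqn_ge0.
have s0 t : 0 < Num.sqrt (v t) by rewrite sqrtr_gt0.
pose w t := \sum_i c t 0 i * derive1 c t 0 i.
pose h' t := (1 + Num.sqrt (v t))^-1 * ((Num.sqrt (v t))^-1 * w t).
have vd t : is_derive t 1 v (2 * w t).
  have d i := is_deriveMf (@d1coord c t i c1) (@d1coord c t i c1).
  have := is_deriveDf (is_derive_cstR t e) (is_derive_sumf (index_enum 'I_n) d).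
  rewrite (_ : (fun s => _ + _) = v).
    move/is_derive_subst; apply; rewrite add0r /w mulr_sumr.
    by apply: eq_bigr => i _; ring.
  apply/funext => s; rewrite /v /sqn; congr (_ + _).
have hd t : is_derive t 1 (fun t => height e (c t)) (h' t).
  have d1 := is_derive_comp_line (vd t) (is_derive1_sqrt (v0 t)).
  have d2 := is_deriveDf (is_derive_cstR t 1) d1.
  have p : 0 < 1 + Num.sqrt (v t) by rewrite ltr_pwDl ?sqrtr_ge0.
  have := is_derive_comp_line d2 (is_derive1_ln p).
  move/is_derive_subst; apply; rewrite /h' add0r; field.
  by rewrite !gt_eqF.
have cv : continuous v by move=> t; exact: derive_cont (vd t).
have cs : continuous (fun t => Num.sqrt (v t)).
  by move=> t; apply: continuous_comp; [exact: cv|exact: sqrt_continuous].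
have cw : continuous w.
  apply: sum_cont => i t.
  exact: cvgM (@coord_curve_cont _ i cc t) (@coord_curve_cont _ i cd t).
apply: (arc_length_ge c1 hd) => t.
  have h1 : {for t, continuous (fun t => (1 + Num.sqrt (v t))^-1)}.
    apply: cvgV; first by rewrite gt_eqF// ltr_pwDl ?sqrtr_ge0.
    exact: cvgD (cvg_cst _) (cs t).
  have h2 : {for t, continuous (fun t => (Num.sqrt (v t))^-1)}.
    by apply: cvgV; [rewrite gt_eqF|exact: cs].
  exact: cvgM h1 (cvgM h2 (cw t)).
rewrite speedE -(@ler_pXn2r _ 2) ?nnegrE ?sqrtr_ge0// real_normK ?num_real//.
have cf0 := conf_gt0 (sqn (c t)).
rewrite sqr_sqrtr; last by rewrite mulr_ge0 ?sqn_ge0// ltW.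
have wle : w t ^+ 2 <= v t * sqn (derive1 c t).
  have := gram2_ge0 (c t) (derive1 c t); rewrite subr_ge0 => H.
  apply: le_trans H _; apply: ler_wpM2r; first exact: sqn_ge0.
  by rewrite /v lerDr ltW.
have sv : Num.sqrt (v t) ^+ 2 = v t by rewrite sqr_sqrtr// ltW.
rewrite /h' !exprMn exprVn [(Num.sqrt (v t))^-1 ^+ 2]exprVn sv.
have p2 : 0 < (1 + Num.sqrt (v t)) ^+ 2 by rewrite exprn_gt0// ltr_pwDl ?sqrtr_ge0.
have K : (v t)^-1 * w t ^+ 2 <= sqn (derive1 c t) by rewrite ler_pdivrMl.
have L : ((1 + Num.sqrt (v t)) ^+ 2)^-1 <= conf (sqn (c t)).
  apply: le_trans (conf_lb (sqn_ge0 (c t))); rewrite lef_pV2 ?posrE//; last first.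
    by rewrite ltr_pwDl ?sqn_ge0.
  have -> : (1 + Num.sqrt (v t)) ^+ 2 = 1 + 2 * Num.sqrt (v t) + v t.
    transitivity (1 + 2 * Num.sqrt (v t) + Num.sqrt (v t) ^+ 2); first ring.
    by rewrite sv.
  by rewrite /v; have := s0 t; rewrite /v; lra.
apply: ler_pM => //.
by rewrite mulr_ge0 ?sqr_ge0// invr_ge0 ltW.
Qed.

Definition lengths x y : set R := [set \sum_(c <- s) arc_length g c | s in joins x y].

Lemma rdistE x y : rdist g x y = inf (lengths x y). Proof. by []. Qed.

Lemma height_joins e x y s : 0 < e -> joins x y s ->
  `|height e y - height e x| <= \sum_(c <- s) arc_length g c.
Proof.
move=> e0; elim: s x => [|c s IH] x /=; first by move=> ->; rewrite subrr normr0 big_nil.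
move=> [c1 <- /IH js]; rewrite big_cons.
rewrite -(subrKA (height e (c 1))); apply: le_trans (ler_normD _ _) _.
by rewrite addrC lerD// height_arc.
Qed.

Lemma lengths_ge0 x y : lbound (lengths x y) 0.
Proof. by move=> _ [s _ <-]; apply: sumr_ge0 => c _; exact: arc_length_ge0. Qed.

Let segment x y : R -> pt := fun t => x + t *: (y - x).

Lemma segment_derive x y t : is_derive t 1 (segment x y) (y - x).
Proof.
have H : (fun h => h^-1 *: ((segment x y \o shift t) (h *: (1 : R)) - segment x y t)) @ 0^'
    --> y - x.
  apply: cvg_near_cst; near=> h.
  have h0 : h != 0 by near: h; exact: nbhs_dnbhs_neq.
  rewrite /= /segment [_%:A]mulr1 opprD addrACA subrr add0r -scalerBl addrK.
  by rewrite scalerA mulVf// scale1r.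
split; first by apply/cvg_ex; exists (y - x).
exact: cvg_lim H.
Unshelve. all: by end_near. Qed.

Lemma segment_joins x y : joins x y [:: segment x y].
Proof.
have d t : derive1 (segment x y) t = y - x.
  by rewrite derive1E; case: (segment_derive x y t).
split; first split.
- by move=> t; case: (segment_derive x y t).
- by rewrite (_ : derive1 _ = fun=> y - x); [exact: cst_continuous|exact/funext].
- by rewrite /segment scale0r addr0.
- by rewrite /= /segment scale1r addrC subrK.
Qed.

Lemma segment_length x y : arc_length g (segment x y) <= Num.sqrt (sqn (y - x)).
Proof.
have [c1 _ _] := segment_joins x y.
have -> : Num.sqrt (sqn (y - x)) =
    \int[lebesgue_measure]_(t in `[0, 1]) (fun=> Num.sqrt (sqn (y - x))) t.
  have L : lebesgue_measure (`[0, 1]%classic : set R) = 1%E.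
    by rewrite lebesgue_measure_itv /= lte_fin ltr01 oppr0 adde0.
  by rewrite Rintegral_cst// [X in fine X]L mulr1.
apply: le_Rintegral => //.
- exact: integrable01 (speed_cont c1).
- by apply: integrable01; exact: cst_continuous.
move=> t _; rewrite -/(speed _ t) speedE derive1E.
have [_ ->] := segment_derive x y t.
by apply: ler_wsqrtr; rewrite ler_piMl ?sqn_ge0// conf_ub.
Qed.

Lemma lengths_segment x y : lengths x y (arc_length g (segment x y)).
Proof.
by exists [:: segment x y]; [exact: segment_joins|rewrite big_seq1].
Qed.

Lemma rdist_le x y : rdist g x y <= Num.sqrt (sqn (y - x)).
Proof.
apply: le_trans (segment_length x y); rewrite rdistE.
by apply: ge_inf; [exists 0; exact: lengths_ge0|exact: lengths_segment].
Qed.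

Lemma rdist_height e x y : 0 < e -> `|height e y - height e x| <= rdist g x y.
Proof.
move=> e0; apply: lb_le_inf; first by exists (arc_length g (segment x y)); exact: lengths_segment.
by move=> _ [s js <-]; exact: height_joins.
Qed.

Lemma rdist_ge0 x y : 0 <= rdist g x y.
Proof. exact: le_trans (rdist_height x y ltr01). Qed.

Lemma joins_cat x y z s s' : joins x y s -> joins y z s' -> joins x z (s ++ s').
Proof. by elim: s x => [x -> //|c s IH] x /= [c1 c0 /IH H] /H. Qed.

Lemma rdist_triangle x y z : rdist g x z <= rdist g x y + rdist g y z.
Proof.
rewrite -lerBlDr; apply: lb_le_inf.
  by exists (arc_length g (segment x y)); exact: lengths_segment.
move=> a [s js sa]; rewrite lerBlDr -lerBlDl; apply: lb_le_inf.
  by exists (arc_length g (segment y z)); exact: lengths_segment.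
move=> b [s' js' sb]; rewrite lerBlDl.
apply: ge_inf; first by exists 0; exact: lengths_ge0.
by exists (s ++ s'); [exact: joins_cat js js'|rewrite big_cat /= sa sb].
Qed.

(** The limit of [rdist_height] when the smoothing parameter of [height] tends
    to zero. *)
Lemma rdist_ge x : ln (1 + Num.sqrt (sqn x)) <= rdist g 0 x.
Proof.
apply/ler_addgt0Pr => e e0.
have e20 : 0 < e ^+ 2 by rewrite exprn_gt0.
have := rdist_height 0 x e20; rewrite /height sqn0 addr0 sqrtr_sqr (gtr0_norm e0) => H.
have H1 : ln (1 + e) <= e by apply: le_ln1Dx; rewrite (lt_trans _ e0).
have H2 : ln (1 + Num.sqrt (sqn x)) <= ln (1 + Num.sqrt (e ^+ 2 + sqn x)).
  rewrite ler_ln ?posrE ?ltr_pwDl ?sqrtr_ge0// lerD2l ler_wsqrtr//.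
  by rewrite lerDr ltW.
have := ler_norm (ln (1 + Num.sqrt (e ^+ 2 + sqn x)) - ln (1 + e)); lra.
Qed.

Lemma rdist_ge_ratio x : Num.sqrt (sqn x) / (1 + Num.sqrt (sqn x)) <= rdist g 0 x.
Proof.
apply: le_trans (rdist_ge x); set r := Num.sqrt _; have r0 : 0 <= r by exact: sqrtr_ge0.
have p : 0 < 1 + r by rewrite ltr_pwDl.
have : ln (1 + - (r / (1 + r))) <= - (r / (1 + r)).
  apply: le_ln1Dx; rewrite ltrN2 ltr_pdivrMr//; lra.
have -> : 1 + - (r / (1 + r)) = (1 + r)^-1 by field; rewrite gt_eqF.
by rewrite lnV ?posrE// lerN2.
Qed.

(** A Cauchy sequence has bounded [height], hence stays in a compact cube, and an
    accumulation point for the Euclidean topology is a limit for the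
    distance. *)
Lemma metric_complete : complete_metric g.
Proof.
move=> q Cq; have [N NP] := Cq 1 ltr01.
pose B := expR (height 1 (q N) + 1).
have qB i : (N <= i)%N -> sqn (q i) <= B ^+ 2.
  move=> Ni; have := rdist_height (q N) (q i) ltr01; have := NP N i (leqnn N) Ni.
  move=> h1 h2; have h3 : height 1 (q i) <= height 1 (q N) + 1.
    have := ler_norm (height 1 (q i) - height 1 (q N)); lra.
  have p : 0 < 1 + Num.sqrt (1 + sqn (q i)) by rewrite ltr_pwDl ?sqrtr_ge0.
  have h4 : Num.sqrt (1 + sqn (q i)) <= B.
    move: h3; rewrite -ler_expR -/B /height lnK ?posrE//; apply: le_trans.
    by rewrite lerDr.
  have -> : sqn (q i) = Num.sqrt (1 + sqn (q i)) ^+ 2 - 1.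
    by rewrite sqr_sqrtr; [ring|rewrite addr_ge0 ?sqn_ge0].
  have := sqrtr_ge0 (1 + sqn (q i)); nra.
pose K := [set x : pt | forall i, `|x 0 i| <= B].
have cK : compact K by exact: compact_cube.
have B0 : 0 <= B by exact: expR_ge0.
have FK : (q @ \oo) K.
  exists N => // i /= Ni j; apply: cube_sqn => //; exact: qB.
have [l [_ cl]] := cK (q @ \oo) _ FK.
have close e M : 0 < e -> exists2 k, (M <= k)%N & rdist g (q k) l < e.
  move=> e0; pose U := [set x : pt | sqn (l - x) < e ^+ 2].
  have Ul : nbhs l U.
    have cU : continuous (fun x : pt => sqn (l - x)).
      move=> x; have lx : {for x, continuous (fun y : pt => l - y)}.
        apply: (@cvgB _ _ _ (nbhs x) _ (fun=> l) (fun y : pt => y) l x).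
          exact: cvg_cst.
        exact: cvg_id.
      exact: (@continuous_comp _ _ _ _ sqn x lx (@sqn_cont R n _)).
    apply: (@cvgr_lt _ _ (nbhs l) _ (fun x : pt => sqn (l - x)) (sqn (l - l))).
      exact: cU.
    by rewrite subrr sqn0 exprn_gt0.
  have QM : (q @ \oo) (q @` [set k | (M <= k)%N]).
    by exists M => // k Mk; exists k.
  have [x [[k Mk <-] Uk]] := cl _ _ QM Ul.
  exists k => //; apply: le_lt_trans (rdist_le _ _) _.
  by rewrite -[e]gtr0_norm// -sqrtr_sqr ltr_sqrt ?exprn_gt0.
exists l; apply/cvgrPdist_lt => e e0.
have e20 : 0 < e / 2 by rewrite divr_gt0.
have [M MP] := Cq _ e20; have [k Mk kl] := close _ M e20.
exists M => // i /= Mi; rewrite sub0r normrN ger0_norm ?rdist_ge0//.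
apply: le_lt_trans (rdist_triangle _ (q k) _) _.
have := MP i k Mi Mk; lra.
Qed.

End distance.

(** * The Green function of the metric *)

Section operators.
Context {R : realType}.
Variables (n m : nat).
Hypothesis hn : n = m.+1.*2.
Local Notation pt := 'rV[R]_n.
Local Notation g := (@metric R n).
Implicit Types (x y : pt) (H phi : pt -> R).

Lemma vol_densityE x : vol_density g x = conf (sqn x) ^+ m.+1.
Proof.
rewrite /vol_density det_scalar; move: (conf _) (conf_gt0 (sqn x)) => a a0.
rewrite hn -muln2 exprM sqrtr_sqr ger0_norm//.
by rewrite exprn_ge0// ltW.
Qed.

Lemma gradE phi x i : grad g phi x 0 i = (conf (sqn x))^-1 * partial i phi x.
Proof.
rewrite mxE; under eq_bigr => j _ do rewrite invmx_metricE -mulrA.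
by rewrite sum_deltaV.
Qed.

Lemma grad_norm2E phi x :
  grad_norm2 g phi x = (conf (sqn x))^-1 * \sum_i partial i phi x ^+ 2.
Proof.
rewrite /grad_norm2 inner_metric /dot !mulr_sumr; apply: eq_bigr => i _.
by rewrite gradE; field; exact: conf_neq0.
Qed.

Lemma laplacian_vol phi x : laplacian g phi x * vol_density g x = wlap m phi x.
Proof.
have v0 : vol_density g x != 0 by rewrite vol_densityE expf_neq0// conf_neq0.
rewrite /laplacian /divergence mulrAC mulVf// mul1r; apply: eq_bigr => i _.
congr (partial i _ x); apply/funext => y; rewrite vol_densityE gradE exprSr.
by rewrite -mulrA mulVKf// conf_neq0.
Qed.

Lemma vol_integral_laplacian H phi :
  vol_integral g (fun x => H x * laplacian g phi x) =
  intRn (fun x => H x * wlap m phi x).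
Proof.
by rewrite /vol_integral /intRn; congr Rintegral; apply/funext => t; rewrite -mulrA laplacian_vol.
Qed.

End operators.

Section green_function.
Context {R : realType}.
Variables (n m : nat) (g : R -> R) (c : R).
Hypothesis hn : n = m.+1.*2.
Hypothesis m_gt0 : (0 < m)%N.
Hypothesis gP : green_profile m g c.
Local Notation pt := 'rV[R]_n.
Local Notation row := (@row_of_tuple R n).
Local Notation met := (@metric R n).
Local Notation G := (fun x : pt => g (sqn x)).
Implicit Types (x y : pt) (H phi : pt -> R).

Lemma vol_integrable_green (K : set pt) : compact K -> vol_integrable met K G.
Proof.
move=> cK; have hK : closed K by apply: compact_closed => //; exact: norm_hausdorff.
have mK : measurable (row @^-1` K).
  have -> : row @^-1` K = ~` (row @^-1` (~` K)) by rewrite -preimage_setC setCK.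
  by apply: measurableC; apply: open_measurable_row; exact: closed_openC.
have [M [M0 KM]] := compact_coord_bounded cK.
pose h x := if `[< K x >] then vol_density met x else 0.
have hE : (fun t => ((G (row t) * vol_density met (row t))%:E)) \_ (row @^-1` K)
    = EFin \o ((fun x => g (sqn x) * h x) \o row).
  apply/funext => t; rewrite patchE /= /h; case: asboolP => Kt.
    by rewrite mem_set.
  by rewrite memNset// mulr0.
rewrite /vol_integrable; apply/(integrable_mkcond _ mK); rewrite hE.
apply: (@intableRn_green _ _ _ _ _ hn m_gt0 gP h M 1) => //.
- rewrite (_ : h \o row = (\1_(row @^-1` K) : _ -> R) \*
     ((fun x => conf (sqn x) ^+ m.+1) \o row)).
    apply: measurable_funM; first exact: measurable_indic.
    apply: measurable_row => x.
    apply: (smooth_cont (U := setT)) => //.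
    by apply: smooth_exp; [exact: openT|exact: smooth_conf].
  apply/funext => t; rewrite /h /= indicE (vol_densityE hn); case: asboolP => Kt.
    by rewrite mem_set//= mul1r.
  by rewrite memNset//= mul0r.
- move=> x j xM; rewrite /h asboolF// => /KM => /(_ j).
  by rewrite leNgt xM.
- move=> x; rewrite /h; case: asboolP => _; last by rewrite normr0.
  rewrite (vol_densityE hn) ger0_norm; last by rewrite exprn_ge0// ltW// conf_gt0.
  by apply: exprn_ile1; [rewrite ltW// conf_gt0|exact: conf_ub].
Qed.

Lemma green_equation_green : green_equation met 0 G.
Proof.
split; first exact: vol_integrable_green.
move=> phi tphi; rewrite (vol_integral_laplacian hn) (green_weak hn m_gt0 gP tphi).
have -> : sphere_area (R := R) (n := n) = n%:R * ball_volume n by [].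
have -> : n%:R - 2 = 2 * m%:R :> R by rewrite hn -muln2 natrM -natr1; ring.
ring.
Qed.

End green_function.

Section minimality.
Context {R : realType}.
Variables (n m : nat) (g : R -> R) (c : R).
Hypothesis hn : n = m.+1.*2.
Hypothesis m_gt0 : (0 < m)%N.
Hypothesis gP : green_profile m g c.
Local Notation pt := 'rV[R]_n.
Local Notation met := (@metric R n).
Local Notation G := (fun x : pt => g (sqn x)).
Implicit Types (x y : pt) (H phi : pt -> R).

Lemma cvg_punctured (f : pt -> R) (l : R) :
  {for 0, continuous f} -> f 0 = l -> f x @[x --> (0 : pt)^'] --> l.
Proof. by move=> cf <-; apply: cvg_trans cf; apply: cvg_app; exact: cvg_within. Qed.

Lemma near_pole (P : pt -> Prop) : (\forall x \near (0 : pt)^', P x) ->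
  exists2 d : R, 0 < d & forall x, 0 < sqn x < d -> P x.
Proof.
rewrite /dnbhs /within /= => /nbhs_ballP[r /= r0 rP].
exists (r ^+ 2); first exact: exprn_gt0.
move=> x /andP[]; rewrite sqn_gt0 => x0 xr; apply: rP => //.
apply: rV_ballP => // j; rewrite mxE sub0r normrN.
rewrite -(@ltr_pXn2r _ 2) ?nnegrE ?(ltW r0)// real_normK ?num_real//.
exact: le_lt_trans (coord_sqn x j) xr.
Qed.

Let dim_sub2 : (n - 2 = m.*2)%N. Proof. by rewrite hn -!muln2; lia. Qed.

(** On the flat ball the Green function is [|x|^(2-n) + c], and the Riemannian
    distance to the pole is asymptotic to [|x|]. *)
Lemma green_asymptotic : G x / rdist met 0 x ^- (n - 2) @[x --> (0 : pt)^'] --> (1 : R).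
Proof.
have [c0 g1 _ _ _] := gP.
pose lo x : R := ((1 + Num.sqrt (sqn x)) ^+ m.*2)^-1.
pose up x : R := 1 + c * sqn x ^+ m.
apply: (@squeeze_cvgr _ _ _ _ lo up).
- near=> x.
  have x0 : x != 0 by near: x; exact: nbhs_dnbhs_neq.
  have x1 : sqn x < 1.
    near: x; apply: cvg_within; apply: open_near (@open_sqn_lt R n 1) _ _ => //.
    by rewrite /= sqn0.
  have s0 : 0 < sqn x by rewrite sqn_gt0.
  rewrite invrK dim_sub2 (g1 _ (ltW x1)) /lo /up.
  have rho0 : 0 < Num.sqrt (sqn x) by rewrite sqrtr_gt0.
  have rhoE : Num.sqrt (sqn x) ^+ m.*2 = sqn x ^+ m.
    by rewrite -mul2n exprM sqr_sqrtr// ltW.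
  have r1 := rdist_ge_ratio x; have := rdist_le 0 x; rewrite subr0 => r2.
  have r0 := rdist_ge0 0 x.
  have p1 : 0 < 1 + Num.sqrt (sqn x) by rewrite ltr_pwDl// ltW.
  have up1 : rdist met 0 x ^+ m.*2 <= sqn x ^+ m.
    by rewrite -rhoE; apply: lerXn2r => //; rewrite nnegrE ltW.
  have lo1 : sqn x ^+ m * ((1 + Num.sqrt (sqn x)) ^+ m.*2)^-1 <= rdist met 0 x ^+ m.*2.
    rewrite -rhoE -expr_div_n; apply: lerXn2r => //.
    by rewrite nnegrE divr_ge0// ltW.
  have sm0 : 0 < sqn x ^+ m by exact: exprn_gt0.
  rewrite exprVn; move: lo1 up1 sm0.
  move: (sqn x ^+ m) (rdist met 0 x ^+ m.*2) (exprn_ge0 m.*2 r0) => s r rr lo1 up1 sm0.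
  apply/andP; split.
    rewrite mulrDl; apply: ler_wpDr; first exact: mulr_ge0.
    by rewrite ler_pdivlMl.
  rewrite -[1 in leRHS](@mulVf _ s) ?gt_eqF// -mulrDl.
  by apply: ler_wpM2l => //; rewrite addr_ge0// invr_ge0 ltW.
- apply: cvg_punctured; last by rewrite /lo sqn0 sqrtr0 addr0 expr1n invr1.
  have cr : {for (0 : pt), continuous (fun x : pt => (1 + Num.sqrt (sqn x)) ^+ m.*2)}.
    have cs : {for (0 : pt), continuous (fun x : pt => Num.sqrt (sqn x))}.
      by apply: continuous_comp; [exact: sqn_cont|exact: sqrt_continuous].
    have c1 : {for (0 : pt), continuous (fun x : pt => 1 + Num.sqrt (sqn x))}.
      exact: cvgD (cvg_cst _) cs.
    exact: (continuous_comp c1 (@exprn_continuous _ _ _)).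
  by apply: continuousV cr; rewrite sqn0 sqrtr0 addr0 expr1n oner_eq0.
- apply: cvg_punctured; last by rewrite /up sqn0 expr0n eqn0Ngt m_gt0 mulr0 addr0.
  apply: (smooth_cont (U := setT)) => //; have oT := @openT pt.
  apply: smooth_add => //; first exact: smooth_cst.
  apply: smooth_mul => //; first exact: smooth_cst.
  by apply: smooth_exp => //; exact: smooth_sqn.
Unshelve. all: by end_near. Qed.

Lemma pole_ratio (F H : pt -> R) (k : nat) e :
  F x / rdist met 0 x ^- k @[x --> (0 : pt)^'] --> (1 : R) ->
  H x / rdist met 0 x ^- k @[x --> (0 : pt)^'] --> (1 : R) -> 0 < e ->
  exists2 d : R, 0 < d & forall x, 0 < sqn x < d -> F x <= (1 + e) * H x.
Proof.
move=> F1 H1 e0; apply: near_pole.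
have q1 : 1 < 1 + e / 2 by rewrite ltrDl divr_gt0.
have e1 : 0 < 1 + e by lra.
have q2 : (1 + e / 2) / (1 + e) < 1 by rewrite ltr_pdivrMr//; lra.
have nF := cvgr_lt _ F1 _ q1; have nH := cvgr_gt _ H1 _ q2.
near=> x.
have hF : F x / rdist met 0 x ^- k < 1 + e / 2 by near: x; exact: nF.
have hH : (1 + e / 2) / (1 + e) < H x / rdist met 0 x ^- k by near: x; exact: nH.
move: hF hH; rewrite invrK ltr_pdivrMr//; have := exprn_ge0 k (rdist_ge0 0 x).
move: (rdist met 0 x ^+ k) => r; rewrite le_eqVlt => /predU1P[<-|r0] hF hH.
  by move: hH; rewrite mulr0 mul0r; lra.
by rewrite -(ler_pM2r r0); lra.
Unshelve. all: by end_near. Qed.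

Lemma positive_green_green : positive_green met 0 G.
Proof.
split.
- exact: smooth_green gP.
- by move=> x x0; exact: (green_gt0 gP).
- exact: green_equation_green hn m_gt0 gP.
- exact: green_asymptotic.
Qed.

Lemma positive_green_wlap H : positive_green met 0 H ->
  forall y, y != 0 -> wlap m H y = 0.
Proof.
case=> sH _ [_ eqH] _; apply: weak_harmonic => // phi tphi phi0.
have := eqH phi tphi; rewrite (vol_integral_laplacian hn) phi0 mulr0.
by move/eqP; rewrite oppr_eq0 => /eqP.
Qed.

Lemma positive_green_ge H : positive_green met 0 H ->
  forall x, x != 0 -> g (sqn x) <= H x.
Proof.
move=> pH; have [sH H0 _ aH] := pH.
have near e : 0 < e -> exists2 d : R, 0 < d &
    forall x, 0 < sqn x < d -> g (sqn x) <= (1 + e) * H x.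
  exact: pole_ratio green_asymptotic aH.
exact: (green_le hn m_gt0 gP sH H0 (positive_green_wlap pH) near).
Qed.

Lemma minimal_green_green : minimal_green met 0 G.
Proof. by split; [exact: positive_green_green|exact: positive_green_ge]. Qed.

(** Two minimal Green functions bound each other. *)
Lemma minimal_green_unique H : minimal_green met 0 H ->
  forall x, x != 0 -> H x = g (sqn x).
Proof.
move=> [pH minH] x x0; apply/eqP; rewrite eq_le positive_green_ge// andbT.
exact: minH positive_green_green _ x0.
Qed.

(** The function [|x|^(n-2) G(x)]; its expression on the unit ball is a polynomial
    in the coordinates because [n] is even. *)
Definition regular_part x : R :=
  if sqn x < 1 then 1 + c * sqn x ^+ m else sqn x ^+ m * g (sqn x).

Lemma regular_partE x : x != 0 -> regular_part x = sqn x ^+ m * g (sqn x).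
Proof.
move=> x0; rewrite /regular_part; case: ifPn => // x1; have [_ g1 _ _ _] := gP.
rewrite g1; last exact: ltW.
by rewrite mulrDr exprVn divff 1?mulrC// expf_neq0// sqn_eq0.
Qed.

Lemma regular_part_gt0 x : 0 < regular_part x.
Proof.
have [->|x0] := eqVneq x 0.
  by rewrite /regular_part sqn0 ltr01 expr0n eqn0Ngt m_gt0 mulr0 addr0.
by rewrite regular_partE// mulr_gt0 ?(green_gt0 gP)// exprn_gt0// sqn_gt0.
Qed.

Lemma smooth_regular_part : smooth_on setT regular_part.
Proof.
apply: smooth_cover.
  have o1 := @open_sqn_lt R n 1.
  apply: (@smooth_eq _ _ _ (fun x => 1 + c * sqn x ^+ m)) => //.
    by move=> x /= x1; rewrite /regular_part x1.
  apply: smooth_add => //; first exact: smooth_cst.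
  apply: smooth_mul => //; first exact: smooth_cst.
  by apply: smooth_exp => //; exact: smooth_sqn.
have o1 := @open_nonzero R n.
apply: (@smooth_eq _ _ _ (fun x => sqn x ^+ m * g (sqn x))) => //.
  by move=> x /eqP x0; rewrite regular_partE.
apply: smooth_mul => //; last exact: smooth_green gP.
by apply: smooth_exp => //; exact: smooth_sqn.
Qed.

(* The exponent of [regular_part] in [|grad b|^2]. *)
Let kappa : R := - m%:R^-1 - 2.

(** With [N = |x|^(n-2) G], the powers of [|x|] cancel in the gradient of [b], and
    [|grad b|^2 = N^(-1/m - 2) conf^(1-n)], which only involves smooth positive
    functions. *)
Lemma smooth_extension_grad (F : pt -> R) : (forall x, x != 0 -> F x = g (sqn x)) ->
  smooth_extension_across 0 (grad_norm2 met (fun x => F x `^ (2 - n%:R)^-1)).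
Proof.
move=> FG; exists (fun x => expR (kappa * ln (regular_part x)) *
    (conf (sqn x))^-1 ^+ m.*2.+1).
  have oT := @openT pt; apply: smooth_mul => //.
    apply: smooth_expR => //; apply: smooth_mul => //; first exact: smooth_cst.
    apply: smooth_ln => //; last exact: smooth_regular_part.
    by move=> x _; exact: regular_part_gt0.
  apply: smooth_exp => //; apply: smooth_inv => //; last exact: smooth_conf.
  by move=> x _; exact: conf_neq0.
move=> x x0; have m0 : m%:R != 0 :> R by rewrite pnatr_eq0 -lt0n.
have t0 : 0 < sqn x by rewrite sqn_gt0.
have g0 : 0 < g (sqn x) by exact: (green_gt0 gP).
pose al : R := (2 - n%:R)^-1.
have alE : al = - (2 * m%:R)^-1.
  rewrite /al -invrN; congr _^-1; rewrite hn -muln2 natrM -natr1; ring.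
have [_ _ dg _ _] := gP.
pose dt : R := expR (al * ln (g (sqn x))) * (al * ((g (sqn x))^-1 *
   - (m%:R * (sqn x)^-1 ^+ m.+1 * (conf (sqn x))^-1 ^+ m))).
have d1 : is_derive (sqn x) 1 (fun t => expR (al * ln (g t))) dt.
  have h1 := is_derive_comp_line (dg _ t0) (is_derive1_ln g0).
  exact: is_derive_comp_line (is_derive_zmul al h1) (is_derive_expR _).
have pE i : partial i (fun x => F x `^ (2 - n%:R)^-1) x = dt * (2 * x 0 i).
  transitivity (partial i (fun y => expR (al * ln (g (sqn y)))) x).
    apply: near_eq_partial; apply: open_near (@open_nonzero R n) _ _; first exact/eqP.
    move=> y /eqP y0; rewrite FG// /powR gt_eqF//; exact: (green_gt0 gP).
  by apply: partialE; exact: is_derive_radial d1.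
rewrite grad_norm2E; under eq_bigr => i _ do rewrite pE.
have -> : \sum_i (dt * (2 * x 0 i)) ^+ 2 = dt ^+ 2 * 4 * sqn x.
  by rewrite /sqn mulr_sumr; apply: eq_bigr => i _; ring.
rewrite regular_partE// lnM ?posrE ?exprn_gt0// lnXn//.
have -> : expR (kappa * (ln (sqn x) *+ m + ln (g (sqn x)))) =
    (sqn x)^-1 * expR (al * ln (g (sqn x))) ^+ 2 * (sqn x)^-1 ^+ m.*2 * (g (sqn x))^-1 ^+ 2.
  move: (g (sqn x)) g0 {dt d1 pE} => y y0; move: (sqn x) t0 => t t0.
  rewrite !exprVn -[t]lnK ?posrE// -[y]lnK ?posrE// !expRK.
  rewrite -!expRM_natr -!expRN -!expRD; congr expR.
  rewrite alE /kappa -mulr_natr -mul2n natrM; field.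
  by rewrite ?mulf_neq0.
rewrite /dt; move: (expR _) => B; have c0 := conf_neq0 (sqn x).
have t0' : sqn x != 0 by rewrite gt_eqF.
have g0' : g (sqn x) != 0 by rewrite gt_eqF.
rewrite alE -mul2n mulnC !exprSr !exprM.
by field; rewrite t0' g0' m0 c0.
Qed.

End minimality.

Theorem corollary6p4 (R : realType) (n : nat) (n_ge4 : (4 <= n)%N)
    (n_even : ~~ odd n) :
  exists (p : 'rV[R]_n) (g : 'rV[R]_n -> 'M[R]_n),
    [/\ riemannian_metric g, complete_metric g, ~ flat g &
        nonneg_sectional_curvature g] /\
    [/\ exists G, minimal_green g p G,
        euclidean_near g p &
        forall G, minimal_green g p G ->
          smooth_extension_across p
            (grad_norm2 g (fun x => G x `^ (2 - n%:R)^-1))].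
Proof.
pose m := n./2.-1.
have hn : n = m.+1.*2 by rewrite /m; lia.
have m_gt0 : (0 < m)%N by rewrite /m; lia.
have [g [c gP]] := @green_profile_exists R m m_gt0.
exists 0, (@metric R n); split.
  split; [exact: metric_riemannian|exact: metric_complete| |exact: metric_nonneg].
  by apply: metric_not_flat; lia.
split.
- by exists (fun x => g (sqn x)); exact: minimal_green_green hn m_gt0 gP.
- exact: metric_euclidean_near.
move=> G minG; apply: (smooth_extension_grad hn m_gt0 gP) => x x0.
exact: (minimal_green_unique hn m_gt0 gP minG x0).
Qed.
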